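(* Let $b\geq 1$ be an integer and set $\alpha=\frac1b$. Let $\Lambda\subset\mathbb{C}$ be a unimodular $\mathbb{Z}$-grid, i.e. $\Lambda=z_0+\vec\Lambda$ with $z_0\in\mathbb{C}$ and $\vec\Lambda$ a discrete additive subgroup of $\mathbb{C}$ spanning $\mathbb{C}$ over $\mathbb{R}$ with covolume $1$. Let $\gamma\in\,]0,1[$. For $N\geq1$ define the measure on $\mathbb{C}$ $$\mathcal{R}_N=\frac{\alpha}{N^{2(2-\alpha-\gamma)}}\sum_{\substack{n,m\in\Lambda,\ n\neq m\\ 0<|n|,|m|\leq N}}\ \sum_{\substack{u,v\in\mathbb{C}^*\\ u^b=m,\ v^b=n}}\Delta_{N^\gamma(v-u)},$$ where $\Delta_w$ is the Dirac mass at $w$. Define $\rho:\mathbb{C}\to[0,\infty)$ by $\rho\equiv0$ if $\gamma>1-\alpha$; $\rho\equiv\frac{\pi}{\alpha^2(2-\alpha)}$ if $\gamma<1-\alpha$; and, if $\gamma=1-\alpha$, $$\rho(z)=\frac{\alpha^{\frac{2}{1-\alpha}}}{1-\alpha}|z|^{-\frac{4-2\alpha}{1-\alpha}}\sum_{\substack{p\in\vec\Lambda\\ |p|\leq |z|/\alpha}}|p|^{\frac{2}{1-\alpha}}$$ (with $\rho(0)=0$). Then $\mathcal{R}_N$ converges vaguely to $\rho\,\mathrm{Leb}_{\mathbb{C}}$ as $N\to\infty$, i.e. $\mathcal{R}_N(f)\to\int_{\mathbb{C}}f(z)\rho(z)\,dz$ for every continuous compactly supported $f:\mathbb{C}\t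o\mathbb{C}$.
   Context: $\mathrm{Leb}_{\mathbb{C}}$ denotes Lebesgue measure on $\mathbb{C}$. *)

(* Defs.v *)
From HB Require Import structures.
From mathcomp Require Import all_boot all_order all_algebra.
From mathcomp Require Import complex.
From mathcomp Require Import all_classical all_reals all_analysis.

Set Implicit Arguments.
Unset Strict Implicit.
Unset Printing Implicit Defensive.

Import Order.TTheory GRing.Theory Num.Theory.
Import numFieldNormedType.Exports.
Import Normc.

Local Open Scope classical_set_scope.
Local Open Scope complex_scope.
Local Open Scope ring_scope.

(* The library's [msum] and [mseries] only cover families indexed by nat.     *)
Section measure_esum.
Local Open Scope ereal_scope.
Context d (T : measurableType d) (R : realType) (I : choiceType).
Variables (D : set I) (m : I -> {measure set T -> \bar R}).

Definition mesum (A : set T) : \bar R := \esum_(i in D) m i A.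

Let mesum0 : mesum set0 = 0.
Proof. by rewrite /mesum esum1// => i _; rewrite measure0. Qed.

Let mesum_ge0 A : 0 <= mesum A.
Proof. exact: esum_ge0. Qed.

Let mesum_sigma_additive : semi_sigma_additive mesum.
Proof.
move=> F mF tF mUF; rewrite [X in _ --> X](_ : _ =
    lim ((fun n => \sum_(0 <= i < n) mesum (F i)) @ \oo)).
  by apply: is_cvg_ereal_nneg_natsum => k _; exact: mesum_ge0.
rewrite nneseries_esumT; last by move=> k; exact: mesum_ge0.
rewrite /mesum esum_esum//=.
rewrite (@reindex_esum _ _ _ (D `*`` (fun=> [set: nat])) _
  (fun z : I * nat => (z.2, z.1))) /=; last first.
  split; first by move=> [i k] [/= Di _].
  - by move=> [i k] [j l] _ _ /= [-> ->].
  - by move=> [k i] [_ /= Di]; exists (i, k).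
rewrite -(@esum_esum _ _ _ D (fun=> [set: nat]) (fun i k => m i (F k)))//.
apply: eq_esum => i _; rewrite -nneseries_esumT//.
exact: measure_semi_bigcup.
Qed.

HB.instance Definition _ := isMeasure.Build _ _ _ mesum
  mesum0 mesum_ge0 mesum_sigma_additive.

End measure_esum.

(* Measures on the complex plane are measures on R * R (with its product      *)
(* sigma-algebra, i.e., the Borel sets), along (x, y) |-> x +i* y. As a       *)
(* topological space the complex plane is R[i]^o: the library puts the norm   *)
(* topology on the regular copy of a field and not on R[i] itself.            *)
Notation plane R := (measurableTypeR R * measurableTypeR R)%type.

Section complex_plane.
Context (R : realType).

Definition plane_of_complex (z : R[i]) : plane R := (complex.Re z, complex.Im z).
Definition complex_of_plane (w : plane R) : R[i] := w.1 +i* w.2.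

Definition lebesgue_complex : {measure set (plane R) -> \bar R} :=
  (lebesgue_measure \x lebesgue_measure)%E.

Definition cdirac (z : R[i]) : {measure set (plane R) -> \bar R} :=
  dirac (plane_of_complex z).

Definition cintegral (mu : {measure set (plane R) -> \bar R})
    (f : R[i] -> R[i]) : R[i] :=
  Rintegral mu setT (fun w => complex.Re (f (complex_of_plane w))) +i*
  Rintegral mu setT (fun w => complex.Im (f (complex_of_plane w))).

End complex_plane.

Section lattice.
Context (R : realType).
Implicit Types (L : set R[i]) (D : set (plane R)).

Definition fundamental_domain L D :=
  measurable D /\
  forall z : R[i], exists! p, L p /\ D (plane_of_complex (z - p)).

(* All fundamental domains of a discrete (hence countable) subgroup have the  *)
(* same Lebesgue measure, so that any one of them computes the covolume.      *)
Definition has_covolume L (c : \bar R) :=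
  exists2 D, fundamental_domain L D & lebesgue_complex R D = c.

Definition real_spanning L :=
  forall z : R[i], exists (n : nat) (a : 'I_n -> R) (p : 'I_n -> R[i]),
    (forall i, L (p i)) /\ z = \sum_(i < n) (a i)%:C * p i.

Definition unimodular_lattice L :=
  [/\ zmod_closed (mem L),
      L `<=` isolated (L : set R[i]^o),
      real_spanning L &
      has_covolume L 1%E].

End lattice.

Section pair_correlation.
Context (R : realType) (b : nat) (gamma : R).
Implicit Types (Lambda L : set R[i]) (N : nat) (z : R[i]).

Local Notation alpha := (b%:R^-1 : R).

Definition correlation_pairs Lambda N : set (R[i] * R[i]) :=
  [set nm | [/\ Lambda nm.1, Lambda nm.2, nm.1 != nm.2,
                0 < normc nm.1 <= N%:R & 0 < normc nm.2 <= N%:R]].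

Definition correlation_roots (nm : R[i] * R[i]) : set (R[i] * R[i]) :=
  [set uv | [/\ uv.1 != 0, uv.2 != 0,
                uv.1 ^+ b = nm.2 & uv.2 ^+ b = nm.1]].

Definition pair_correlation Lambda N : {measure set (plane R) -> \bar R} :=
  mscale (alpha / N%:R `^ (2 * (2 - alpha - gamma)))%:nng
    (mesum (correlation_pairs Lambda N) (fun nm =>
      mesum (correlation_roots nm) (fun uv =>
        cdirac ((N%:R `^ gamma)%:C * (uv.2 - uv.1))))).

Definition correlation_density L z : R :=
  if 1 - alpha < gamma then 0
  else if gamma < 1 - alpha then pi / (alpha ^+ 2 * (2 - alpha))
  else if z == 0 then 0
  else alpha `^ (2 / (1 - alpha)) / (1 - alpha)
       * normc z `^ (- ((4 - 2 * alpha) / (1 - alpha)))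
       * \sum_(p \in [set p | L p /\ normc p <= normc z / alpha])
           normc p `^ (2 / (1 - alpha)).

End pair_correlation.

(* Main.v *)
Require Import Defs.
From HB Require Import structures.
From mathcomp Require Import all_boot all_order all_algebra.
From mathcomp Require Import complex.
From mathcomp Require Import all_classical all_reals all_analysis.
From mathcomp Require Import measurable_realfun separable cyclotomic.
From mathcomp Require Import ring lra.
Import Order.TTheory GRing.Theory Num.Theory.
Import numFieldNormedType.Exports.
Import Normc.
Local Open Scope classical_set_scope.
Local Open Scope complex_scope.
Local Open Scope ring_scope.
Set Implicit Arguments.
Unset Strict Implicit.
Unset Printing Implicit Defensive.

(**
Positive and negative parts of the real and imaginary parts reduce the claim to
a nonnegative, uniformly continuous, compactly supported [f].  Put
[t = N^(alpha + gamma - 1)].  If [u ^ b = m] and [v ^ b = m + p] with [m] of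
size [N], then either [v - u] has size [N^alpha] (different determinations of
the root), hence contributes nothing, or [v - u] is close to [u p / (b m)].  With
[y = m / N] and [w ^ b = y] the pair [(m, m + p)] thus contributes
[f (t p w / (b y))], and [R_N f] is a Riemann sum, over the rescaled grid in the
unit disc, of [alpha t^2 sum_(p != 0) sum_(w ^ b = y) f (t p w / (b y))].

If [t] tends to infinity, all terms vanish because [|p|] is bounded below.  If
[t = 1], the limit is the integral over the unit disc of this function of [y].
If [t] tends to [0], the sum over [p] is itself a Riemann sum, with limit
[b^2 |y|^(2 - 2 alpha) int f] for each [w].  The Riemann sums are controlled by
unfolding the Lebesgue integral over a fundamental domain of the lattice.

The integrals over the disc are computed by averaging [f] over rotations: since
the integrals are rotation invariant, [f] may be replaced by a function of
[|z|^2].  The image of Lebesgue measure under [|z|^2] being [pi] times Lebesgue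
measure on the half-line, only the substitution
[s = (|p| / b)^2 r^(alpha - 1)] remains.
*)

(** * Complex numbers and roots *)

(** The comparison of a pair with [f (t p w / (b y))] fails for small [|y|], where [p / m] is not
    small, and near [|y| = 1], where [m + p] may leave the disc. Both zones are cut off at width
    [eta]. There only an upper bound is available: a ball of radius [r] contains [O((1 + r) ^ 2)]
    lattice points, so each [m] contributes [O(t ^ -2)], and the zones have area [O(eta)]. The
    cut-offs are continuous because convergence of Riemann sums is proved for continuous functions.
    The cases [t -> 0] and [t = 1] then share one limit theorem, with an abstract limit function
    [H]. Equidistribution uses no basis of the lattice: the sums over two translates of a fine grid
    are nearly equal, and their mean over a fundamental domain of measure 1 is exactly an integral.
    At [t = 1] the integrand involves the multivalued [w / y], which offers no global change of
    variables. But multiplying [y] by a suitable number of norm 1 turns [w / y] by any prescribed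
    angle, whence the rotation invariance. Rotations are parametrised by the directions of the
    points of the unit disc, so that planar Lebesgue measure suffices. *)

Lemma lerX_nneg (R : realDomainType) n (x y : R) : (0 < n)%N -> 0 <= x -> 0 <= y ->
  (x ^+ n <= y ^+ n) = (x <= y).
Proof. by move=> n0 x0 y0; rewrite ler_pXn2r. Qed.

Section complex_norm.
Context (R : realType).
Implicit Types z w : R[i].

Lemma normcX z n : normc (z ^+ n) = normc z ^+ n.
Proof.
by elim: n => [|n IH]; rewrite ?expr0 ?normc1// !exprS normcM IH.
Qed.

Lemma normc_ge0 z : 0 <= normc z.
Proof. by case: z => a b; rewrite sqrtr_ge0. Qed.

Lemma normc_eq0 z : (normc z == 0) = (z == 0).
Proof. by apply/eqP/eqP => [/eq0_normc|->]; rewrite ?normc0. Qed.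

Lemma normc_gt0 z : (0 < normc z) = (z != 0).
Proof. by rewrite lt_neqAle normc_ge0 andbT eq_sym normc_eq0. Qed.

Lemma normcR (x : R) : normc x%:C = `|x|.
Proof. by rewrite /= expr0n addr0 sqrtr_sqr. Qed.

Lemma normc_nat n : normc (n%:R : R[i]) = n%:R.
Proof. by rewrite -(rmorph_nat (real_complex R)) normcR normr_nat. Qed.

Lemma normcB z w : normc (z - w) = normc (w - z).
Proof. by rewrite -normcN opprB. Qed.

Lemma ler_normcB z w : normc z - normc w <= normc (z - w).
Proof. by rewrite lerBlDr -{1}(subrK w z) le_normcD. Qed.

Lemma ler_dist_normc z w : `|normc z - normc w| <= normc (z - w).
Proof. by rewrite ler_norml lerNl opprB {1}normcB !ler_normcB. Qed.

Lemma ler_normc_sum (I : Type) (s : seq I) (P : pred I) (F : I -> R[i]) :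
  normc (\sum_(i <- s | P i) F i) <= \sum_(i <- s | P i) normc (F i).
Proof.
elim/big_ind2 : _ => [|x1 x2 y1 y2 h1 h2|//]; first by rewrite normc0.
exact: le_trans (le_normcD _ _) (lerD h1 h2).
Qed.

Lemma normc_sqr z : normc z ^+ 2 = complex.Re z ^+ 2 + complex.Im z ^+ 2.
Proof. by case: z => a b /=; rewrite sqr_sqrtr// addr_ge0 ?sqr_ge0. Qed.

Lemma ler_Re_normc z : `|complex.Re z| <= normc z.
Proof.
rewrite -(@ler_pXn2r _ 2) ?nnegrE ?normc_ge0 ?normr_ge0//.
by rewrite normc_sqr real_normK ?num_real// lerDl sqr_ge0.
Qed.

Lemma ler_Im_normc z : `|complex.Im z| <= normc z.
Proof.
rewrite -(@ler_pXn2r _ 2) ?nnegrE ?normc_ge0 ?normr_ge0//.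
by rewrite normc_sqr real_normK ?num_real// lerDr sqr_ge0.
Qed.

Lemma ler_normc_ReIm z : normc z <= `|complex.Re z| + `|complex.Im z|.
Proof.
rewrite -(@ler_pXn2r _ 2) ?nnegrE ?normc_ge0 ?addr_ge0 ?normr_ge0//.
rewrite normc_sqr sqrrD !real_normK ?num_real//.
by rewrite lerD2r lerDl mulrn_wge0 ?mulr_ge0.
Qed.

(** [z ^+ n - w ^+ n] is [z - w] times a sum of [n] products of [n.-1] factors of norm at most [r].
    So close roots have close powers; with real arguments this is a Lipschitz bound. *)
Lemma normc_subX_le n (r : R) z w : normc z <= r -> normc w <= r ->
  normc (z ^+ n - w ^+ n) <= n%:R * r ^+ n.-1 * normc (z - w).
Proof.
move=> zr wr; rewrite subrXX normcM mulrC ler_wpM2r ?normc_ge0//.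
apply: le_trans (ler_normc_sum _ _ _) _.
rewrite -[n in n%:R]card_ord mulr_natl -sumr_const; apply: ler_sum => i _.
rewrite normcM !normcX.
have -> : n.-1 = (n.-1 - i + i)%N by rewrite subnK//; case: n i => [[]|n []].
by rewrite addnK exprD ler_pM ?exprn_ge0 ?normc_ge0// lerXn2r ?nnegrE ?normc_ge0 //;
  apply: le_trans (normc_ge0 _) _; eassumption.
Qed.

End complex_norm.

Section roots.
Context (R : realType) (b : nat).
Hypothesis b_gt0 : (0 < b)%N.
Implicit Types (y w u v x : R[i]).

Lemma poly_root_seq y : exists2 r : seq R[i],
  'X^b - y%:P = \prod_(z <- r) ('X - z%:P) & size r = b.
Proof.
have [r hr] := closed_field_poly_normal ('X^b - y%:P).
move: hr; rewrite lead_coefDl ?size_polyXn ?size_polyN; last first.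
  by rewrite ltnS (leq_trans (size_polyC_leq1 _)).
rewrite lead_coefXn scale1r => hr; exists r => //.
have := congr1 (fun p : {poly R[i]} => size p) hr.
by rewrite size_prod_XsubC size_XnsubC// => -[].
Qed.

(** ['X^b - 1] is separable because [b] is nonzero in characteristic 0, so its [b] roots are
    distinct. *)
Lemma unity_roots_ex : exists U : seq R[i],
  [/\ uniq U, size U = b & forall w, (w \in U) = (w ^+ b == 1)].
Proof.
have [r hr sr] := poly_root_seq 1; exists r; split => //.
  rewrite -separable_prod_XsubC -hr separable_Xn_sub_1//.
  by rewrite pnatr_eq0 -lt0n.
move=> w; rewrite -root_prod_XsubC -hr rootE !hornerE.
by rewrite subr_eq0.
Qed.

Definition unity_roots : seq R[i] := sval (cid unity_roots_ex).

Lemma unity_roots_uniq : uniq unity_roots.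
Proof. by rewrite /unity_roots; case: cid => ? []. Qed.

Lemma size_unity_roots : size unity_roots = b.
Proof. by rewrite /unity_roots; case: cid => ? []. Qed.

Lemma mem_unity_roots w : (w \in unity_roots) = (w ^+ b == 1).
Proof. by rewrite /unity_roots; case: cid => ? []. Qed.

Lemma normc_unity_root w : w ^+ b = 1 -> normc w = 1.
Proof.
move=> /(congr1 (@normc R)); rewrite normcX normc1 => /eqP.
by rewrite pexpr_eq1 ?normc_ge0// => /eqP.
Qed.

(** The roots are listed as multiples of one determination, so that the index list does not depend
    on [y]. At [y = 0] the single root [0] is counted [b] times. *)
Definition sum_roots (V : nmodType) (y : R[i]) (g : R[i] -> V) : V :=
  \sum_(w <- unity_roots) g (b.-root y * w).

Lemma perm_unity_roots x : x ^+ b = 1 ->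
  perm_eq [seq x * w | w <- unity_roots] unity_roots.
Proof.
move=> xb; have x0 : x != 0 by rewrite -normc_gt0 (normc_unity_root xb).
apply: uniq_perm; rewrite ?unity_roots_uniq//.
  by rewrite map_inj_uniq ?unity_roots_uniq//; exact: mulfI.
move=> w; rewrite mem_unity_roots; apply/mapP/eqP.
  by move=> [v]; rewrite mem_unity_roots => /eqP vb ->; rewrite exprMn xb vb mul1r.
move=> wb; exists (x^-1 * w); last by rewrite mulrA divff ?mul1r.
by rewrite mem_unity_roots exprMn exprVn xb wb invr1 mulr1.
Qed.

(** Two determinations differ by a root of unity, and multiplication by it permutes [unity_roots]:
    the choice made by [b.-root] does not matter. This allows the roots at different points to be
    matched without a continuous determination. *)
Lemma sum_rootsE (V : nmodType) (g : R[i] -> V) u y : u ^+ b = y -> y != 0 ->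
  sum_roots y g = \sum_(w <- unity_roots) g (u * w).
Proof.
move=> uy y0; set r := b.-root y; have ry : r ^+ b = y by exact: rootCK.
have r0 : r != 0 by apply: contra_neq y0 => r0; rewrite -ry r0 expr0n; case: b b_gt0.
rewrite /sum_roots -/r.
have xb : (u / r) ^+ b = 1 by rewrite exprMn exprVn uy ry divff.
rewrite -(perm_big _ (perm_unity_roots xb))/= big_map.
by apply: eq_bigr => w _; rewrite mulrA [_ * (u / r)]mulrC divfK.
Qed.

Lemma fsbig_roots (V : nmodType) (g : R[i] -> V) y : y != 0 ->
  \sum_(w \in [set w | w ^+ b = y]) g w = sum_roots y g.
Proof.
move=> y0; set r := b.-root y; have ry : r ^+ b = y by exact: rootCK.
have r0 : r != 0 by apply: contra_neq y0 => r0; rewrite -ry r0 expr0n; case: b b_gt0.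
have ur : uniq [seq r * w | w <- unity_roots].
  by rewrite map_inj_uniq ?unity_roots_uniq//; exact: mulfI.
rewrite /sum_roots -/r -(big_map (fun w => r * w) predT g) [RHS](fsbig_seq _ _ ur).
apply: eq_fsbigl; apply/seteqP; split => w /=.
  move=> wy; apply/mapP; exists (r^-1 * w); last by rewrite mulrA divff ?mul1r.
  by rewrite mem_unity_roots exprMn exprVn ry wy mulVf.
move=> /mapP[v]; rewrite mem_unity_roots => /eqP vb ->.
by rewrite exprMn ry vb mulr1.
Qed.

Lemma finite_roots y : finite_set [set w : R[i] | w ^+ b = y].
Proof.
have [r hr _] := poly_root_seq y.
apply: (sub_finite_set (B := [set` r])); last exact: finite_seq.
move=> w /= wy; rewrite -root_prod_XsubC -hr rootE !hornerE wy.
by rewrite subrr.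
Qed.

Lemma sum_roots_cst (V : nmodType) y (c : V) : sum_roots y (fun=> c) = c *+ b.
Proof. by rewrite /sum_roots big_const_seq count_predT size_unity_roots -Monoid.iteropE. Qed.

Lemma eq_sum_roots (V : nmodType) y (g h : R[i] -> V) :
  (forall w, w ^+ b = y -> g w = h w) -> sum_roots y g = sum_roots y h.
Proof.
move=> gh; rewrite /sum_roots; apply: eq_big_seq => w.
rewrite mem_unity_roots => /eqP w1; apply: gh.
by rewrite exprMn w1 mulr1 rootCK.
Qed.

Lemma ler_sum_roots y (g h : R[i] -> R) :
  (forall w, w ^+ b = y -> g w <= h w) -> sum_roots y g <= sum_roots y h.
Proof.
move=> gh; rewrite /sum_roots big_seq_cond [leRHS]big_seq_cond; apply: ler_sum => w.
rewrite andbT mem_unity_roots => /eqP w1; apply: gh.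
by rewrite exprMn w1 mulr1 rootCK.
Qed.

(* The roots of [X ^ b - (1 + e)] multiply at [X = 1] to [+- e], so that one  *)
(* of them is close to [1]; a first order expansion then improves the bound.  *)
Lemma near_root_ex : exists e0 K c0 : R, [/\ 0 < e0, 0 < K, 0 < c0 &
  forall e : R[i], normc e <= e0 -> exists x : R[i],
    [/\ x ^+ b = 1 + e, normc (x - 1) <= 2 * normc e,
        normc (x - 1 - e / b%:R) <= K * normc e ^+ 2 &
        forall w, w ^+ b = 1 -> w != 1 -> c0 <= normc (x * w - 1)]].
Proof.
(* [d0 * 2 ^ b = 1 / 2]: within distance [d0] of [1], the terms of degree at least 2 in the
   expansion of [x ^ b] are at most half that distance. *)
pose d0 : R := 2^-1 ^+ b.+1.
have d0_gt0 : 0 < d0 by rewrite exprn_gt0.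
have d0_lt1 : d0 < 1 by rewrite exprn_ilt1//; lra.
have [c1 c1_gt0 c1P] : exists2 c1 : R, 0 < c1 &
    forall w, w ^+ b = 1 -> w != 1 -> c1 <= normc (w - 1).
  (* The initial value [1] keeps the minimum positive when [b = 1] and there is no other root of
     unity. *)
  exists (\big[Num.min/1]_(w <- unity_roots | w != 1) normc (w - 1)).
    by apply: lt_bigmin => // w w1; rewrite normc_gt0 subr_eq0.
  by move=> w wb w1; apply: ge_bigmin_seq; rewrite // mem_unity_roots wb.
(* The other half of the gap absorbs the displacement [|x - 1| <= 2 |e| <= c0]. *)
pose c0 : R := c1 / 2.
pose e0 : R := Num.min (d0 ^+ b) (c0 / 2).
have e0_gt0 : 0 < e0 by rewrite lt_min exprn_gt0//= !divr_gt0.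
exists e0, (2 ^+ b * 4), c0; split => //; rewrite ?divr_gt0 ?mulr_gt0 ?exprn_gt0//.
move=> e; rewrite le_min => /andP[ee0 ee1].
have [r hr sr] := poly_root_seq (1 + e).
have [x xr xd] : exists2 x, x \in r & normc (x - 1) <= d0.
  (* Otherwise all [b] linear factors, evaluated at [1], have norm above [d0], and so their product
     [- e] has norm above [d0 ^ b]. *)
  apply: contrapT => H.
  have : d0 ^+ b < normc (\prod_(z <- r) (1 - z)).
    have {H} : all (fun z => d0 < normc (1 - z)) r.
      apply/allP => z zr; rewrite ltNge; apply/negP => hz; apply: H.
      by exists z; rewrite // normcB.
    rewrite -sr; case: (r) sr => [/esym b0|z s _]; first by move: (b_gt0); rewrite b0.
    elim: s z => [|z' s IH] z.
      by rewrite /= big_seq1 expr1 andbT.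
    move=> /andP[zd /IH{}IH]; rewrite big_cons normcM exprS.
    by apply: ltr_pM; rewrite ?exprn_ge0// ltW.
  have := congr1 (fun p : {poly R[i]} => p.[1]) hr.
  rewrite horner_prod !hornerE expr1n.
  under eq_bigr do rewrite !hornerE.
  by rewrite opprD addrA subrr add0r => <-; rewrite normcN ltNge ee0.
have xb : x ^+ b = 1 + e.
  move: xr; rewrite -root_prod_XsubC -hr rootE !hornerE subr_eq0.
  by move=> /eqP.
pose d := x - 1.
have xE : x = d + 1 by rewrite subrK.
(* Binomial expansion of [(1 + d) ^ b]: [q] collects the terms of degree at least 2, and its norm is
   at most the sum of all binomial coefficients. *)
have [q dq qle] : exists2 q, e = b%:R * d + d ^+ 2 * q & normc q <= 2 ^+ b.
  have -> : e = x ^+ b - 1 by rewrite xb addrC addKr.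
  rewrite xE [d + 1]addrC exprDn.
  exists (\sum_(i < b.+1 | (1 < i)%N) (d ^+ (i - 2)) *+ 'C(b, i)).
    rewrite (bigD1 ord0)//= expr1n mul1r expr0 bin0 mulr1n addrAC subrr add0r.
    have b1 : (1 < b.+1)%N by rewrite ltnS.
    rewrite (bigD1 (Ordinal b1))//= expr1n mul1r expr1 bin1 mulr_natl; congr (_ + _).
    rewrite mulr_sumr; apply: eq_big => [i|i].
      by case: i => [[|[|i]] hi].
    move=> /andP[i0 i1]; rewrite expr1n mul1r mulrnAr -exprD subnKC//.
    by case: i i0 i1 => [[|[|i]] hi].
  apply: le_trans (ler_normc_sum _ _ _) _.
  have -> : (2 : R) ^+ b = \sum_(i < b.+1) 'C(b, i)%:R.
    rewrite -[2]/(1 + 1) exprDn; apply: eq_bigr => i _.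
    by rewrite !expr1n mulr1.
  rewrite big_mkcond; apply: ler_sum => i _; case: ifP => // _.
  rewrite -[_ *+ _]mulr_natr normcM normc_nat ler_piMl// normcX.
  by rewrite exprn_ile1 ?normc_ge0// ltW// (le_lt_trans xd).
have bR : 1 <= b%:R :> R by rewrite ler1n.
have bC0 : b%:R != 0 :> R[i] by rewrite pnatr_eq0 -lt0n.
have dqle : normc (d ^+ 2 * q) <= 2^-1 * normc d.
  rewrite normcM normcX expr2 -mulrA mulrC ler_wpM2r ?normc_ge0//.
  have : d0 * 2 ^+ b = 2^-1.
    rewrite /d0 exprSr mulrAC -exprMn mulVf ?expr1n ?mul1r//.
  by move=> <-; apply: ler_pM; rewrite ?normc_ge0.
(* The linear term [b d] has norm at least [|d|], and the remainder takes away at most half of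
   it. *)
have d2 : normc d <= 2 * normc e.
  have : b%:R * normc d - 2^-1 * normc d <= normc e.
    have := ler_normcB (b%:R * d) (- (d ^+ 2 * q)).
    rewrite opprK -dq normcN normcM normc_nat => /(le_trans _); apply.
    by rewrite lerD2l lerN2.
  have := normc_ge0 d; nra.
exists x; split => //.
- have -> : x - 1 - e / b%:R = - (d ^+ 2 * q / b%:R).
    by rewrite -/d dq; field.
  rewrite normcN normcM normcV normc_nat.
  apply: (@le_trans _ _ (normc (d ^+ 2 * q))).
    by rewrite ler_piMr ?normc_ge0// invf_le1// (lt_le_trans ltr01).
  rewrite normcM normcX mulrC -mulrA.
  have : normc d ^+ 2 <= 4 * normc e ^+ 2.
    by have := normc_ge0 d; have := normc_ge0 e; nra.
  by move=> ?; rewrite ler_pM ?normc_ge0 ?exprn_ge0 ?normc_ge0.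
- move=> w wb w1; have hw := c1P _ wb w1.
  have -> : x * w - 1 = (w - 1) - (- (d * w)) by rewrite xE; ring.
  apply: le_trans (ler_normcB _ _).
  rewrite normcN normcM (normc_unity_root wb) mulr1.
  by move: ee1 hw d2; rewrite /c0; lra.
Qed.

End roots.

(** * Lattices *)

Section fsums.
Context (R : realType) (I : choiceType).
Implicit Types (A : set I) (F G : I -> R).

Lemma ler_fsum A F G : finite_set A -> (forall p, A p -> F p <= G p) ->
  \sum_(p \in A) F p <= \sum_(p \in A) G p.
Proof.
move=> fA FG; rewrite !fsbig_finite//= big_seq [leRHS]big_seq; apply: ler_sum => p.
by rewrite in_fset_set// inE => /FG.
Qed.

Lemma ler_norm_fsum A F : finite_set A ->
  `|\sum_(p \in A) F p| <= \sum_(p \in A) `|F p|.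
Proof. by move=> fA; rewrite !fsbig_finite//= ler_norm_sum. Qed.

Lemma fsum_bound A F (M : R) : finite_set A -> (forall p, A p -> `|F p| <= M) ->
  `|\sum_(p \in A) F p| <= M * \sum_(p \in A) (1 : R).
Proof.
move=> fA FM; apply: le_trans (ler_norm_fsum _ fA) _.
by rewrite mulr_fsumr; apply: ler_fsum => // p Ap; rewrite mulr1 FM.
Qed.

Lemma ler_fsum_subset A B F : finite_set B -> A `<=` B ->
  (forall p, B p -> 0 <= F p) -> \sum_(p \in A) F p <= \sum_(p \in B) F p.
Proof.
move=> fB AB F0; have fA := sub_finite_set AB fB.
rewrite (fsbigID A B)// setIidr// lerDl; apply: fsumr_ge0 => // p [].
by move=> /F0.
Qed.

Lemma fsumB A F G : finite_set A ->
  \sum_(p \in A) (F p - G p) = \sum_(p \in A) F p - \sum_(p \in A) G p.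
Proof. by move=> fA; rewrite !fsbig_finite//= sumrB. Qed.

End fsums.

Section lattice_geometry.
Context (R : realType) (L : set R[i]).
Hypothesis hL : unimodular_lattice L.
Implicit Types p q x a : R[i].

Lemma lattice0 : L 0.
Proof. by case: hL => -[/=]; rewrite inE. Qed.

Lemma latticeB p q : L p -> L q -> L (p - q).
Proof.
case: hL => -[_ hB] _ _ _ Lp Lq.
by have := hB p q; rewrite !inE; exact.
Qed.

Lemma latticeN p : L p -> L (- p).
Proof. by move=> Lp; rewrite -sub0r; apply: latticeB => //; exact: lattice0. Qed.

Lemma latticeD p q : L p -> L q -> L (p + q).
Proof. by move=> Lp Lq; rewrite -(opprK q); apply: latticeB => //; exact: latticeN. Qed.

Lemma latticeMn p n : L p -> L (p *+ n).
Proof.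
move=> Lp; elim: n => [|n IH]; first exact: lattice0.
by rewrite mulrS; apply: latticeD.
Qed.

Lemma latticeMz p (n : int) : L p -> L (p *~ n).
Proof. by case: n => n Lp; [exact: latticeMn | apply: latticeN; exact: latticeMn]. Qed.

Lemma lattice_sum (n : nat) (p : 'I_n -> R[i]) :
  (forall i, L (p i)) -> L (\sum_(i < n) p i).
Proof.
move=> Lp; elim/big_ind: _ => //; first exact: lattice0.
by move=> *; apply: latticeD.
Qed.

Lemma lattice_gap : exists2 d : R, 0 < d & forall p, L p -> p != 0 -> d <= normc p.
Proof.
case: hL => _ iL _ _; have [_ [V]] := iL _ lattice0.
move=> /nbhs_normP[e /= e0 eV] VL.
(* The radius of a ball in [R[i]] is itself a complex number; being positive, it is real. *)
have [e1 e2] : complex.Im e = 0 /\ 0 < complex.Re e.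
  by move: e0; rewrite ltcE => /andP[/eqP ? ?].
exists (complex.Re e) => // p Lp p0; rewrite leNgt; apply/negP => pe.
suff : (V `&` L) p by rewrite VL/= => /eqP; rewrite (negbTE p0).
split => //; apply: eV; rewrite /= sub0r normrN.
by rewrite /Num.norm/= ltcE/= e1 eqxx/=.
Qed.

(** Write [1] and ['i] as real combinations of lattice vectors. Rounding down the coefficients of
    their real multiples moves a point by at most the sum of the norms of these vectors. *)
Lemma lattice_cocompact : exists2 C : R, 0 <= C & forall x, exists2 q, L q & normc (x - q) <= C.
Proof.
case: hL => _ _ sL _.
have approx z : exists2 C : R, 0 <= C &
    forall t : R, exists2 q, L q & normc (t%:C * z - q) <= C.
  have [n [c [p [Lp ->]]]] := sL z.
  exists (\sum_(i < n) normc (p i)).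
    by apply: sumr_ge0 => i _; exact: normc_ge0.
  move=> t; exists (\sum_(i < n) p i *~ Num.floor (t * c i)).
    by apply: lattice_sum => i; exact: latticeMz.
  rewrite mulr_sumr -sumrB; apply: le_trans (ler_normc_sum _ _ _) _.
  apply: ler_sum => i _; rewrite mulrA -rmorphM/= -mulrzr.
  have -> : (Num.floor (t * c i))%:~R = ((Num.floor (t * c i))%:~R)%:C :> R[i].
    by rewrite rmorph_int.
  rewrite [p i * _]mulrC -mulrBl -rmorphB/= normcM normcR.
  rewrite ler_piMl ?normc_ge0// ger0_norm ?subr_ge0 ?floor_le//.
  by rewrite lerBlDl ltW// -intrD1 floorD1_gt.
have [C1 C10 hC1] := approx 1; have [C2 C20 hC2] := approx 'i%C.
exists (C1 + C2); rewrite ?addr_ge0// => x.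
have [q1 Lq1 h1] := hC1 (complex.Re x); have [q2 Lq2 h2] := hC2 (complex.Im x).
exists (q1 + q2); first exact: latticeD.
have -> : x - (q1 + q2) =
    ((complex.Re x)%:C * 1 - q1) + ((complex.Im x)%:C * 'i%C - q2).
  by rewrite {1}(complexE x); ring.
exact: le_trans (le_normcD _ _) (lerD h1 h2).
Qed.

(** Pigeonhole: two lattice points in one square of side [d / 2] would be closer than the minimal
    distance [d]. The constant does not depend on the centre [a], so the bound also serves
    translated grids. *)
Lemma lattice_count : exists2 K : R, 0 < K & forall a (r : R), 0 <= r ->
  finite_set [set p | L p /\ normc (p - a) <= r] /\
  \sum_(p \in [set p | L p /\ normc (p - a) <= r]) (1 : R) <= K * (1 + r) ^+ 2.
Proof.
have [d d0 gap] := lattice_gap; pose s := 2 / d.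
have s0 : 0 < s by rewrite divr_gt0.
exists ((2 * (s + 1)) ^+ 2); first by rewrite exprn_gt0// mulr_gt0// addr_gt0.
move=> a r r0; set A := [set p | _].
(* Shifting the floors by [k] makes the cell indices run from [0] to [2 k - 1]. *)
pose k := (Num.truncn (s * r)).+1.
have kr : s * r < k%:R by rewrite truncnS_gt.
have cell (t : R) : `|t| <= r -> (0 <= Num.floor (s * t) + k%:Z < (k + k)%:Z)%R.
  rewrite ler_norml => /andP[t1 t2].
  have h1 : - k%:R < s * t.
    by apply: lt_le_trans (_ : - (s * r) <= _); rewrite ?ltrN2// -mulrN ler_pM2l.
  have h2 : s * t < k%:R by apply: le_lt_trans kr; rewrite ler_pM2l.
  rewrite -lerBlDr sub0r floor_ge_int rmorphN/= ltW//=.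
  by rewrite PoszD ltrD2r floor_lt_int.
pose X (t : R) := absz (Num.floor (s * t) + k%:Z)%R.
have X_lt t : `|t| <= r -> (X t < k + k)%N.
  move=> /cell /andP[h1 h2]; rewrite /X -ltz_nat gez0_abs//.
have X_inj t u : `|t| <= r -> `|u| <= r -> X t = X u -> `|t - u| < d / 2.
  move=> /cell /andP[t1 t2] /cell/andP[u1 u2] /(congr1 Posz).
  rewrite /X !gez0_abs// => /addIr tu.
  have : `|s * t - s * u| < 1.
    rewrite ltr_norml; have := floor_le (s * t); have := floorD1_gt (s * t).
    have := floor_le (s * u); have := floorD1_gt (s * u).
    by rewrite tu !intrD; lra.
  rewrite -mulrBr normrM gtr0_norm// /s mulrC -ltr_pdivlMr ?divr_gt0//.
  by rewrite mul1r invf_div.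
pose phi p := (X (complex.Re (p - a)), X (complex.Im (p - a))).
have phi_inj : {in A &, injective phi}.
  move=> p q; rewrite !inE => -[Lp pa] [Lq qa] [hx hy].
  apply/eqP; rewrite -subr_eq0; apply/negPn/negP => pq.
  have := gap _ (latticeB Lp Lq) pq; rewrite leNgt => /negP; apply.
  have -> : p - q = (p - a) - (q - a) by ring.
  apply: le_lt_trans (ler_normc_ReIm _) _.
  have := X_inj _ _ (le_trans (ler_Re_normc _) pa) (le_trans (ler_Re_normc _) qa) hx.
  have := X_inj _ _ (le_trans (ler_Im_normc _) pa) (le_trans (ler_Im_normc _) qa) hy.
  have ReB (z w : R[i]) : complex.Re (z - w) = complex.Re z - complex.Re w.
    by case: z w => ? ? [].
  have ImB (z w : R[i]) : complex.Im (z - w) = complex.Im z - complex.Im w.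
    by case: z w => ? ? [].
  by rewrite [complex.Re (p - a - _)]ReB [complex.Im (p - a - _)]ImB; lra.
pose W := [seq (i, j) | i <- iota 0 (k + k), j <- iota 0 (k + k)].
have phiW p : A p -> phi p \in W.
  move=> [Lp pa]; apply/allpairsP; exists (phi p); split => //.
  - by rewrite mem_iota add0n X_lt// (le_trans (ler_Re_normc _)).
  - by rewrite mem_iota add0n X_lt// (le_trans (ler_Im_normc _)).
have fA : finite_set A.
  have fi : finite_set (phi @` A).
    apply: (sub_finite_set (B := [set` W])); last exact: finite_seq.
    by move=> _ [p Ap <-]/=; exact: phiW.
  by move: fi; rewrite (eq_finite_set (inj_card_eq phi_inj)).
split=> //; rewrite fsbig_finite//= big_const_seq count_predT.
have -> (n : nat) : iter n (+%R 1) 0 = n%:R :> R by elim: n => //= n ->; rewrite mulrS.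
have sz : (size (finmap.enum_fset (fset_set A)) <= (k + k) * (k + k))%N.
  have -> : ((k + k) * (k + k))%N = size W by rewrite size_allpairs !size_iota.
  rewrite -(size_map phi); apply: uniq_leq_size.
    rewrite map_inj_in_uniq ?finmap.fset_uniq// => p q pA qA.
    by apply: phi_inj; rewrite -in_fset_set.
  move=> _ /mapP[p pA ->]; apply: phiW.
  by apply: set_mem; rewrite -in_fset_set.
apply: (@le_trans _ _ ((k + k) * (k + k))%:R); first by rewrite ler_nat.
rewrite natrM natrD -exprMn -expr2 ler_pXn2r ?nnegrE ?addr_ge0 ?mulr_ge0 ?ltW//.
- have : k%:R <= s * r + 1 by rewrite /k -natr1 lerD2r truncn_le// mulr_ge0// ltW.
  by have := mulr_ge0 (ltW s0) r0; nra.
- lra.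
- lra.
Qed.

End lattice_geometry.

(** * Lebesgue measure on the plane *)

Section lebesgue_affine.
Context (R : realType).
Local Notation mu := (@lebesgue_measure R).
Local Open Scope ereal_scope.

Lemma affine_measurable (s t : R) : measurable_fun [set: measurableTypeR R]
  (fun x : measurableTypeR R => (s * x + t)%R : measurableTypeR R).
Proof.
by apply: measurable_funD => //; apply: measurable_funM => //; exact: measurable_cst.
Qed.

(** [|s|] times the image measure gives every half-open interval its length, which characterises
    Lebesgue measure. For [s < 0] the preimage of such an interval is half-open on the other
    side. *)
Lemma lebesgue_affine (s t : R) (A : set R) : s != 0%R -> measurable A ->
  mu ((fun x => (s * x + t)%R) @^-1` A) = (`|s|^-1)%:E * mu A.
Proof.
move=> s0 mA; pose h := fun x : measurableTypeR R => (s * x + t)%R : measurableTypeR R.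
have mh : measurable_fun [set: measurableTypeR R] h by exact: affine_measurable.
have sE : `|s|%:E != 0 by rewrite eqe normr_eq0.
pose m' := mscale (NngNum (normr_ge0 s))
  (measure_function_pushforward__canonical__measure_function_Measure mu mh).
suff -> : mu A = m' A.
  by rewrite /m' /mscale/= muleA -EFinM mulVf ?normr_eq0// mul1e.
apply: lebesgue_measure_unique => // X /ocitvP[->|[[a b] /= ab ->]].
  by rewrite !measure0.
rewrite /m' /mscale/= /pushforward.
have [sp|sn|/eqP] := ltgtP 0%R s; last by rewrite eq_sym (negbTE s0).
- have -> : h @^-1` `]a, b]%classic = `]((a - t) / s)%R, ((b - t) / s)%R]%classic.
    apply/seteqP; split => x; rewrite /= !in_itv/= /h.
      by rewrite ltr_pdivrMr// ler_pdivlMr// [(x * s)%R]mulrC ltrBlDr lerBrDr.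
    by rewrite ltr_pdivrMr// ler_pdivlMr// [(x * s)%R]mulrC ltrBlDr lerBrDr.
  rewrite !lebesgue_measure_itv/= !lte_fin ab ltr_pM2r ?invr_gt0// ltrD2r ab.
  rewrite gtr0_norm// -!EFinB -EFinM -mulrBl mulrC divfK//.
  by congr (_%:E); ring.
- have -> : h @^-1` `]a, b]%classic = `[((b - t) / s)%R, ((a - t) / s)%R[%classic.
    apply/seteqP; split => x; rewrite /= !in_itv/= /h.
      by rewrite ler_ndivrMr// ltr_ndivlMr// [(x * s)%R]mulrC ltrBlDr lerBrDr andbC.
    by rewrite ler_ndivrMr// ltr_ndivlMr// [(x * s)%R]mulrC ltrBlDr lerBrDr andbC.
  rewrite !lebesgue_measure_itv/= !lte_fin ab ltr_nM2r ?invr_lt0// ltrD2r ab.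
  rewrite ltr0_norm// -!EFinB -EFinM -mulrBl mulrC mulrN divfK//.
  by congr (_%:E); ring.
Qed.

Lemma ge0_integral_affine (g : R -> \bar R) (s t : R) : s != 0%R ->
  measurable_fun [set: R] g -> (forall x, 0 <= g x) ->
  \int[mu]_x g (s * x + t)%R = (`|s|^-1)%:E * \int[mu]_x g x.
Proof.
move=> s0 mg g0; pose h := fun x : measurableTypeR R => (s * x + t)%R : measurableTypeR R.
have mh : measurable_fun [set: measurableTypeR R] h by exact: affine_measurable.
have := @ge0_integral_pushforward _ _ _ _ R h mh mu setT g measurableT mg.
rewrite preimage_setT => <-; last by move=> x _; exact: g0.
have nn : (0 <= `|s|^-1)%R by rewrite invr_ge0.
rewrite -(ge0_integral_mscale _ _ (NngNum nn))//.
apply: eq_measure_integral => A mA _.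
by rewrite /mscale/= /pushforward lebesgue_affine.
Qed.

End lebesgue_affine.

Section plane_lebesgue.
Context (R : realType).
Local Notation mu := (@lebesgue_measure R).
Local Notation Leb := (lebesgue_complex R).
Local Notation cop := (@complex_of_plane R).
Local Notation P := (plane R).
Local Open Scope ereal_scope.
Implicit Types G : P -> \bar R.

Lemma measurable_fun_lin (a b c : R) :
  measurable_fun [set: P] (fun w : P => (a * w.1 + b * w.2 + c)%R : measurableTypeR R).
Proof.
apply: measurable_funD => //; apply: measurable_funD => //;
  apply: measurable_funM => //; by [exact: measurable_fst|exact: measurable_snd].
Qed.

Lemma measurable_fun_lin2 G (a b c a' b' c' : R) : measurable_fun [set: P] G ->
  measurable_fun [set: P] (fun w : P =>
    G ((a * w.1 + b * w.2 + c)%R, (a' * w.1 + b' * w.2 + c')%R)).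
Proof.
move=> mG; apply: (measurableT_comp mG).
by apply: measurable_fun_pair; exact: measurable_fun_lin.
Qed.

(** Multiplication by [a + i b] is decomposed into maps that change one coordinate at a time, to
    which the affine formula applies under Tonelli's theorem. The factors [|a|] and
    [(a ^ 2 + b ^ 2) / |a|] multiply to the squared norm. *)
Lemma ge0_integral_plane_lin G (a b : R) : (a, b) != (0, 0)%R ->
  measurable_fun [set: P] G -> (forall w, 0 <= G w) ->
  \int[Leb]_w G ((a * w.1 - b * w.2)%R, (b * w.1 + a * w.2)%R) =
  ((a ^+ 2 + b ^+ 2)^-1)%:E * \int[Leb]_w G w.
Proof.
move=> ab0 mG G0.
have mG1 (y : R) : measurable_fun [set: measurableTypeR R] (fun x => G (x, y)).
  exact: measurable_fun_pair1.
have mG2 (x : R) : measurable_fun [set: measurableTypeR R] (fun y => G (x, y)).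
  exact: measurable_fun_pair2.
have mgen (p q r s : R) : measurable_fun [set: P]
    (fun w : P => G ((p * w.1 + q * w.2)%R, (r * w.1 + s * w.2)%R)).
  have := measurable_fun_lin2 p q 0 r s 0 mG.
  by under eq_fun do rewrite !addr0.
have mF : measurable_fun [set: P]
    (fun w : P => G ((a * w.1 - b * w.2)%R, (b * w.1 + a * w.2)%R)).
  by have := mgen a (- b)%R b a; under eq_fun do rewrite mulNr.
rewrite /lebesgue_complex [in RHS]fubini_tonelli1//=.
have [a0|a0] := eqVneq a 0%R.
(* For [a = 0] the map exchanges the coordinates, scaling them by [b] and [- b]. *)
- have b0 : b != 0%R by move: ab0; rewrite a0 xpair_eqE eqxx.
  rewrite fubini_tonelli1//= /fubini_F/=.
  transitivity (\int[mu]_x ((`|b|^-1)%:E * \int[mu]_y G (y, (b * x)%R))).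
    apply: eq_integral => x _.
    transitivity (\int[mu]_y (fun y' => G (y', (b * x)%R)) (- b * y + 0)%R).
      by apply: eq_integral => y _; rewrite a0 !mul0r sub0r !addr0 mulNr.
    by rewrite (@ge0_integral_affine R (fun y' => G (y', (b * x)%R))) ?oppr_eq0 ?normrN//;
      exact: mG1.
  have mH : measurable_fun [set: P] (fun w : P => G (w.2, (b * w.1)%R)).
    have := mgen 0%R 1%R b 0%R.
    by under eq_fun do rewrite !mul0r add0r mul1r addr0.
  rewrite ge0_integralZl//; last 2 first.
  - exact: (@measurable_fun_fubini_tonelli_F _ _ _ _ _ mu (fun w : P => G (w.2, (b * w.1)%R))).
  - by move=> x _; exact: integral_ge0.
  rewrite (fubini_tonelli _ mH (fun w => G0 _))/=.
  transitivity ((`|b|^-1)%:E * \int[mu]_y ((`|b|^-1)%:E * \int[mu]_x G (y, x))).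
    congr (_ * _); apply: eq_integral => y _.
    transitivity (\int[mu]_x (fun x' => G (y, x')) (b * x + 0)%R).
      by apply: eq_integral => x _; rewrite addr0.
    by rewrite (@ge0_integral_affine R (fun x' => G (y, x')))//; exact: mG2.
  rewrite ge0_integralZl//; last 2 first.
  - exact: measurable_fun_fubini_tonelli_F.
  - by move=> x _; exact: integral_ge0.
  rewrite muleA -EFinM a0 expr0n/= add0r -invfM -normrM -expr2.
  by rewrite ger0_norm ?sqr_ge0.
(* With [x' = a x - b y] the second coordinate is [(b / a) x' + (n2 / a) y]: substitute [x] at fixed
   [y], then [y] at fixed [x']. *)
- set n2 := (a ^+ 2 + b ^+ 2)%R.
  have n20 : (0 < n2)%R.
    by rewrite ltr_pwDl ?sqr_ge0// exprn_even_gt0.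
  rewrite fubini_tonelli2//= /fubini_G/=.
  have mH : measurable_fun [set: P]
      (fun w : P => G (w.1, (b / a * w.1 + n2 / a * w.2)%R)).
    have := mgen 1%R 0%R (b / a)%R (n2 / a)%R.
    by under eq_fun do rewrite mul0r mul1r addr0.
  transitivity (\int[mu]_y ((`|a|^-1)%:E *
      \int[mu]_x G (x, (b / a * x + n2 / a * y)%R))).
    apply: eq_integral => y _.
    transitivity (\int[mu]_x
        (fun x' => G (x', (b / a * x' + n2 / a * y)%R)) (a * x + (- (b * y)))%R).
      apply: eq_integral => x _ /=; congr (G (_, _)).
      by rewrite /n2; field.
    rewrite (@ge0_integral_affine R (fun x' => G (x', (b / a * x' + n2 / a * y)%R)))//.
    exact: (@measurable_fun_pair1 _ _ _ _ _ _
      (fun w : P => G (w.1, (b / a * w.1 + n2 / a * w.2)%R)) y).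
  rewrite ge0_integralZl//; last 2 first.
  - exact: (@measurable_fun_fubini_tonelli_G _ _ _ _ _ mu
    (fun w : P => G (w.1, (b / a * w.1 + n2 / a * w.2)%R))).
  - by move=> x _; exact: integral_ge0.
  rewrite -(fubini_tonelli _ mH (fun w => G0 _))/=.
  transitivity ((`|a|^-1)%:E * \int[mu]_x ((`|n2 / a|^-1)%:E * \int[mu]_y G (x, y))).
    congr (_ * _); apply: eq_integral => x _.
    transitivity (\int[mu]_y (fun y' => G (x, y')) (n2 / a * y + b / a * x)%R).
      by apply: eq_integral => y _; rewrite addrC.
    by rewrite (@ge0_integral_affine R (fun y' => G (x, y')))//;
      [rewrite mulf_neq0 ?invr_eq0// gt_eqF|exact: mG2].
  rewrite ge0_integralZl//; last 2 first.
  - exact: measurable_fun_fubini_tonelli_F.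
  - by move=> x _; exact: integral_ge0.
  rewrite muleA -EFinM; congr (_%:E * _).
  rewrite normrM normfV invfM invrK mulrCA mulrC mulVf ?normr_eq0// ?mulr1 ?mul1r.
  by rewrite gtr0_norm.
Qed.

Lemma ge0_integral_plane_shift G (a b : R) :
  measurable_fun [set: P] G -> (forall w, 0 <= G w) ->
  \int[Leb]_w G ((w.1 + a)%R, (w.2 + b)%R) = \int[Leb]_w G w.
Proof.
move=> mG G0.
have mF : measurable_fun [set: P] (fun w : P => G ((w.1 + a)%R, (w.2 + b)%R)).
  have := measurable_fun_lin2 1 0 a 0 1 b mG.
  by under eq_fun do rewrite !mul1r !mul0r add0r addr0.
have mH : measurable_fun [set: P] (fun w : P => G ((w.1 + a)%R, w.2)).
  have := measurable_fun_lin2 1 0 a 0 1 0 mG.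
  by under eq_fun do rewrite !mul1r !mul0r add0r !addr0.
rewrite /lebesgue_complex fubini_tonelli1//= /fubini_F/=.
transitivity (\int[mu]_x \int[mu]_y G ((x + a)%R, y)).
  apply: eq_integral => x _.
  transitivity (\int[mu]_y (fun y' => G ((x + a)%R, y')) (1 * y + b)%R).
    by apply: eq_integral => y _; rewrite mul1r.
  rewrite (@ge0_integral_affine R (fun y' => G ((x + a)%R, y'))) ?oner_eq0//;
    last exact: measurable_fun_pair2.
  by rewrite normr1 invr1 mul1e.
rewrite [in RHS](fubini_tonelli1 _ mG G0) /fubini_F/=.
transitivity (\int[mu]_x (fun x' => \int[mu]_y G (x', y)) (1 * x + a)%R).
  by apply: eq_integral => x _; rewrite mul1r.
rewrite (@ge0_integral_affine R (fun x' => \int[mu]_y G (x', y))) ?oner_eq0//.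
- by rewrite normr1 invr1 mul1e.
- exact: measurable_fun_fubini_tonelli_F.
- by move=> x; exact: integral_ge0.
Qed.

End plane_lebesgue.

Section complex_lebesgue.
Context (R : realType).
Local Notation mu := (@lebesgue_measure R).
Local Notation Leb := (lebesgue_complex R).
Local Notation cop := (@complex_of_plane R).
Local Notation P := (plane R).
Local Open Scope ereal_scope.
Implicit Types (g : R[i] -> \bar R) (c a : R[i]).

Lemma measurable_cscale d (T : measurableType d) (g : R[i] -> T) c :
  measurable_fun [set: P] (g \o cop) ->
  measurable_fun [set: P] (fun w => g (c * cop w)%R).
Proof.
move=> mg; case: c => a b.
have := measurable_comp (F := setT) measurableT (@subsetT _ _) mg
  (measurable_fun_pair (measurable_fun_lin a (- b) 0) (measurable_fun_lin b a 0)).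
apply: eq_measurable_fun => -[x y] _ /=; congr g.
by apply/eqP; rewrite eq_complex/= !addr0 mulNr eqxx/= addrC.
Qed.

Lemma measurable_cshift d (T : measurableType d) (g : R[i] -> T) a :
  measurable_fun [set: P] (g \o cop) ->
  measurable_fun [set: P] (fun w => g (cop w + a)%R).
Proof.
move=> mg; case: a => a b.
have := measurable_comp (F := setT) measurableT (@subsetT _ _) mg
  (measurable_fun_pair (measurable_fun_lin 1 0 a) (measurable_fun_lin 0 1 b)).
apply: eq_measurable_fun => -[x y] _ /=; congr g.
by apply/eqP; rewrite eq_complex/= !mul1r !mul0r addr0 add0r !eqxx.
Qed.

Lemma ge0_cint_scale g c : c != 0%R ->
  measurable_fun [set: P] (g \o cop) -> (forall z, 0 <= g z) ->
  \int[Leb]_w g (c * cop w)%R = ((normc c ^+ 2)^-1)%:E * \int[Leb]_w g (cop w).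
Proof.
case: c => a b c0 mg g0; rewrite normc_sqr/=.
rewrite -(@ge0_integral_plane_lin R (g \o cop) a b)//.
  apply: eq_integral => -[x y] _ /=; congr g.
  by apply/eqP; rewrite eq_complex/= eqxx/= addrC.
  by apply: contra c0; rewrite xpair_eqE eq_complex.
by move=> w; exact: g0.
Qed.

Lemma ge0_cint_shift g a :
  measurable_fun [set: P] (g \o cop) -> (forall z, 0 <= g z) ->
  \int[Leb]_w g (cop w + a)%R = \int[Leb]_w g (cop w).
Proof.
case: a => a b mg g0.
rewrite -(@ge0_integral_plane_shift R (g \o cop) a b)//.
by move=> w; exact: g0.
Qed.

Definition sqn (w : P) : R := (w.1 ^+ 2 + w.2 ^+ 2)%R.

Lemma sqnE w : sqn w = (normc (cop w) ^+ 2)%R.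
Proof. by rewrite normc_sqr. Qed.

Lemma sqn_ge0 w : (0 <= sqn w)%R.
Proof. by rewrite addr_ge0 ?sqr_ge0. Qed.

Lemma measurable_sqn : measurable_fun [set: P] (sqn : P -> measurableTypeR R).
Proof.
apply: measurable_funD; apply: measurable_funX.
- exact: measurable_fst.
- exact: measurable_snd.
Qed.

Lemma measurable_sqn_le (r : R) : measurable [set w : P | (sqn w <= r)%R].
Proof.
rewrite (_ : [set w : P | _] = sqn @^-1` `]-oo, r]%classic).
  rewrite -[X in measurable X]setTI; exact: measurable_sqn.
by apply/seteqP; split => w /=; rewrite in_itv.
Qed.

Lemma lebesgue_complexX (A B : set (measurableTypeR R)) :
  measurable A -> measurable B -> Leb (A `*` B) = mu A * mu B.
Proof. exact: product_measure1E. Qed.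

(** Area of the unit disc, kept as an unknown constant until a Gaussian integral identifies it in
    [kappaE]. *)
Let kappa := Leb [set w : P | (sqn w <= 1)%R].

Let kappa_fin : kappa \is a fin_num.
Proof.
rewrite ge0_fin_numE ?measure_ge0//.
apply: (@le_lt_trans _ _ (Leb ((`[(-1)%R, 1%R]%classic : set (measurableTypeR R)) `*`
    (`[(-1)%R, 1%R]%classic : set (measurableTypeR R))))).
  apply: le_measure; rewrite ?inE.
  - exact: measurable_sqn_le.
  - by apply: measurableX; exact: measurable_itv.
  - move=> [x y]; rewrite /sqn/= => h; rewrite !in_itv/= -!ler_norml.
    have sq (u : R) : (u ^+ 2 <= 1 -> `|u| <= 1)%R.
      by rewrite -[(u ^+ 2)%R]real_normK ?num_real// expr_le1.
    by split; apply: sq; apply: le_trans h; rewrite ?lerDl ?lerDr sqr_ge0.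
rewrite lebesgue_complexX//; try exact: measurable_itv.
by rewrite !lebesgue_measure_itv/= ifT ?lte_fin; [rewrite -EFinB -EFinM ltry|lra].
Qed.

Let disc_gt0 (r : R) : (0 < r)%R -> Leb [set w : P | (sqn w <= r)%R] = r%:E * kappa.
Proof.
move=> r0; pose D (s : R) := [set w : P | (sqn w <= s)%R].
pose g z : \bar R := (if (normc z ^+ 2 <= r)%R then 1 else 0)%:E.
have gE w : g (cop w) = (\1_(D r) w)%:E.
  rewrite /g -sqnE indicE; case: ifPn => h; first by rewrite mem_set.
  by rewrite memNset//=; exact/negP.
have mg : measurable_fun [set: P] (g \o cop).
  rewrite (_ : g \o cop = EFin \o \1_(D r)); last by apply/funext => w; exact: gE.
  by apply/measurable_EFinP; apply: measurable_indic; exact: measurable_sqn_le.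
have c0 : (Num.sqrt r)%:C != 0%R :> R[i].
  by rewrite -normc_gt0 normcR normr_gt0 gt_eqF// sqrtr_gt0.
have := ge0_cint_scale c0 mg; rewrite normcR real_normK ?num_real// (sqr_sqrtr (ltW r0)).
have -> : \int[Leb]_w g (cop w) = Leb (D r).
  under eq_integral do rewrite gE.
  by rewrite integral_indic ?setIT//; exact: measurable_sqn_le.
have -> : \int[Leb]_w g ((Num.sqrt r)%:C * cop w)%R = kappa.
  transitivity (\int[Leb]_w (\1_(D 1%R) w)%:E).
    apply: eq_integral => w _; rewrite /g normcM normcR exprMn real_normK ?num_real//.
    rewrite (sqr_sqrtr (ltW r0)) -sqnE ger_pMr// indicE.
    by case: ifPn => h; [rewrite mem_set|rewrite memNset//=; exact/negP].
  by rewrite integral_indic ?setIT//; exact: measurable_sqn_le.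
move=> ->; last by move=> z; rewrite /g; case: ifP => _; rewrite lee_fin.
by rewrite muleA -EFinM divff ?gt_eqF// mul1e.
Qed.

Let disc (r : R) : Leb [set w : P | (sqn w <= r)%R] = (Num.max r 0)%:E * kappa.
Proof.
have [r0|r0|->] := ltgtP r 0%R.
- rewrite (_ : [set w : P | _] = set0) ?measure0 ?mul0e//.
  by rewrite -subset0 => w /= h; have := le_lt_trans (le_trans (sqn_ge0 w) h) r0; rewrite ltxx.
- exact: disc_gt0.
- rewrite mul0e (_ : [set w : P | _] = [set 0%R : measurableTypeR R] `*` [set 0%R :
  measurableTypeR R]).
    by rewrite lebesgue_complexX// lebesgue_measure_set1 mul0e.
  apply/seteqP; split => -[x y]; rewrite /sqn/=.
    by have := sqr_ge0 x; have := sqr_ge0 y => ? ? h; split; apply/eqP; rewrite -sqrf_eq0;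
      apply/eqP; lra.
  by move=> [-> ->]; rewrite expr0n addr0.
Qed.

Let oc_radial (a b : R) : (a < b)%R ->
  Leb (sqn @^-1` `]a, b]%classic) = kappa * mu (`]a, b]%classic `&` `[0%R, +oo[%classic).
Proof.
move=> ab.
have -> : sqn @^-1` `]a, b]%classic =
    [set w : P | (sqn w <= b)%R] `\` [set w : P | (sqn w <= a)%R].
  apply/seteqP; split => w /=; rewrite in_itv/=.
    by move=> /andP[h1 h2]; split => //; apply/negP; rewrite -ltNge.
  by move=> [-> /negP]; rewrite -ltNge => ->.
have Ab : Leb [set w : P | (sqn w <= b)%R] < +oo.
  by rewrite disc -(fineK kappa_fin) -EFinM ltry.
rewrite [LHS](measureD (measurable_sqn_le b) (measurable_sqn_le a) Ab).
rewrite setIidr; last by move=> w /= /le_trans; apply; exact: ltW.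
rewrite [X in X - _](disc b) [X in _ - X](disc a) -(fineK kappa_fin) -!EFinM -EFinB.
have -> : mu (`]a, b]%classic `&` `[0%R, +oo[%classic) = (Num.max b 0 - Num.max a 0)%:E.
  have [b0|b0] := ltP b 0%R.
    rewrite (_ : _ `&` _ = set0) ?measure0 ?(max_r (ltW (lt_trans ab b0))) ?subrr//.
    by rewrite -subset0 => x /=; rewrite !in_itv/= andbT => -[/andP[_ ?] ?]; lra.
  have [a0|a0] := ltP a 0%R.
    rewrite (_ : _ `&` _ = `[0%R, b]%classic).
      rewrite lebesgue_measure_itv/= subr0; case: ifPn; rewrite ?oppr0 ?adde0//.
      by rewrite lte_fin -leNgt => h; congr (_%:E); apply/eqP; rewrite eq_le b0 h.
    apply/seteqP; split => x /=; rewrite !in_itv/= ?andbT.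
      by move=> [/andP[_ ->] ->].
    by move=> /andP[x0 ->]; rewrite (lt_le_trans a0 x0).
  rewrite (_ : _ `&` _ = `]a, b]%classic); first by rewrite lebesgue_measure_itv/= lte_fin ab EFinB.
  apply/seteqP; split => x /=; rewrite !in_itv/= ?andbT; first by move=> [].
  by move=> /andP[ax ->]; rewrite ax; split => //; rewrite ltW// (le_lt_trans a0).
by rewrite -EFinM; congr (_%:E); ring.
Qed.

(** Both sides are measures in [A] that agree and are finite on the half-open intervals.
    Intersecting with the half-line removes the negative values, which [sqn] never takes. *)
Let radial_measure (A : set (measurableTypeR R)) : measurable A ->
  Leb (sqn @^-1` A) = kappa * mu (A `&` `[0%R, +oo[%classic).
Proof.
have m0 : measurable (`[0%R, +oo[%classic : set (measurableTypeR R)) by exact: measurable_itv.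
have nn : (0 <= fine kappa)%R by apply: fine_ge0; exact: measure_ge0.
pose m1 := measure_function_pushforward__canonical__measure_function_Measure Leb measurable_sqn.
pose m2 := mscale (NngNum nn) (mrestr mu m0).
rewrite -[kappa]fineK//.
apply: (@measure_unique _ R (measurableTypeR R) (@ocitv R)
  (fun k => `](- k%:R)%R, k%:R]%classic) _ _ _ _ m1 m2) => //.
- exact: ocitvI.
- by move=> k; exact: is_ocitv.
- rewrite -subTset => x _; exists (Num.truncn `|x|).+1 => //=.
  rewrite in_itv/=; have : (`|x| < (Num.truncn `|x|).+1%:R)%R by rewrite truncnS_gt.
  by rewrite ltr_norml => /andP[-> /ltW ->].
- move=> X /ocitvP[->|[[a b] /= ab ->]].
    by rewrite !measure0.
  rewrite /m1 /m2 /mscale/= /pushforward /mrestr/= fineK//.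
  exact: oc_radial.
- move=> [|k].
    by rewrite oppr0 set_itvoc0 measure0 ltry.
  rewrite /m1/= /pushforward oc_radial; last by rewrite gtrN.
  rewrite -(fineK kappa_fin).
  apply: (@le_lt_trans _ _ ((fine kappa)%:E * mu `](- k.+1%:R)%R, k.+1%:R]%classic)).
    rewrite lee_wpmul2l ?lee_fin//; apply: le_measure; rewrite ?inE.
    - by apply: measurableI; exact: measurable_itv.
    - exact: measurable_itv.
    - exact: subIsetl.
  by rewrite lebesgue_measure_itv/= lte_fin gtrN// -EFinB -EFinM ltry.
Qed.

Let ge0_integral_radial_kappa (g : R -> \bar R) :
  measurable_fun [set: measurableTypeR R] g -> (forall x, 0 <= g x) ->
  \int[Leb]_w g (sqn w) = kappa * \int[mu]_(x in `[0%R, +oo[) g x.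
Proof.
move=> mg g0; have nn : (0 <= fine kappa)%R by apply: fine_ge0; exact: measure_ge0.
have m0 : measurable (`[0%R, +oo[%classic : set (measurableTypeR R)) by exact: measurable_itv.
have mg0 : measurable_fun (`[0%R, +oo[%classic : set (measurableTypeR R)) g.
  exact: measurable_funS mg.
transitivity (\int[Leb]_(w in sqn @^-1` `[0%R, +oo[%classic) (g \o sqn) w).
  congr integral; apply/seteqP; split => // w _ /=.
  by rewrite in_itv/= sqn_ge0.
rewrite -(ge0_integral_pushforward measurable_sqn)//.
rewrite -[kappa]fineK// -(ge0_integral_mscale _ _ (NngNum nn))//.
apply: eq_measure_integral => [|? A mA A0]; first exact: measurable_sqn.
transitivity (kappa * mu A); last by rewrite -[X in X * _](fineK kappa_fin).
by rewrite -[in RHS](setIidl A0); exact: radial_measure.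
Qed.

Lemma integral_expR_half : \int[mu]_(x in `[0%R, +oo[) (expR (- x))%:E = 1.
Proof.
rewrite -(@integral_exponential_pdf R 1)// integral_mkcond.
apply: eq_integral => x _; rewrite /exponential_pdf !patchE.
by case: ifP => //; rewrite mul1r mulN1r.
Qed.

(** The integral of [exp (- |z| ^ 2)] is [kappa] by the radial formula, and the square of the
    Gaussian integral [sqrt pi] by Tonelli's theorem. *)
Let kappaE : kappa = pi%:E.
Proof.
have mexp : measurable_fun [set: measurableTypeR R] (fun x : R => (expR (- x))%:E).
  apply/measurable_EFinP; apply: measurableT_comp; first exact: measurable_expR.
  exact: measurable_funN.
have := ge0_integral_radial_kappa mexp (fun x => expR_ge0 _).
rewrite integral_expR_half mule1 => <-.
have mgauss : measurable_fun [set: measurableTypeR R] (fun x : R => (gauss_fun x)%:E).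
  by apply/measurable_EFinP; exact: measurable_gauss_fun.
transitivity (\int[Leb]_w ((gauss_fun w.1)%:E * (gauss_fun w.2)%:E)).
  by apply: eq_integral => w _; rewrite -EFinM /gauss_fun -expRD /sqn opprD.
rewrite /lebesgue_complex fubini_tonelli1/=; last 2 first.
- apply: emeasurable_funM.
    by apply: (measurableT_comp mgauss); exact: measurable_fst.
  by apply: (measurableT_comp mgauss); exact: measurable_snd.
- by move=> w; rewrite mule_ge0 ?lee_fin ?gauss_fun_ge0.
rewrite /fubini_F/=.
transitivity (\int[mu]_x ((gauss_fun x)%:E * (Num.sqrt pi)%:E)).
  apply: eq_integral => x _; rewrite ge0_integralZl//.
  - by rewrite integralT_gauss.
  - by move=> y _; rewrite lee_fin gauss_fun_ge0.
  - by rewrite lee_fin gauss_fun_ge0.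
rewrite ge0_integralZr//.
- by rewrite integralT_gauss -EFinM -expr2 sqr_sqrtr// pi_ge0.
- by move=> y _; rewrite lee_fin gauss_fun_ge0.
Qed.

Lemma ge0_integral_radial (g : R -> \bar R) :
  measurable_fun [set: measurableTypeR R] g -> (forall x, 0 <= g x) ->
  \int[Leb]_w g (sqn w) = pi%:E * \int[mu]_(x in `[0%R, +oo[) g x.
Proof. by rewrite -kappaE; exact: ge0_integral_radial_kappa. Qed.

Lemma lebesgue_sqn_le (r : R) : (0 <= r)%R ->
  Leb [set w : P | (sqn w <= r)%R] = (pi * r)%:E.
Proof. by move=> r0; rewrite disc max_l// kappaE -EFinM mulrC. Qed.

End complex_lebesgue.

(** * Test functions *)

Section test_functions.
Context (R : realType).
Local Notation Leb := (lebesgue_complex R).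
Local Notation cop := (@complex_of_plane R).
Local Notation P := (plane R).
Implicit Types (f g h : R[i] -> R) (z w : R[i]).

Definition unif_cont f := forall e : R, 0 < e ->
  exists2 d : R, 0 < d & forall z w, normc (z - w) < d -> `|f z - f w| < e.

Definition bounded_supp f := exists2 K : R, 0 < K & forall z, K < normc z -> f z = 0.

Definition testfun f := [/\ forall z, 0 <= f z, unif_cont f & bounded_supp f].

(** A step of length [s], below the modulus of continuity for the value 1, changes [f] by less than
    1. After [k] steps along the real axis the point has left the support, so [f <= k]. *)
Lemma testfun_bounded f : testfun f -> exists2 M, 0 < M & forall z, `|f z| <= M.
Proof.
move=> [f0 uf [K K0 fK]]; have [d d0 fd] := uf _ ltr01.
pose s := d / 2; have s0 : 0 < s by rewrite divr_gt0.
have step k z : f z <= f (z + (k%:R * s)%:C) + k%:R.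
  elim: k => [|k IH]; first by rewrite mul0r !addr0.
  have h : `|f (z + (k%:R * s)%:C) - f (z + (k.+1%:R * s)%:C)| < 1.
    apply: fd; rewrite (_ : _ - _ = (- s)%:C); last first.
      by rewrite -natr1 mulrDl mul1r !rmorphD rmorphN /=; ring.
    by rewrite normcR normrN gtr0_norm// /s ltr_pdivrMr// ltr_pMr// ltr1n.
  by move: h; rewrite ltr_norml -natr1; lra.
pose k := (Num.truncn (2 * K / s)).+1.
have kK : 2 * K < k%:R * s by rewrite -ltr_pdivrMr// truncnS_gt.
exists k%:R => // z; rewrite ger0_norm//.
have [zK|zK] := ltP K (normc z); first by rewrite fK.
apply: le_trans (step k z) _; rewrite fK ?add0r//.
rewrite addrC -[z]opprK; apply: lt_le_trans (ler_normcB _ _).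
rewrite normcN normcR ger0_norm ?mulr_ge0 ?ltW//.
by lra.
Qed.

(** Rounding the first argument down to a grid of mesh [1 / (n + 1)] gives functions whose level
    sets are countable unions of rectangles. Continuity in that argument makes them converge
    pointwise. *)
Lemma measurable_caratheodory d (T : measurableType d) (f : R[i] -> T -> R) :
  (forall a, measurable_fun [set: T] (f a)) ->
  (forall x a (e : R), 0 < e ->
    exists2 r : R, 0 < r & forall a', normc (a - a') < r -> `|f a x - f a' x| < e) ->
  measurable_fun [set: P * T] (fun x => f (cop x.1) x.2).
Proof.
move=> mf cf.
pose fl (n : nat) (x : R) : R := (Num.floor (n.+1%:R * x))%:~R / n.+1%:R.
pose F (n : nat) (w : P * T) : R := f (fl n w.1.1 +i* fl n w.1.2) w.2.
have flP n x : `|fl n x - x| <= n.+1%:R^-1.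
  rewrite /fl distrC ler_norml; have := floor_le (n.+1%:R * x).
  have := floorD1_gt (n.+1%:R * x); rewrite intrD.
  set y : R := (Num.floor _)%:~R => h1 h2.
  have n0 : 0 < n.+1%:R :> R by [].
  have -> : x - y / n.+1%:R = (n.+1%:R * x - y) / n.+1%:R.
    by rewrite mulrBl mulrAC divff ?mul1r.
  have n1 := lt0r_neq0 n0.
  apply/andP; split.
  - by rewrite ler_pdivlMr// mulNr mulVf//; lra.
  - by rewrite ler_pdivrMr// mulVf//; lra.
apply: (@measurable_fun_cvg _ _ R setT F) => //.
- move=> n _ Y mY; rewrite setTI.
  have -> : F n @^-1` Y = \bigcup_(k in [set: int * int])
      ((`[k.1%:~R / n.+1%:R, (k.1 + 1)%:~R / n.+1%:R[%classic : set (measurableTypeR R)) `*`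
       (`[k.2%:~R / n.+1%:R, (k.2 + 1)%:~R / n.+1%:R[%classic : set (measurableTypeR R)) `*`
       (f (k.1%:~R / n.+1%:R +i* (k.2%:~R / n.+1%:R)) @^-1` Y)).
    have n0 : 0 < n.+1%:R :> R by [].
    have itvP (x : R) (k : int) :
        x \in `[k%:~R / n.+1%:R, (k + 1)%:~R / n.+1%:R[ = (Num.floor (n.+1%:R * x) == k).
      rewrite in_itv/= ler_pdivrMr// ltr_pdivlMr// [x * _]mulrC.
      by rewrite -floor_ge_int -floor_lt_int ltzD1 eq_le andbC.
    apply/seteqP; split => [w Yw|w [k _]].
      exists (Num.floor (n.+1%:R * w.1.1), Num.floor (n.+1%:R * w.1.2)) => //=.
      by split => //; split; rewrite /= itvP.
    move=> [[/=]]; rewrite !itvP => /eqP h1 /eqP h2.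
    by rewrite /F /fl/= h1 h2.
  apply: countable_bigcupT_measurable => // k; apply: measurableX.
    by apply: measurableX; exact: measurable_itv.
  by have := mf (k.1%:~R / n.+1%:R +i* (k.2%:~R / n.+1%:R)) measurableT Y mY; rewrite setTI.
- move=> w _; apply/cvgrPdist_lt => e e0; have [r r0 fr] := cf w.2 (cop w.1) _ e0.
  near=> n; apply: fr.
  apply: le_lt_trans (ler_normc_ReIm _) _.
  rewrite -[X in X + _]normrN -[X in _ + X]normrN /= !opprD !opprK ![- _ + _]addrC.
  apply: le_lt_trans (lerD (flP _ _) (flP _ _)) _.
  have : n.+1%:R^-1 < r / 2.
    near: n; exact: (@near_infty_natSinv_lt R (PosNum (divr_gt0 r0 (ltr0Sn R 1)))).
  by move=> h; rewrite (splitr r) ltrD.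
Unshelve. all: by end_near. Qed.

Lemma testfun_measurable f : testfun f -> measurable_fun [set: P] (f \o cop : P -> R).
Proof.
move=> [_ uf _].
have mf : measurable_fun [set: P * P] (fun x : P * P => f (cop x.1)).
  apply: (@measurable_caratheodory _ P (fun a _ => f a)); first by move=> a; exact: measurable_cst.
  by move=> x a e e0; have [d d0 fd] := uf _ e0; exists d => // a'; exact: fd.
have := measurable_comp (F := setT) measurableT (@subsetT _ _) mf
  (measurable_fun_pair (@measurable_id _ P setT) (@measurable_id _ P setT)).
exact.
Qed.

Lemma measurable_normc : measurable_fun [set: P] ((@normc R) \o cop : P -> R).
Proof.
rewrite (_ : _ \o _ = Num.sqrt \o (@sqn R)); last by apply/funext.
apply: measurableT_comp; last exact: measurable_sqn.
exact: continuous_measurable_fun (@sqrt_continuous R).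
Qed.

Lemma measurable_normc_le (r : R) : measurable [set w : P | normc (cop w) <= r].
Proof.
rewrite (_ : [set w : P | _] = (@normc R \o cop) @^-1` `]-oo, r]%classic).
  rewrite -[X in measurable X]setTI; exact: measurable_normc.
by apply/seteqP; split => w /=; rewrite in_itv.
Qed.

Lemma lebesgue_normc_le (r : R) : 0 <= r ->
  Leb [set w : P | normc (cop w) <= r] = (pi * r ^+ 2)%:E.
Proof.
move=> r0; rewrite -lebesgue_sqn_le ?sqr_ge0//; congr (Leb _).
apply/seteqP; split => w /=; rewrite sqnE ler_pXn2r ?nnegrE ?normc_ge0//.
Qed.

Definition cintr f : R := Rintegral Leb setT (f \o cop).

Lemma le_cint_bound f (M K : R) : measurable_fun [set: P] (f \o cop) -> 0 <= M -> 0 <= K ->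
  (forall z, 0 <= f z <= M) -> (forall z, K < normc z -> f z = 0) ->
  (\int[Leb]_w (f (cop w))%:E <= (M * (pi * K ^+ 2))%:E)%E.
Proof.
move=> mf M0 K0 fM fK; have mD := measurable_normc_le K.
rewrite EFinM -lebesgue_normc_le// -integral_cst// integral_mkcond.
apply: ge0_le_integral => //.
- by move=> w _; rewrite lee_fin; have /andP[] := fM (cop w).
- exact/measurable_EFinP.
- by apply/(measurable_restrictT _ mD); exact: measurable_cst.
move=> w _; rewrite patchE; case: ifPn => [_|].
  by rewrite lee_fin; have /andP[] := fM (cop w).
rewrite notin_setE/= => /negP; rewrite -ltNge => wK.
by rewrite fK.
Qed.

Lemma testfun_int_fin f : testfun f -> (\int[Leb]_w (f (cop w))%:E)%E \is a fin_num.
Proof.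
move=> tf; have [M M0 fM] := testfun_bounded tf; have [f0 _ [K K0 fK]] := tf.
rewrite ge0_fin_numE; last by apply: integral_ge0 => w _; rewrite lee_fin.
apply: (@le_lt_trans _ _ (M * (pi * K ^+ 2))%:E); last by rewrite ltry.
apply: le_cint_bound => //; rewrite ?ltW//; first exact: testfun_measurable.
by move=> z; rewrite f0 (le_trans (ler_norm _)).
Qed.

Lemma cintrE f : testfun f -> (\int[Leb]_w (f (cop w))%:E)%E = (cintr f)%:E.
Proof. by move=> tf; rewrite /cintr /Rintegral fineK//; exact: testfun_int_fin. Qed.

Lemma unif_cont_scale f (c : R[i]) : unif_cont f -> unif_cont (fun z => f (c * z)).
Proof.
move=> uf e e0; have [d d0 fd] := uf _ e0.
have c1 : 0 < normc c + 1 by rewrite ltr_wpDl ?normc_ge0.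
exists (d / (normc c + 1)); first by rewrite divr_gt0.
move=> z w zw; apply: fd; rewrite -mulrBr normcM.
move: zw; rewrite ltr_pdivlMr// => /(le_lt_trans _); apply.
by rewrite mulrC ler_wpM2l ?normc_ge0// lerDl.
Qed.

Lemma testfun_scale f (c : R[i]) : c != 0 -> testfun f -> testfun (fun z => f (c * z)).
Proof.
move=> c0 [f0 uf [K K0 fK]]; split => //; first exact: unif_cont_scale.
have nc : 0 < normc c by rewrite normc_gt0.
exists (K / normc c); rewrite ?divr_gt0// => z.
by rewrite ltr_pdivrMr// mulrC -normcM => /fK.
Qed.

End test_functions.

(** * Equidistribution of dilated lattices *)

Section equidistribution.
Context (R : realType) (L : set R[i]).
Hypothesis hL : unimodular_lattice L.
Local Notation Leb := (lebesgue_complex R).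
Local Notation cop := (@complex_of_plane R).
Local Notation P := (plane R).
Implicit Types (f g h : R[i] -> R) (z p q x a c : R[i]).

Lemma lattice_countable : countable L.
Proof.
have [K K0 hK] := lattice_count hL.
have -> : L = \bigcup_(n in [set: nat]) [set p | L p /\ normc (p - 0) <= n%:R].
  apply/seteqP; split => [p Lp|p [n _ []]//].
  exists (Num.truncn (normc p)).+1 => //=; split => //.
  by rewrite subr0 ltW// truncnS_gt.
apply: bigcup_countable => // n _; apply: finite_set_countable.
by have [] := hK 0 _ (ler0n R n).
Qed.

(** The translates of [D] by the lattice tile the plane. Each is brought back to [D] by translation
    invariance, and the sum over the countable lattice is exchanged with the integral. *)
Lemma unfolding (D : set P) (G : R[i] -> \bar R) : fundamental_domain L D ->
  measurable_fun [set: P] (G \o cop) -> (forall z, (0 <= G z)%E) ->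
  measurable_fun D (fun w => \esum_(p in L) G (cop w + p)%R)%E /\
  (\int[Leb]_w G (cop w) = \int[Leb]_(w in D) \esum_(p in L) G (cop w + p)%R)%E.
Proof.
move=> [mD fD] mG G0.
have [num inj_num] := countable_injP _ lattice_countable.
(* Each index carries at most one lattice vector; an index carrying none contributes the empty set
   and the zero function. *)
pose S n := [set p | L p /\ num p = n].
have S1 n p q : S n p -> S n q -> p = q.
  by move=> [Lp <-] [Lq /esym]; apply: inj_num; rewrite inE.
pose A n : set P := [set w | exists2 p, S n p & D (plane_of_complex (cop w - p))].
pose h n (w : P) : \bar R := (if pselect (exists p, S n p) is left e
  then G (cop w + projT1 (cid e))%R else 0)%E.
have hE n p w : S n p -> h n w = G (cop w + p).
  move=> Sp; rewrite /h; case: pselect => [e|]; last by case; exists p.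
  by case: cid => q Sq /=; rewrite (S1 _ _ _ Sq Sp).
have h0 n w : ~ (exists p, S n p) -> h n w = 0%E by rewrite /h; case: pselect.
have poc_cop (w : P) : plane_of_complex (cop w) = w by case: w.
have cop_poc z : cop (plane_of_complex z) = z by case: z.
have h_ge0 n w : (0 <= h n w)%E by rewrite /h; case: pselect.
have mh n : measurable_fun [set: P] (h n).
  have [[p Sp]|nS] := pselect (exists p, S n p).
    rewrite (_ : h n = fun w => G (cop w + p)); first exact: measurable_cshift.
    by apply/funext => w; exact: hE.
  rewrite (_ : h n = cst 0%E); first exact: measurable_cst.
  by apply/funext => w; exact: h0.
have mDs p : measurable [set w : P | D (plane_of_complex (cop w - p))].
  have mid : measurable_fun [set: P] ((@plane_of_complex R) \o cop).
    rewrite (_ : _ \o _ = id); first exact: measurable_id.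
    by apply/funext => w; exact: poc_cop.
  by have := measurable_cshift (- p) mid measurableT mD; rewrite setTI.
have ASE n p : S n p -> A n = [set w : P | D (plane_of_complex (cop w - p))].
  move=> Sp; apply/seteqP; split => [w [q Sq]|w Dw]; last by exists p.
  by rewrite (S1 _ _ _ Sq Sp).
have mA n : measurable (A n).
  have [[p Sp]|nS] := pselect (exists p, S n p); first by rewrite (ASE _ p).
  rewrite (_ : A n = set0); first exact: measurable0.
  by rewrite -subset0 => w [p Sp _]; apply: nS; exists p.
have tA : trivIset setT A.
  move=> i j _ _ [w [[p Sp Dp] [q Sq Dq]]].
  have [r [_ ur]] := fD (cop w).
  have rp := ur p (conj Sp.1 Dp); have rq := ur q (conj Sq.1 Dq).
  by move: Sp Sq; rewrite -rp -rq => -[_ <-] [_ <-].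
have UA : \bigcup_n A n = setT.
  rewrite -subTset => w _; have [p [[Lp Dp] _]] := fD (cop w).
  by exists (num p) => //; exists p.
have Ih n : (\int[Leb]_(w in A n) G (cop w) = \int[Leb]_(w in D) h n w)%E.
  have [[p Sp]|nS] := pselect (exists p, S n p); last first.
    rewrite (_ : A n = set0); last first.
      by rewrite -subset0 => w [p Sp _]; apply: nS; exists p.
    by rewrite integral_set0 integral0_eq// => w _; exact: h0.
  rewrite (ASE _ _ Sp) integral_mkcond [RHS]integral_mkcond.
  pose g z : \bar R := (if pselect (D (plane_of_complex z)) then G (z + p)%R else 0)%E.
  transitivity (\int[Leb]_w g (cop w + (- p))%R)%E.
    apply: eq_integral => w _; rewrite patchE /g; case: pselect => Dw.
      by rewrite mem_set// subrK.
    by rewrite memNset.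
  rewrite ge0_cint_shift.
  - apply: eq_integral => w _; rewrite patchE /g poc_cop; case: pselect => Dw.
      by rewrite mem_set// (hE _ p).
    by rewrite memNset.
  - rewrite (_ : g \o cop = (fun w => G (cop w + p)) \_ D); last first.
      apply/funext => w; rewrite /g/= patchE poc_cop; case: pselect => Dw.
        by rewrite mem_set.
      by rewrite memNset.
    apply/(measurable_restrictT _ mD); apply: measurable_funTS.
    exact: measurable_cshift.
  - by move=> z; rewrite /g; case: pselect => _ //=; exact: lexx.
have sumE w : (\sum_(0 <= n <oo) h n w = \esum_(p in L) G (cop w + p)%R)%E.
  rewrite nneseries_esumT; last by move=> n; exact: h_ge0.
  transitivity (\esum_(n in num @` L) h n w)%E.
    rewrite [RHS]esum_mkcond; apply: eq_esum => n _; case: ifPn => //.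
    rewrite notin_setE => nL; apply: h0 => -[p [Lp pn]]; apply: nL.
    by exists p.
  rewrite (reindex_esum L (num @` L) num); last first.
    split; [by move=> p Lp; exists p|exact: inj_num|by move=> _ [p Lp <-]; exists p].
  by apply: eq_esum => p Lp; rewrite (hE _ p).
split.
  rewrite (_ : (fun w => _) = (fun w => \sum_(0 <= n <oo) h n w)%E); last first.
    by apply/funext => w; rewrite sumE.
  apply: measurable_funTS.
  have := @ge0_emeasurable_sum _ P R setT h xpredT (fun k (w : P) _ _ => h_ge0 k w)
    (fun k _ => mh k).
  exact.
under [RHS]eq_integral do rewrite -sumE.
rewrite integral_nneseries//; last by move=> n; exact: measurable_funTS.
rewrite -UA ge0_integral_bigcup//.
- by apply: eq_eseriesr => n _; exact: Ih.
- by rewrite UA.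
Qed.

Lemma esum_lattice (F : R[i] -> R) (B : set R[i]) : B `<=` L -> finite_set B ->
  (forall p, 0 <= F p) -> (forall p, L p -> ~ B p -> F p = 0) ->
  (\esum_(p in L) (F p)%:E = (\sum_(p \in L) F p)%:E)%E.
Proof.
move=> BL fB F0 FB.
rewrite -(@fsbig_widen _ _ _ _ B L) //; last first.
  by move=> p [Lp nB]; exact: FB.
rewrite (esumID B) ?(setIidr BL)//; last by move=> p _; rewrite lee_fin.
rewrite [X in (_ + X)%E]esum1 ?adde0; last by move=> p [Lp nB]; rewrite FB.
by rewrite esum_fset -?fsumEFin// => p _; rewrite lee_fin.
Qed.

(** By unfolding, the integral of [g] is the integral of its lattice sums over a domain of measure
    1, that is, their mean; and the mean of numbers within [e] of [S] is within [e] of [S]. This is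
    where the covolume enters. *)
Lemma fundamental_bound g (S e : R) : 0 <= e -> (forall z, 0 <= g z) ->
  measurable_fun [set: P] (g \o cop) ->
  (forall x, finite_set [set p | L p /\ g (x + p) != 0]) ->
  (forall x, `|\sum_(p \in L) g (x + p) - S| <= e) ->
  `|fine (\int[Leb]_w (g (cop w))%:E)%E - S| <= e.
Proof.
move=> e0 g0 mg fg hS; case: (hL) => _ _ _ [D fD D1].
have mD : measurable D by case: fD.
pose F w := \sum_(p \in L) g (cop w + p).
have F0 w : 0 <= F w by apply: fsumr_ge0 => p _.
have [mF ->] := @unfolding D (EFin \o g) fD (measurable_comp measurableT (@subsetT _ _)
  (@EFin_measurable R setT) mg) (fun z => g0 z).
have FE w : (\esum_(p in L) (EFin \o g) (cop w + p)%R = (F w)%:E)%E.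
  apply: (@esum_lattice (fun p => g (cop w + p)) [set p | L p /\ g (cop w + p) != 0]) => //.
  - by move=> p [].
  - by move=> p Lp /not_andP[//|/negP/negPn/eqP].
under eq_integral do rewrite FE.
have {}mF : measurable_fun D (EFin \o F).
  by move: mF; under eq_fun do rewrite FE.
have cD (r : R) : (\int[Leb]_(w in D) r%:E = r%:E)%E.
  have := integral_cst Leb mD r%:E; rewrite /cst => ->.
  by rewrite [X in (_ * X)%E]D1 mule1.
have ub : (\int[Leb]_(w in D) (F w)%:E <= (S + e)%:E)%E.
  rewrite -cD; apply: ge0_le_integral => //.
  - by move=> w _; rewrite lee_fin.
  - by move=> w _; rewrite lee_fin; have := hS (cop w); rewrite ler_norml /F; lra.
have lb : (S%:E <= \int[Leb]_(w in D) (F w)%:E + e%:E)%E.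
  (* The comparison of integrals is between nonnegative functions, hence the maximum with 0. *)
  apply: (@le_trans _ _ (\int[Leb]_(w in D) (Num.max S 0)%:E)%E).
    by rewrite cD lee_fin le_max lexx.
  rewrite -(cD e) -ge0_integralD//; last by move=> w _; rewrite lee_fin.
  apply: ge0_le_integral => //.
  - by move=> w _; rewrite lee_fin le_max lexx orbT.
  - by apply: emeasurable_funD.
  - move=> w _; rewrite -EFinD lee_fin ge_max addr_ge0// andbT.
    by have := hS (cop w); rewrite ler_norml /F; lra.
have I0 : (0 <= \int[Leb]_(w in D) (F w)%:E)%E.
  by apply: integral_ge0 => w _; rewrite lee_fin.
move: ub lb I0; case: (integral _ _ _) => [r| |] //=.
rewrite -EFinD !lee_fin => h1 h2 _.
by rewrite ler_norml; lra.
Qed.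

Lemma reindex_lattice (F : R[i] -> R) q : L q ->
  \sum_(p \in L) F p = \sum_(p \in L) F (q + p).
Proof.
move=> Lq; apply: (reindex_fsbig (fun p => q + p)); split.
- by move=> p Lp; exact: latticeD.
- by move=> p p' _ _ /addrI.
- by move=> p Lp; exists (p - q); [exact: latticeB|rewrite addrC subrK].
Qed.

(** Modulo the lattice, any translation is bounded by [C], hence by [C |c|] after dilation. Uniform
    continuity then makes each of the [O(|c| ^ -2)] nonzero terms change little, so the sums over
    all translates are close to one another, hence to their mean, uniformly in [a]. *)
Theorem equidistribution h : testfun h -> forall e : R, 0 < e ->
  exists2 d : R, 0 < d & forall c a, c != 0 -> normc c < d ->
  `|normc c ^+ 2 * \sum_(p \in L) h (c * (a + p)) - cintr h| <= e.
Proof.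
move=> th e e0; have [h0 uh [K K0 hK]] := th.
have [C C0 coC] := lattice_cocompact hL.
have [Kc Kc0 cnt] := lattice_count hL.
have KC0 : 0 < 1 + K + C by rewrite ltr_pwDl// addr_gt0.
(* At most [Kc (1 + r) ^ 2] terms change, each by at most [e1], and [(1 + r) |c| <= 1 + K + C] as
   soon as [|c| < 1]. *)
pose e1 := e / (Kc * (1 + K + C) ^+ 2).
have e10 : 0 < e1 by rewrite divr_gt0// mulr_gt0// exprn_gt0.
have [d d0 hd] := uh _ e10.
exists (Num.min 1 (d / (C + 1))); first by rewrite lt_min ltr01 divr_gt0// ltr_wpDl.
move=> c a c0; rewrite lt_min => /andP[c1 cd].
have nc : 0 < normc c by rewrite normc_gt0.
pose S := \sum_(p \in L) h (c * (a + p)).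
pose r := K / normc c + C.
have r0 : 0 <= r by rewrite addr_ge0// divr_ge0// ltW.
pose B x := [set p | L p /\ normc (p - (- x)) <= r].
have fB x : finite_set (B x) by have [] := cnt (- x) _ r0.
have far x y p : normc (x - y) <= C -> ~ B x p -> L p -> h (c * (y + p)) = 0.
  move=> xy nB Lp; apply: hK.
  have : r < normc (p + x).
    by rewrite ltNge; apply/negP => pr; apply: nB; split => //; rewrite opprK.
  rewrite /r => hr; rewrite normcM mulrC -ltr_pdivrMr//.
  have := ler_normcB (p + x) (x - y).
  rewrite (_ : p + x - (x - y) = y + p); last by ring.
  by lra.
have Sx x : `|\sum_(p \in L) h (c * (x + p)) - S| <= e / normc c ^+ 2.
  have [q Lq hq] := coC (x - a).
  rewrite /S (@reindex_lattice (fun p => h (c * (a + p))) q Lq).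
  have close : normc (x - (a + q)) <= C by rewrite opprD addrA.
  rewrite -!(@fsbig_widen _ _ _ _ (B x) L); try by move=> p [].
  - rewrite -fsumB//; apply: le_trans (fsum_bound (M := e1) _ _) _ => //.
      move=> p _; apply/ltW/hd; rewrite -mulrBr normcM.
      rewrite (_ : _ - _ = x - (a + q)); last by ring.
      have : normc c * (C + 1) < d by rewrite -ltr_pdivlMr// ltr_wpDl.
      apply: le_lt_trans; rewrite ler_pM2l//.
      by rewrite (le_trans close)// lerDl.
    have [_ hc] := cnt (- x) _ r0.
    apply: le_trans (_ : e1 * (Kc * (1 + r) ^+ 2) <= _); first by rewrite ler_pM2l.
    have rc : (1 + r) * normc c <= 1 + K + C.
      rewrite mulrDl mul1r /r mulrDl divfK ?gt_eqF//.
      have : C * normc c <= C by rewrite ler_piMr// ltW.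
      by lra.
    rewrite ler_pdivlMr ?exprn_gt0//.
    have -> : e1 * (Kc * (1 + r) ^+ 2) * normc c ^+ 2 =
        e * (((1 + r) * normc c) ^+ 2 / (1 + K + C) ^+ 2).
      by rewrite /e1; field; rewrite !gt_eqF.
    rewrite ger_pMr// ler_pdivrMr ?exprn_gt0// mul1r.
    have rc0 : 0 <= (1 + r) * normc c by rewrite mulr_ge0 ?normc_ge0// addr_ge0.
    by rewrite ler_pXn2r// nnegrE// ltW.
  - by move=> p [Lp nB] /=; rewrite addrA; apply: (far x) => //; rewrite -?addrA.
  - by move=> p [Lp nB]; apply: (far x) => //; rewrite subrr normc0.
have e2 : 0 <= e / normc c ^+ 2 by rewrite divr_ge0 ?sqr_ge0// ltW.
have th' := testfun_scale c0 th.
have := @fundamental_bound (fun z => h (c * z)) S _ e2 (fun z => h0 _)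
  (testfun_measurable th') _ Sx.
have -> : (\int[Leb]_w (h (c * cop w))%:E = ((normc c ^+ 2)^-1 * cintr h)%:E)%E.
  rewrite (@ge0_cint_scale R (EFin \o h))//; first by rewrite cintrE// EFinM.
  by apply/measurable_EFinP; exact: testfun_measurable.
move=> /(_ _)/wrap[].
  move=> x; apply: (sub_finite_set _ (fB x)) => p [Lp hp].
  apply: contrapT => nB; move/eqP: hp; apply; apply: (far x) => //.
  by rewrite subrr normc0.
rewrite /= -(ler_pM2l (exprn_gt0 2 nc)) [_ * (e / _)]mulrC divfK ?gt_eqF ?exprn_gt0//.
rewrite -[X in X * _]ger0_norm ?sqr_ge0// -normrM mulrBr mulrA divff ?gt_eqF ?exprn_gt0//.
by rewrite mul1r distrC.
Qed.

End equidistribution.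

(** * Local expansion of root differences *)

Section local_expansion.
Context (R : realType) (b : nat).
Hypothesis b_gt0 : (0 < b)%N.
Local Notation sroots := (@sum_roots R b b_gt0 _).
Implicit Types (f : R[i] -> R) (u v w m p y z : R[i]).

Lemma sum_rootsB y (g h : R[i] -> R) :
  sroots y (fun w => g w - h w) = sroots y g - sroots y h.
Proof. by rewrite /sum_roots sumrB. Qed.

Lemma ler_norm_sum_roots y (g : R[i] -> R) (M : R) :
  (forall w, w ^+ b = y -> `|g w| <= M) -> `|sroots y g| <= b%:R * M.
Proof.
move=> gM; apply: (@le_trans _ _ (sroots y (fun w => `|g w|))).
  exact: ler_norm_sum.
by rewrite mulr_natl -(@sum_roots_cst R b b_gt0 _ y); exact: ler_sum_roots.
Qed.

Lemma root_neq0 u m : u ^+ b = m -> m != 0 -> u != 0.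
Proof. by move=> <-; apply: contra_neq => ->; rewrite expr0n; case: b b_gt0. Qed.

(** In use, [n = N], [A = N ^ alpha] and [G = N ^ gamma]; all errors are governed by
    [Q = G A = t n]. Since [m + p = m (1 + eps)] with [eps = O(1 / Q)], the roots of [m + p] are the
    [u x w], where [x] is the root of [1 + eps] near [1] and [w] a root of unity. Only [w = 1] is
    close enough to [u] to be seen by [f]. *)
Lemma local_expansion f (K eta e : R) : testfun f -> 0 < K ->
  (forall z, K < normc z -> f z = 0) -> 0 < eta <= 1 -> 0 < e ->
  exists2 Q0 : R, 0 < Q0 & forall n A G t : R,
    0 < n -> 0 < A -> 0 < G -> 0 < t -> A ^+ b = n -> G * A = t * n -> Q0 <= G * A ->
    forall m p, eta * n <= normc m <= n -> normc p <= b%:R * K / t ->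
  `|sroots m (fun u => sroots (m + p) (fun v => f (G%:C * (v - u)))) -
    sroots m (fun u => f (G%:C * u * (p / (b%:R * m))))| <= e.
Proof.
move=> tf K0 fK /andP[eta0 eta1] e_gt0; have [f0 uf _] := tf.
have [e0 [K1 [c0 [e00 K10 c00 near]]]] := near_root_ex R b_gt0.
have bR : 0 < b%:R :> R by rewrite ltr0n.
have bC : b%:R != 0 :> R[i] by rewrite pnatr_eq0 -lt0n.
have [d d0 fd] := uf _ (divr_gt0 e_gt0 bR).
pose k := b%:R * K / eta.
have k0 : 0 < k by rewrite divr_gt0// mulr_gt0.
(* [q1] puts [eps] in the range of [near_root_ex]; [q2] gives [|eps| <= 1 / 2], so that [m + p] is
   nonzero; [q3] brings the second order error [K1 k ^ 2 / Q] below [d]; [q4] pushes the other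
   determinations beyond [K]. *)
pose q1 := k / e0; pose q2 := 2 * k; pose q3 := 2 * K1 * k ^+ 2 / d.
pose q4 := 2 * K / (eta * c0).
have q10 : 0 < q1 by rewrite divr_gt0.
have q20 : 0 < q2 by rewrite mulr_gt0.
have q30 : 0 < q3 by rewrite divr_gt0// mulr_gt0 ?exprn_gt0// mulr_gt0.
have q40 : 0 < q4 by rewrite divr_gt0// mulr_gt0.
exists (q1 + q2 + q3 + q4); first by rewrite !addr_gt0.
move=> n A G t n0 A0 G0 t0 An GA QQ m p /andP[m1 m2] hp.
set Q := G * A in QQ.
have Q0 : 0 < Q by rewrite mulr_gt0.
have Q1 : q1 <= Q by lra.
have Q2 : q2 <= Q by lra.
have Q3 : q3 <= Q by lra.
have Q4 : q4 <= Q by lra.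
have etan : 0 < eta * n by rewrite mulr_gt0.
have mpos : 0 < normc m by apply: lt_le_trans m1.
have m0 : m != 0 by rewrite -normc_gt0.
pose eps := p / m.
have epsQ : normc eps <= k / Q.
  rewrite /eps normcM normcV ler_pdivrMr//.
  apply: le_trans hp _; rewrite /k /Q GA.
  rewrite (_ : b%:R * K / t = b%:R * K / eta / (t * n) * (eta * n)); last first.
    by field; rewrite !gt_eqF.
  by rewrite ler_pM2l// !divr_gt0 ?mulr_gt0.
have eps1 : normc eps <= e0.
  apply: le_trans epsQ _; rewrite ler_pdivrMr// mulrC -ler_pdivrMr//.
have eps2 : normc eps <= 2^-1.
  apply: le_trans epsQ _; rewrite ler_pdivrMr//.
  by move: Q2; rewrite /q2; lra.
have [x [xb x1 xe xw]] := near _ eps1.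
have mpE : m + p = m * (1 + eps) by rewrite /eps mulrDr mulr1 mulrCA divff ?mulr1.
have e1 : 1 + eps != 0.
  rewrite -normc_gt0 -[eps]opprK.
  by apply: lt_le_trans (ler_normcB _ _); rewrite normc1 normcN; lra.
have mp0 : m + p != 0 by rewrite mpE mulf_neq0.
have inner u : u ^+ b = m ->
    sroots (m + p) (fun v => f (G%:C * (v - u))) = f (G%:C * (u * (x - 1))).
  move=> um.
  have uxb : (u * x) ^+ b = m + p by rewrite exprMn um xb mpE.
  rewrite (sum_rootsE b_gt0 _ uxb mp0) (bigD1_seq 1)/=; last 2 first.
  - by rewrite mem_unity_roots expr1n.
  - exact: unity_roots_uniq.
  have -> : u * (x - 1) = u * x - u by ring.
  rewrite mulr1 big_seq_cond big1 ?addr0// => w /andP[].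
  rewrite mem_unity_roots => /eqP wb w1; apply: fK.
  rewrite (_ : u * x * w - u = u * (x * w - 1)); last by ring.
  rewrite !normcM normcR gtr0_norm//.
  (* [eta ^ b <= eta] gives this bound without taking a root of [eta]. *)
  have uA : eta * A <= normc u.
    rewrite -(lerX_nneg b_gt0) ?normc_ge0 ?mulr_ge0 ?(ltW eta0) ?(ltW A0)//.
    rewrite -normcX um; apply: le_trans m1; rewrite exprMn An ler_pM2r//.
    by rewrite -{2}(expr1 eta) ler_wiXn2l// ltW.
  have h1 : K < eta * c0 * Q.
    by move: Q4; rewrite /q4 ler_pdivrMr ?mulr_gt0// mulrC; lra.
  apply: lt_le_trans h1 _.
  rewrite (_ : eta * c0 * Q = G * (eta * A * c0)); last by rewrite /Q; ring.
  rewrite ler_pM2l//; apply: ler_pM => //; [exact: mulr_ge0 (ltW _) (ltW _)|exact: ltW|exact: xw].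
rewrite -sum_rootsB.
have -> : e = b%:R * (e / b%:R) by rewrite mulrC divfK ?gt_eqF.
apply: ler_norm_sum_roots => u um; rewrite inner//; apply/ltW/fd.
rewrite (_ : _ - _ = G%:C * u * (x - 1 - eps / b%:R)); last first.
  by rewrite /eps; field; rewrite bC m0.
rewrite !normcM normcR gtr0_norm//.
have uA : normc u <= A.
  rewrite -(lerX_nneg b_gt0) ?normc_ge0 ?(ltW A0)//.
  by rewrite -normcX um An.
apply: (@le_lt_trans _ _ (Q * (K1 * (k / Q) ^+ 2))).
  apply: ler_pM; rewrite ?mulr_ge0 ?normc_ge0 ?(ltW G0)//.
    by rewrite /Q ler_pM2l.
  apply: le_trans xe _; rewrite ler_pM2l// ler_pXn2r ?nnegrE ?normc_ge0//.
  by rewrite ltW// divr_gt0.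
rewrite (_ : Q * _ = K1 * k ^+ 2 / Q); last by field; rewrite gt_eqF.
rewrite ltr_pdivrMr//; move: Q3; rewrite /q3 ler_pdivrMr//.
have : 0 < K1 * k ^+ 2 by rewrite mulr_gt0// exprn_gt0.
by lra.
Qed.

End local_expansion.

(** * Continuous cut-offs near the origin and the unit circle *)

Section cutoffs.
Context (R : realType).
Local Notation Leb := (lebesgue_complex R).
Local Notation cop := (@complex_of_plane R).
Local Notation P := (plane R).
Implicit Types (f g h : R[i] -> R) (y z : R[i]).

Definition clamp (s : R) : R := Num.max 0 (Num.min 1 s).

Lemma clamp_ge0 s : 0 <= clamp s.
Proof. by rewrite /clamp le_max lexx. Qed.

Lemma clamp_le1 s : clamp s <= 1.
Proof. by rewrite /clamp ge_max ler01 ge_min lexx. Qed.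

Lemma clamp1 s : 1 <= s -> clamp s = 1.
Proof. by move=> s1; rewrite /clamp min_l// max_r. Qed.

Lemma clamp0 s : s <= 0 -> clamp s = 0.
Proof. by move=> s1; rewrite /clamp min_r ?max_l// (le_trans s1). Qed.

Lemma clamp_lip s t : `|clamp s - clamp t| <= `|s - t|.
Proof.
wlog st : s t / s <= t.
  by move=> H; have [/H//|/ltW/H] := leP s t; rewrite distrC [leRHS]distrC.
rewrite [leRHS]distrC [leLHS]distrC [leRHS]ger0_norm ?subr_ge0//.
rewrite /clamp; have [s1|s1] := leP s 1; have [t1|t1] := leP t 1;
  have [h1|h1] := leP 0 s; have [h2|h2] := leP 0 t;
  rewrite ?(min_r s1) ?(min_l (ltW s1)) ?(min_r t1) ?(min_l (ltW t1));
  rewrite /Num.max ?ltr01 ler_norml; do ?case: ifPn; rewrite -?leNgt; lra.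
Qed.

Lemma unif_cont_clamp (r c : R) : unif_cont (fun z => clamp (r * normc z + c)).
Proof.
move=> e e0; have r1 : 0 < `|r| + 1 by rewrite ltr_wpDl.
exists (e / (`|r| + 1)); first by rewrite divr_gt0.
move=> z w; rewrite ltr_pdivlMr// => zw; apply: le_lt_trans (clamp_lip _ _) _.
rewrite (_ : _ - _ = r * (normc z - normc w)); last by ring.
rewrite normrM; apply: le_lt_trans zw; rewrite mulrC ler_pM//.
  exact: ler_dist_normc.
by rewrite lerDl.
Qed.

Lemma unif_contM f g (M : R) : (forall z, `|f z| <= M) -> (forall z, `|g z| <= M) ->
  unif_cont f -> unif_cont g -> unif_cont (fun z => f z * g z).
Proof.
move=> fM gM uf ug e e0.
have M0 : 0 <= M by apply: le_trans (fM 0).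
have M1 : 0 < 2 * (M + 1) by rewrite mulr_gt0// ltr_wpDl.
have [d1 d10 h1] := uf _ (divr_gt0 e0 M1); have [d2 d20 h2] := ug _ (divr_gt0 e0 M1).
exists (Num.min d1 d2); first by rewrite lt_min d10.
move=> z w; rewrite lt_min => /andP[/h1 zw1 /h2 zw2].
rewrite (_ : _ - _ = f z * (g z - g w) + (f z - f w) * g w); last by ring.
apply: le_lt_trans (ler_normD _ _) _; rewrite !normrM.
have a1 : `|f z| * `|g z - g w| <= M * (e / (2 * (M + 1))).
  by rewrite ler_pM// ltW.
have a2 : `|f z - f w| * `|g w| <= (e / (2 * (M + 1))) * M.
  by rewrite ler_pM// ltW.
apply: le_lt_trans (lerD a1 a2) _.
rewrite (_ : _ + _ = e * (M / (M + 1))); last by field; rewrite gt_eqF ?ltr_wpDl.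
by rewrite gtr_pMr// ltr_pdivrMr ?ltr_wpDl// mul1r ltrDl.
Qed.

Lemma unif_contC c f : unif_cont f -> unif_cont (fun z => c - f z).
Proof.
move=> uf e e0; have [d d0 fd] := uf _ e0; exists d => // z w zw.
have -> : c - f z - (c - f w) = f w - f z by ring.
by rewrite distrC; exact: fd.
Qed.

(** Piecewise linear at both ends: for [eta > 0] it is 1 when [2 eta <= |y| <= 1 - 2 eta], and 0
    when [|y| <= eta] or [|y| >= 1 - eta]. *)
Definition cut (eta : R) y : R :=
  clamp (eta^-1 * normc y - 1) * clamp (- eta^-1 * normc y + (1 - eta) / eta).

(** Dominates [1 - cut] on the unit disc and vanishes beyond [1 + eta]. It is continuous, so that
    equidistribution can count the grid points in the cut-off zones. *)
Definition cutc (eta : R) y : R :=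
  clamp (- eta^-1 * normc y + (1 + eta) / eta) * (1 - cut eta y).

Lemma cut_ge0 eta y : 0 <= cut eta y.
Proof. by rewrite mulr_ge0 ?clamp_ge0. Qed.

Lemma cut_le1 eta y : cut eta y <= 1.
Proof. by rewrite mulr_ile1 ?clamp_ge0 ?clamp_le1. Qed.

Lemma cutc_ge0 eta y : 0 <= cutc eta y.
Proof. by rewrite mulr_ge0 ?clamp_ge0// subr_ge0 cut_le1. Qed.

Lemma cutc_le1 eta y : cutc eta y <= 1.
Proof. by rewrite mulr_ile1 ?clamp_ge0 ?clamp_le1 ?subr_ge0 ?cut_le1// gerBl cut_ge0. Qed.

Lemma cut_small eta y : 0 < eta -> normc y <= eta -> cut eta y = 0.
Proof.
move=> e0 ye; rewrite /cut clamp0 ?mul0r//.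
by rewrite subr_le0 mulrC ler_pdivrMr// mul1r.
Qed.

Lemma cut_large eta y : 0 < eta -> 1 - eta <= normc y -> cut eta y = 0.
Proof.
move=> e0 ye; rewrite /cut [X in _ * X]clamp0 ?mulr0//.
by rewrite mulNr addrC [eta^-1 * _]mulrC -mulrBl mulr_le0_ge0 ?subr_le0 ?invr_ge0// ltW.
Qed.

Lemma cut_mid eta y : 0 < eta -> 2 * eta <= normc y <= 1 - 2 * eta -> cut eta y = 1.
Proof.
move=> e0 /andP[y1 y2]; rewrite /cut !clamp1 ?mulr1//.
  rewrite mulNr addrC [eta^-1 * _]mulrC -mulrBl ler_pdivlMr//; lra.
by rewrite lerBrDr mulrC ler_pdivlMr//; lra.
Qed.

Lemma cutc_ge eta y : 0 < eta -> normc y <= 1 -> 1 - cut eta y <= cutc eta y.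
Proof.
move=> e0 y1; rewrite /cutc clamp1 ?mul1r//.
by rewrite mulNr addrC [eta^-1 * _]mulrC -mulrBl ler_pdivlMr//; lra.
Qed.

Lemma cutc_large eta y : 0 < eta -> 1 + eta <= normc y -> cutc eta y = 0.
Proof.
move=> e0 ye; rewrite /cutc clamp0 ?mul0r//.
by rewrite mulNr addrC [eta^-1 * _]mulrC -mulrBl mulr_le0_ge0 ?subr_le0 ?invr_ge0// ltW.
Qed.

Lemma cutc_mid eta y : 0 < eta -> 2 * eta <= normc y <= 1 - 2 * eta -> cutc eta y = 0.
Proof. by move=> e0 h; rewrite /cutc cut_mid// subrr mulr0. Qed.

Lemma unif_cont_cut eta : unif_cont (cut eta).
Proof.
apply: (@unif_contM _ _ 1); try exact: unif_cont_clamp.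
- by move=> z; rewrite ger0_norm ?clamp_ge0 ?clamp_le1.
- by move=> z; rewrite ger0_norm ?clamp_ge0 ?clamp_le1.
Qed.

Lemma testfun_cutc eta : 0 < eta -> testfun (cutc eta).
Proof.
move=> e0; split; first exact: cutc_ge0.
- apply: (@unif_contM _ _ 1).
  + by move=> z; rewrite ger0_norm ?clamp_ge0 ?clamp_le1.
  + by move=> z; rewrite ger0_norm ?subr_ge0 ?cut_le1// gerBl cut_ge0.
  + exact: unif_cont_clamp.
  + by apply: unif_contC; exact: unif_cont_cut.
- exists (1 + eta); first by rewrite addr_gt0.
  by move=> z /ltW /cutc_large; exact.
Qed.

(** The support lies in the disc of radius [2 eta] and the annulus from [1 - 2 eta] to [1 + eta],
    whose areas add up to [pi (6 eta + eta ^ 2)]; hence the 7. The indicator of the disc of radius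
    [1 - 2 eta] is added to the left-hand side instead of being subtracted from the right. *)
Lemma cintr_cutc eta : 0 < eta -> 2 * eta <= 1 -> cintr (cutc eta) <= 7 * pi * eta.
Proof.
move=> e0 e1; have tc := testfun_cutc e0.
pose D r := [set w : P | normc (cop w) <= r].
have mD r : measurable (D r) by exact: measurable_normc_le.
have mI r : measurable_fun [set: P] (fun w => (\1_(D r) w)%:E : \bar R).
  by apply/measurable_EFinP; exact: measurable_indic.
have ID r : 0 <= r -> (\int[Leb]_w (\1_(D r) w)%:E = (pi * r ^+ 2)%:E)%E.
  by move=> r0; rewrite integral_indic// setIT; exact: lebesgue_normc_le.
have indE r w : \1_(D r) w = (if normc (cop w) <= r then 1 else 0) :> R.
  by rewrite indicE; case: ifPn => h; [rewrite mem_set|rewrite memNset//=; exact/negP].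
have h : (\int[Leb]_w ((cutc eta (cop w))%:E + (\1_(D (1 - 2 * eta)%R) w)%:E) <=
    \int[Leb]_w ((\1_(D (2 * eta)%R) w)%:E + (\1_(D (1 + eta)%R) w)%:E))%E.
  apply: ge0_le_integral => //.
  - by move=> w _; rewrite adde_ge0 ?lee_fin ?cutc_ge0.
  - apply: emeasurable_funD => //; apply/measurable_EFinP; exact: testfun_measurable.
  - exact: emeasurable_funD.
  - move=> w _; rewrite -!EFinD lee_fin !indE.
    have c1 := cutc_le1 eta (cop w).
    have [w1|w1] := leP (normc (cop w)) (1 - 2 * eta);
    have [w2|w2] := leP (normc (cop w)) (2 * eta);
    have [w3|w3] := leP (normc (cop w)) (1 + eta); try lra.
    + by rewrite cutc_mid ?(ltW w2)//; lra.
    + by rewrite cutc_large ?(ltW w3)//; lra.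
move: h; rewrite !ge0_integralD//; do ?[by move=> w _; rewrite lee_fin ?cutc_ge0].
  rewrite cintrE// !ID; [|lra|lra|lra].
  rewrite -!EFinD lee_fin.
  have p0 := pi_gt0 R.
  have : pi * eta ^+ 2 <= pi * eta.
    by rewrite ler_pM2l// expr2 ger_pMr//; lra.
  by lra.
by apply/measurable_EFinP; exact: testfun_measurable.
Qed.

End cutoffs.

(** * Pair sums *)

Section pair_sums.
Context (R : realType) (b : nat).
Hypothesis b_gt0 : (0 < b)%N.
Context (L : set R[i]) (z0 : R[i]).
Hypothesis hL : unimodular_lattice L.
Variables (f : R[i] -> R) (K : R).
Hypotheses (K0 : 0 < K) (fK : forall z, K < normc z -> f z = 0).
Local Notation sroots := (@sum_roots R b b_gt0 _).
Implicit Types (u v w m p y z : R[i]).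

Definition grid_ball (n : R) : set R[i] :=
  [set m | L (m - z0) /\ 0 < normc m <= n].

Definition root_pair_sum (G : R) m m' : R :=
  sroots m (fun u => sroots m' (fun v => f (G%:C * (v - u)))).

Definition inner_sum (n G : R) m : R :=
  \sum_(m' \in grid_ball n `\ m) root_pair_sum G m m'.

(* [f (t p w / (b y))] approximates the contribution of the pair [(m, m + p)]
   near [m = n y], [w] being the rescaled determination of the root of [m]. *)
Definition main_term (t : R) y : R :=
  t ^+ 2 * \sum_(p \in L `\ 0) sroots y (fun w => f (t%:C * p * w / (b%:R * y))).

Let bR : 0 < b%:R :> R. Proof. by rewrite ltr0n. Qed.
Let bC : b%:R != 0 :> R[i]. Proof. by rewrite pnatr_eq0 -lt0n. Qed.

Lemma grid_ball_finite n : finite_set (grid_ball n).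
Proof.
have [Kc Kc0 cnt] := lattice_count hL.
have [n0|n0] := leP 0 n; last first.
  rewrite (_ : grid_ball n = set0)// -subset0 => m [_ /andP[h1 h2]].
  by have := lt_trans (lt_le_trans h1 h2) n0; rewrite ltxx.
have [fin _] := cnt (- z0) _ n0.
apply: (sub_finite_set _ (finite_image (fun p => z0 + p) fin)).
move=> m [Lm /andP[_ mn]]; exists (m - z0); last by rewrite addrC subrK.
by split => //; rewrite opprK subrK.
Qed.

Lemma grid_ball_count : exists2 C : R, 0 < C & forall n, 1 <= n ->
  \sum_(m \in grid_ball n) (1 : R) <= C * n ^+ 2.
Proof.
have [Kc Kc0 cnt] := lattice_count hL.
exists (Kc * 4); first by rewrite mulr_gt0.
move=> n n1; have n0 : 0 <= n by lra.
have [fin le] := cnt (- z0) _ n0.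
rewrite (reindex_fsbig (fun p => z0 + p) [set p | L p /\ 0 < normc (z0 + p) <= n]); last first.
  split.
  - by move=> p [Lp pn]; split => //=; rewrite addrC addKr.
  - by move=> p q _ _ /addrI.
  - move=> m [Lm mn]; exists (m - z0); rewrite /= [z0 + _]addrC subrK//.
apply: (@le_trans _ _ (Kc * (1 + n) ^+ 2)).
  apply: le_trans le; apply: ler_fsum_subset => //.
  by move=> p [Lp /andP[_ pn]]; split => //; rewrite opprK addrC.
rewrite -mulrA ler_pM2l// (_ : 4 * n ^+ 2 = (2 * n) ^+ 2); last by ring.
by rewrite ler_pXn2r ?nnegrE//; lra.
Qed.

Section fixed_scale.
Variables (n A G t : R).
Hypotheses (n0 : 0 < n) (A0 : 0 < A) (G0 : 0 < G) (t0 : 0 < t).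
Hypotheses (An : A ^+ b = n) (GA : G * A = t * n).

Let P : R := b%:R * K / t.
Let P0 : 0 <= P. Proof. by rewrite divr_ge0 ?mulr_ge0// ltW. Qed.

Let An1 : A ^+ b.-1 * A = n.
Proof. by rewrite -exprSr prednK. Qed.

Let root_le u m : u ^+ b = m -> normc m <= n -> normc u <= A.
Proof.
move=> um mn; rewrite -(lerX_nneg b_gt0) ?normc_ge0 ?(ltW A0)//.
by rewrite -normcX um An.
Qed.

(** A nonzero term has [|v - u| <= K / G] with [|u|] and [|v|] at most [A], so
    [|m' - m| <= b A ^ (b - 1) K / G]. This is [P] because [G = t A ^ (b - 1)]. *)
Lemma root_pair_sum_far m m' : normc m <= n -> normc m' <= n ->
  P < normc (m' - m) -> root_pair_sum G m m' = 0.
Proof.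
move=> mn m'n Pm; rewrite /root_pair_sum.
rewrite -[RHS](mul0rn _ b) -(@sum_roots_cst R b b_gt0 _ m); apply: eq_sum_roots => u um.
rewrite -[RHS](mul0rn _ b) -(@sum_roots_cst R b b_gt0 _ m'); apply: eq_sum_roots => v vm.
apply: fK; rewrite normcM normcR gtr0_norm//.
have := normc_subX_le b (root_le vm m'n) (root_le um mn); rewrite vm um => h.
have {}h := lt_le_trans Pm h; move: h; rewrite /P.
have -> : b%:R * K / t = b%:R * A ^+ b.-1 * (K / G).
  have -> : G = t * A ^+ b.-1.
    by apply: (mulIf (lt0r_neq0 A0)); rewrite -mulrA An1.
  by field; rewrite !gt_eqF ?exprn_gt0.
rewrite ltr_pM2l ?mulr_gt0 ?exprn_gt0//.
by rewrite ltr_pdivrMr// mulrC.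
Qed.

Lemma root_pair_sum_le m m' (M : R) : (forall z, `|f z| <= M) ->
  `|root_pair_sum G m m'| <= b%:R * (b%:R * M).
Proof.
by move=> fM; apply: ler_norm_sum_roots => u _; apply: ler_norm_sum_roots.
Qed.

Definition near_diffs m : set R[i] :=
  [set p | [/\ L p, p != 0, 0 < normc (m + p) <= n & normc p <= P]].

Lemma inner_sumE m : grid_ball n m ->
  inner_sum n G m = \sum_(p \in near_diffs m) root_pair_sum G m (m + p).
Proof.
move=> [Lm /andP[m_gt0 mn]].
rewrite /inner_sum -(@fsbig_widen _ _ _ _ [set m' | (grid_ball n `\ m) m' /\ normc (m' - m) <= P]).
- apply: reindex_fsbig; split.
  + move=> p [Lp p0 mp pP]; split; last by rewrite addrC addKr.
    split; last by move=> /= /(canRL (addKr m)); rewrite addNr => /eqP; rewrite (negbTE p0).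
    split => //; rewrite (_ : _ - _ = (m - z0) + p); last by ring.
    exact: latticeD.
  + by move=> p q _ _ /addrI.
  + move=> m' [[[Lm' m'n] m'm] m'P]; exists (m' - m); last by rewrite addrC subrK.
    split => //.
    * rewrite (_ : m' - m = (m' - z0) - (m - z0)); last by ring.
      exact: latticeB.
    * by rewrite subr_eq0; apply/eqP.
    * by rewrite addrC subrK.
- by move=> m' [].
- move=> m' [[[Lm' /andP[m'0 m'n]] m'm] nP] /=.
  apply: root_pair_sum_far => //; rewrite ltNge; apply/negP => h; apply: nP.
  by split => //; split => //; split => //; rewrite m'0.
Qed.

Lemma near_diffs_sub m : near_diffs m `<=` [set p | L p /\ normc (p - 0) <= P].
Proof. by move=> p [Lp _ _ pP]; split => //; rewrite subr0. Qed.

(** Only [O((1 + P) ^ 2)] neighbours contribute, and [t (1 + P) <= 1 + b K] for [t <= 1]. The bound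
    holds for all [m], including those near the origin or the boundary of the ball, which the local
    expansion does not treat. *)
Lemma inner_sum_le m (M Kc : R) : grid_ball n m -> t <= 1 -> 0 <= M ->
  (forall z, `|f z| <= M) -> 0 < Kc ->
  (forall a (r : R), 0 <= r ->
    finite_set [set p | L p /\ normc (p - a) <= r] /\
    \sum_(p \in [set p | L p /\ normc (p - a) <= r]) (1 : R) <= Kc * (1 + r) ^+ 2) ->
  t ^+ 2 * `|inner_sum n G m| <= b%:R * (b%:R * M) * (Kc * (1 + b%:R * K) ^+ 2).
Proof.
move=> gm t1 M0 fM Kc0 cnt; rewrite inner_sumE//.
have [fin le] := cnt 0 _ P0.
have finB := sub_finite_set (@near_diffs_sub m) fin.
have bM0 : 0 <= b%:R * (b%:R * M) by rewrite !mulr_ge0// ltW.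
have h1 : `|\sum_(p \in near_diffs m) root_pair_sum G m (m + p)| <=
    b%:R * (b%:R * M) * (Kc * (1 + P) ^+ 2).
  apply: le_trans (fsum_bound (M := b%:R * (b%:R * M)) finB _) _.
    by move=> p _; exact: root_pair_sum_le.
  rewrite ler_wpM2l//; apply: le_trans le.
  by apply: ler_fsum_subset => //; exact: near_diffs_sub.
apply: le_trans (ler_wpM2l (exprn_ge0 2 (ltW t0)) h1) _.
rewrite mulrCA ler_wpM2l// mulrCA ler_pM2l// -exprMn.
rewrite lerX_nneg ?mulr_ge0 ?addr_ge0 ?mulr_ge0 ?invr_ge0 ?(ltW t0) ?(ltW bR) ?(ltW K0)//.
by rewrite mulrDr mulr1 /P mulrC divfK ?gt_eqF// lerD2r.
Qed.

(** The roots of [y = m / n] are the [u / A] with [u] a root of [m], and [t = G A / n]: the powers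
    of [n] cancel in the argument of [f]. *)
Lemma main_termE m : m != 0 ->
  main_term t (m / n%:C) = t ^+ 2 * \sum_(p \in L `\ 0)
    sroots m (fun u => f (G%:C * u * (p / (b%:R * m)))).
Proof.
move=> m0; rewrite /main_term; congr (_ * _); apply: eq_fsbigr => p _.
have nC : n%:C != 0 :> R[i] by rewrite -normc_gt0 normcR gtr0_norm.
have AC : A%:C != 0 :> R[i] by rewrite -normc_gt0 normcR gtr0_norm.
pose u := b.-root m : R[i]; have um : u ^+ b = m by exact: rootCK.
have wm : (u / A%:C) ^+ b = m / n%:C.
  by rewrite exprMn exprVn um -An rmorphXn.
have y0 : m / n%:C != 0 by rewrite mulf_neq0 ?invr_eq0.
rewrite (sum_rootsE b_gt0 _ wm y0) (sum_rootsE b_gt0 _ um m0).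
apply: eq_bigr => w _; congr f.
have tE : t%:C = G%:C * A%:C / n%:C.
  by rewrite -rmorphM GA rmorphM/= mulfK.
by rewrite tE; field; rewrite m0 nC AC bC.
Qed.

(** From [|u| <= A] follows [|m| A <= |u| n], so the argument of [f] has norm at least
    [t |p| / b > K]. Thus one cut-off [P] serves both the pair sums and the main terms. *)
Lemma main_far m p : m != 0 -> normc m <= n -> P < normc p ->
  sroots m (fun u => f (G%:C * u * (p / (b%:R * m)))) = 0.
Proof.
move=> m0 mn pP.
rewrite -[RHS](mul0rn _ b) -(@sum_roots_cst R b b_gt0 _ m); apply: eq_sum_roots => u um.
apply: fK; rewrite !normcM normcV normcM normc_nat normcR gtr0_norm//.
have mpos : 0 < normc m by rewrite normc_gt0.
have u0 : 0 < normc u by rewrite normc_gt0; exact: (root_neq0 b_gt0 um m0).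
rewrite [ltRHS](_ : _ = (G * normc u * normc p) / (b%:R * normc m)); last by rewrite mulrA.
rewrite ltr_pdivlMr ?mulr_gt0//.
have h1 : normc m * A <= normc u * n.
  rewrite -um normcX -(prednK b_gt0) exprS -mulrA ler_pM2l// -An1 ler_pM2r//.
  by apply: lerXn2r; rewrite ?nnegrE ?normc_ge0 ?(ltW A0)//; exact: root_le um mn.
move: pP; rewrite /P ltr_pdivrMr// => pP.
rewrite -(ltr_pM2r A0).
apply: (@le_lt_trans _ _ (b%:R * K * (normc u * n))).
  rewrite (_ : K * _ * A = b%:R * K * (normc m * A)); last by ring.
  by rewrite ler_pM2l ?mulr_gt0.
rewrite (_ : G * normc u * normc p * A = (normc p * t) * (normc u * n)); last first.
  by rewrite (_ : _ * A = (G * A) * (normc u * normc p)); [rewrite GA|]; ring.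
by rewrite ltr_pM2r ?mulr_gt0.
Qed.

(** The bounds on [|m|] together with [P < eta n] keep [m + p] nonzero and in the ball, so the
    contributing neighbours correspond to all short nonzero lattice vectors, as in the main term. It
    remains to add up [O((1 + P) ^ 2)] errors [e]. *)
Lemma inner_main m (eta e Kc : R) : grid_ball n m -> t <= 1 -> 0 < eta -> 0 < e ->
  eta * n <= normc m <= (1 - eta) * n -> P < eta * n ->
  (forall p, normc p <= P ->
    `|root_pair_sum G m (m + p) - sroots m (fun u => f (G%:C * u * (p / (b%:R * m))))| <= e) ->
  0 < Kc ->
  (forall a (r : R), 0 <= r ->
    finite_set [set p | L p /\ normc (p - a) <= r] /\
    \sum_(p \in [set p | L p /\ normc (p - a) <= r]) (1 : R) <= Kc * (1 + r) ^+ 2) ->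
  `|t ^+ 2 * inner_sum n G m - main_term t (m / n%:C)| <=
    e * (Kc * (1 + b%:R * K) ^+ 2).
Proof.
move=> gm t1 eta0 e0 /andP[m1 m2] Pn hloc Kc0 cnt.
have [Lm /andP[m_gt0 mn]] := gm.
have m0 : m != 0 by rewrite -normc_gt0.
have [fin le] := cnt 0 _ P0.
pose B := [set p | [/\ L p, p != 0 & normc p <= P]].
have BE : near_diffs m = B.
  apply/seteqP; split => p [Lp p0]; first by move=> _ pP; split.
  move=> pP; split => //; apply/andP; split.
    have := ler_normcB m (- p); rewrite opprK normcN; lra.
  by apply: le_trans (le_normcD _ _) _; lra.
have finB : finite_set B.
  by rewrite -BE; exact: sub_finite_set (@near_diffs_sub m) fin.
rewrite inner_sumE// BE main_termE//.
rewrite -(@fsbig_widen _ _ _ _ B (L `\ 0)); last 2 first.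
- by move=> p [Lp p0 _]; split => //; apply/eqP.
- move=> p [[Lp /eqP p0] nB] /=; apply: main_far => //.
  by rewrite ltNge; apply/negP => h; apply: nB.
rewrite -mulrBr -fsumB// normrM ger0_norm ?sqr_ge0//.
have h1 : `|\sum_(p \in B) (root_pair_sum G m (m + p) -
    sroots m (fun u => f (G%:C * u * (p / (b%:R * m)))))| <= e * (Kc * (1 + P) ^+ 2).
  apply: le_trans (fsum_bound (M := e) finB _) _.
    by move=> p [_ _ pP]; exact: hloc.
  rewrite ler_pM2l//; apply: le_trans le.
  by apply: ler_fsum_subset => //; rewrite -BE; exact: near_diffs_sub.
apply: le_trans (ler_wpM2l (exprn_ge0 2 (ltW t0)) h1) _.
rewrite mulrCA ler_pM2l// mulrCA ler_pM2l// -exprMn.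
rewrite lerX_nneg ?mulr_ge0 ?addr_ge0 ?mulr_ge0 ?invr_ge0 ?(ltW t0) ?(ltW bR) ?(ltW K0)//.
by rewrite mulrDr mulr1 /P mulrC divfK ?gt_eqF// lerD2r.
Qed.

End fixed_scale.

End pair_sums.

(** * Functions on the punctured open disc *)

Section annulus.
Context (R : realType).
Local Notation Leb := (lebesgue_complex R).
Local Notation cop := (@complex_of_plane R).
Local Notation P := (plane R).
Implicit Types (H : R[i] -> R) (y z : R[i]).

(** The open disc without its centre is where [cut eta] becomes 1 as [eta] decreases to 0; elsewhere
    [cut eta] is 0. The centre and the circle are null sets. *)
Definition punctured H y : R := if 0 < normc y < 1 then H y else 0.

Lemma punctured_measurable H :
  (forall eta : R, 0 < eta -> 2 * eta <= 1 -> testfun (fun y => cut eta y * H y)) ->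
  measurable_fun [set: P] (punctured H \o cop).
Proof.
(* [k.+2] gives [2 * eta k <= 1] from [k = 0] on. *)
move=> tH; pose eta (k : nat) : R := k.+2%:R^-1.
have eta0 k : 0 < eta k by rewrite invr_gt0.
have eta1 k : 2 * eta k <= 1.
  by rewrite mulrC mulrC ler_pdivrMr// mul1r ler_nat.
apply: (@measurable_fun_cvg _ P R setT (fun k w => cut (eta k) (cop w) * H (cop w))) => //.
  by move=> k; exact: (testfun_measurable (tH _ (eta0 k) (eta1 k))).
move=> w _; apply: cvg_near_cst.
set r := normc (cop w).
have small (d : R) : 0 < d -> \forall k \near \oo, 2 * eta k <= d.
  move=> d0; near=> k.
  have : k.+1%:R^-1 < d / 2.
    by near: k; exact: (@near_infty_natSinv_lt R (PosNum (divr_gt0 d0 (ltr0Sn R 1)))).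
  have : eta k <= k.+1%:R^-1 by rewrite lef_pV2 ?posrE// ler_nat.
  by move: (eta k) (k.+1%:R^-1) => x q ? ?; lra.
rewrite /= /punctured -/r; case: ifPn => [/andP[r0 r1]|].
  near=> k; rewrite cut_mid ?mul1r// -/r.
  have h1 : 2 * eta k <= r by near: k; exact: small.
  have h2 : 2 * eta k <= 1 - r by near: k; apply: small; rewrite subr_gt0.
  by rewrite h1/=; lra.
rewrite negb_and -!leNgt => h; near=> k.
have e0 := eta0 k.
by case/orP: h => h; [rewrite cut_small ?mul0r//|rewrite cut_large ?mul0r//]; move: h;
  rewrite /r; lra.
Unshelve. all: by end_near. Qed.

(** [punctured H] lies between [cut eta * H] and [cut eta * H + C * cutc eta], and [cintr_cutc]
    bounds the integral of the last term. *)
Lemma cintr_punctured H (C : R) (eta : R) : 0 <= C -> 0 < eta -> 2 * eta <= 1 ->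
  (forall eta : R, 0 < eta -> 2 * eta <= 1 -> testfun (fun y => cut eta y * H y)) ->
  (forall y, 0 <= H y) -> (forall y, 0 < normc y <= 1 -> H y <= C) ->
  `|cintr (fun y => cut eta y * H y) - cintr (punctured H)| <= C * (7 * pi * eta).
Proof.
move=> C0 e0 e1 tH H0 HC; have tc := tH _ e0 e1; have tcc := testfun_cutc e0.
have mp := punctured_measurable tH.
have p0 y : 0 <= punctured H y by rewrite /punctured; case: ifP.
have le1 y : cut eta y * H y <= punctured H y.
  rewrite /punctured; case: ifPn => [_|].
    by rewrite ler_piMl// cut_le1.
  rewrite negb_and -!leNgt => /orP[h|h]; [rewrite cut_small ?mul0r//|rewrite cut_large ?mul0r//];
    lra.
have le2 y : punctured H y <= cut eta y * H y + C * cutc eta y.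
  rewrite /punctured; case: ifPn => [/andP[y0 y1]|_]; last first.
    by apply: addr_ge0; apply: mulr_ge0 => //; (exact: cut_ge0) || (exact: cutc_ge0).
  have hc := cutc_ge e0 (ltW y1).
  have HCy : H y <= C by apply: HC; rewrite y0 ltW.
  have := cut_le1 eta y; have := H0 y => ? ?.
  have : (1 - cut eta y) * H y <= cutc eta y * C.
    by rewrite ler_pM// subr_ge0.
  by lra.
have mc : measurable_fun [set: P] (EFin \o ((fun y => cut eta y * H y) \o cop)).
  by apply/measurable_EFinP; exact: testfun_measurable.
have mcc : measurable_fun [set: P] (EFin \o (cutc eta \o cop)).
  by apply/measurable_EFinP; exact: testfun_measurable.
have mpE : measurable_fun [set: P] (EFin \o (punctured H \o cop)).
  exact/measurable_EFinP.
have i1 : ((cintr (fun y => cut eta y * H y))%:E <= \int[Leb]_w (punctured H (cop w))%:E)%E.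
  rewrite -cintrE//; apply: ge0_le_integral => //.
  - by move=> w _; rewrite lee_fin mulr_ge0// cut_ge0.
  - by move=> w _; rewrite lee_fin.
have i2 : (\int[Leb]_w (punctured H (cop w))%:E <=
    (cintr (fun y => cut eta y * H y) + C * cintr (cutc eta))%:E)%E.
  rewrite EFinD EFinM -!cintrE// -ge0_integralZl//; last first.
    by move=> w _; rewrite lee_fin cutc_ge0.
  rewrite -ge0_integralD//; last 3 first.
  - by move=> w _; rewrite lee_fin mulr_ge0// cut_ge0.
  - by move=> w _; rewrite -EFinM lee_fin mulr_ge0// cutc_ge0.
  - apply: emeasurable_funM => //; exact: measurable_cst.
  apply: ge0_le_integral => //.
  - by move=> w _; rewrite lee_fin.
  - apply: emeasurable_funD => //; apply: emeasurable_funM => //; exact: measurable_cst.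
  - by move=> w _; rewrite -EFinM -EFinD lee_fin.
have c7 := cintr_cutc e0 e1.
have : C * cintr (cutc eta) <= C * (7 * pi * eta) by rewrite ler_wpM2l.
have pE : (\int[Leb]_w (punctured H (cop w))%:E = (cintr (punctured H))%:E)%E.
  rewrite /cintr /Rintegral fineK// ge0_fin_numE; first exact: le_lt_trans i2 (ltry _).
  by apply: integral_ge0 => w _; rewrite lee_fin; exact: p0.
by move: i1 i2; rewrite pE !lee_fin ler_norml; lra.
Qed.

End annulus.

(** * Limit of the pair sums when [t <= 1] *)

Section scaling_limit.
Context (R : realType) (b : nat).
Hypothesis b_gt0 : (0 < b)%N.
Context (L : set R[i]) (z0 : R[i]).
Hypothesis hL : unimodular_lattice L.
Variables (f : R[i] -> R).
Hypothesis (tf : testfun f).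
Implicit Types (u v w m p y z : R[i]).
Local Notation main_term := (@main_term R b b_gt0 L f).
Local Notation inner_sum := (@inner_sum R b b_gt0 L z0 f).
Local Notation grid_ball := (grid_ball L z0).

Variables (A G t : nat -> R) (H : R[i] -> R) (C : R).
Hypotheses (A0 : forall N, (0 < N)%N -> 0 < A N)
  (G0 : forall N, (0 < N)%N -> 0 < G N)
  (t0 : forall N, (0 < N)%N -> 0 < t N <= 1)
  (AN : forall N, (0 < N)%N -> A N ^+ b = N%:R)
  (GA : forall N, (0 < N)%N -> G N * A N = t N * N%:R)
  (GAoo : forall Q : R, exists N0, forall N, (N0 <= N)%N -> Q <= G N * A N).
Hypotheses (H0 : forall y, 0 <= H y)
  (HC : forall y, 0 < normc y <= 1 -> H y <= C)
  (tH : forall eta : R, 0 < eta -> 2 * eta <= 1 -> testfun (fun y => cut eta y * H y))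
  (Hlim : forall eta e : R, 0 < eta -> 0 < e -> exists N0, forall N, (N0 <= N)%N ->
    forall y, eta <= normc y <= 1 -> `|main_term (t N) y - H y| <= e).

Let C0 : 0 <= C.
Proof.
have c1 : 0 < normc (1 : R[i]) <= 1 by rewrite normc1 ltr01 lexx.
exact: le_trans (H0 1) (HC c1).
Qed.

Lemma grid_sumE (F : R[i] -> R) (N : nat) : (0 < N)%N ->
  (forall y, 1 <= normc y -> F y = 0) -> F 0 = 0 ->
  \sum_(m \in grid_ball N%:R) F (m / N%:R) =
  \sum_(p \in L) F (N%:R^-1 * (z0 + p)).
Proof.
move=> N0 F1 F00; have nR : 0 < N%:R :> R by rewrite ltr0n.
rewrite (reindex_fsbig (fun p => z0 + p) [set p | L p /\ 0 < normc (z0 + p) <= N%:R]); last first.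
  split.
  - by move=> p [Lp pn]; split => //=; rewrite addrC addKr.
  - by move=> p q _ _ /addrI.
  - by move=> m [Lm mn]; exists (m - z0); rewrite /= [z0 + _]addrC subrK.
rewrite (@fsbig_widen _ _ _ _ _ L).
- by apply: eq_fsbigr => p _; rewrite mulrC.
- by move=> p [].
move=> p [Lp np] /=; rewrite mulrC.
have [z1|z1] := leP 1 (normc (N%:R^-1 * (z0 + p))); first by rewrite F1.
have [->|zp] := eqVneq (z0 + p) 0; first by rewrite mulr0.
exfalso; apply: np; split => //; rewrite normc_gt0 zp/=.
by move: z1; rewrite normcM normcV normc_nat mulrC ltr_pdivrMr// mul1r => /ltW.
Qed.

Lemma grid_sum_cut (eta : R) (N : nat) : 0 < eta -> 2 * eta <= 1 -> (0 < N)%N ->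
  \sum_(m \in grid_ball N%:R) (cut eta (m / N%:R) * H (m / N%:R)) =
  \sum_(p \in L) (cut eta (N%:R^-1 * (z0 + p)) * H (N%:R^-1 * (z0 + p))).
Proof.
move=> e0 e1 N0; apply: (grid_sumE (F := fun y => cut eta y * H y)) => //.
  by move=> y y1; rewrite cut_large ?mul0r//; lra.
by rewrite cut_small ?mul0r// normc0 ltW.
Qed.

Lemma grid_sum_cutc (eta : R) (N : nat) : 0 < eta -> (0 < N)%N ->
  \sum_(m \in grid_ball N%:R) cutc eta (m / N%:R) <=
  \sum_(p \in L) cutc eta (N%:R^-1 * (z0 + p)).
Proof.
move=> e0 N0; have nR : 0 < N%:R :> R by rewrite ltr0n.
have [Kc Kc0 cnt] := lattice_count hL.
have r0 : 0 <= (1 + eta) * N%:R by rewrite mulr_ge0// addr_ge0// ltW.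
have [fin _] := cnt (- z0) _ r0; set B := [set p | _] in fin.
rewrite (reindex_fsbig (fun p => z0 + p) [set p | L p /\ 0 < normc (z0 + p) <= N%:R]); last first.
  split.
  - by move=> p [Lp pn]; split => //=; rewrite addrC addKr.
  - by move=> p q _ _ /addrI.
  - by move=> m [Lm mn]; exists (m - z0); rewrite /= [z0 + _]addrC subrK.
rewrite -(@fsbig_widen _ _ _ _ B L).
- under eq_fsbigr do rewrite mulrC.
  apply: ler_fsum_subset => //; last by move=> p _; exact: cutc_ge0.
  move=> p [Lp /andP[_ pn]]; split => //; rewrite opprK addrC (le_trans pn)//.
  by rewrite ler_peMl// lerDl ltW.
- by move=> p [].
move=> p [Lp np] /=; apply: cutc_large => //.
rewrite normcM normcV normc_nat mulrC ler_pdivlMr// leNgt; apply/negP => h.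
by apply: np; split => //; rewrite opprK addrC ltW.
Qed.

(** With [c = cut eta y] and [I] the scaled inner sum at [m], [I - c H = (1 - c) I + c (I - H)]. The
    first term is at most a multiple of [cutc eta y], whose sum over the grid is small. In the
    second, [c != 0] puts [y] in the annulus where [I] is close to the main term and the main term
    to [H]. *)
Theorem pair_sum_limit (e : R) : 0 < e -> exists N0, forall N, (N0 <= N)%N ->
  `|(N%:R ^+ 2)^-1 * \sum_(m \in grid_ball N%:R) (t N ^+ 2 * inner_sum N%:R (G N) m)
    - cintr (punctured H)| <= e.
Proof.
move=> e_gt0; have [f0 _ [K K0 fK]] := tf.
have [M M0 fM] := testfun_bounded tf.
have [Kc Kc0 cnt] := lattice_count hL.
have [Kg Kg0 gcnt] := grid_ball_count z0 hL.
have bR : 0 < b%:R :> R by rewrite ltr0n.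
pose C1 := b%:R * (b%:R * M) * (Kc * (1 + b%:R * K) ^+ 2).
pose C2 := Kc * (1 + b%:R * K) ^+ 2.
have C20 : 0 < C2 by rewrite mulr_gt0// exprn_gt0// addr_gt0// mulr_gt0.
have C10 : 0 < C1 by rewrite mulr_gt0// !mulr_gt0.
pose T := 7 * pi * (C1 + C).
have T0 : 0 < T by rewrite !mulr_gt0 ?pi_gt0// ltr_pwDl.
(* The cut-off zones, of area at most [7 pi eta], cost [T eta] in total: [C1] per unit of area for
   the pair sums, [C] for [H]. The remaining errors are multiples of [e1]. *)
pose eta := Num.min 2^-1 (e / 4 / T).
have eta0 : 0 < eta by rewrite lt_min invr_gt0 ltr0n/= !divr_gt0.
have eta1 : 2 * eta <= 1.
  have : eta <= 2^-1 by rewrite ge_min lexx.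
  lra.
have etaT : T * eta <= e / 4.
  by rewrite mulrC -ler_pdivlMr// ge_min lexx orbT.
pose e1 := e / 4 / (1 + C1 + Kg * (C2 + 1)).
have D0 : 0 < 1 + C1 + Kg * (C2 + 1).
  by rewrite !addr_gt0// mulr_gt0// addr_gt0.
have e10 : 0 < e1 by rewrite !divr_gt0.
have e1D : e1 * (1 + C1 + Kg * (C2 + 1)) = e / 4 by rewrite divfK ?gt_eqF.
have [Q0 Q00 hloc] := local_expansion b_gt0 tf K0 fK (e := e1)
  (introT andP (conj eta0 (ltac:(lra) : eta <= 1))) e10.
(* As [G N * A N = t N * N], the second bound means [b K / t N < eta N]: differences [p] are shorter
   than the margin of the annulus. *)
have [N1 hN1] := GAoo (Num.max Q0 (2 * (b%:R * K) / eta)).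
have [N2 hN2] := Hlim eta0 e10.
have tc := tH eta0 eta1; have tcc := testfun_cutc eta0.
have [d1 d10 eq1] := equidistribution hL tc e10.
have [d2 d20 eq2] := equidistribution hL tcc e10.
pose N3 := (Num.truncn (Num.min d1 d2)^-1).+1.
exists (maxn (maxn N1 N2) (maxn N3 1)) => N; rewrite !geq_max => /andP[/andP[n1 n2] /andP[n3 n4]].
have nR : 0 < N%:R :> R by rewrite ltr0n.
have n1R : 1 <= N%:R :> R by rewrite ler1n.
have nC : N%:R != 0 :> R[i] by rewrite pnatr_eq0 -lt0n.
have /andP[tN0 tN1] := t0 n4.
have QN : Q0 <= G N * A N /\ 2 * (b%:R * K) / eta <= G N * A N.
  by have := hN1 _ n1; rewrite ge_max => /andP[].
have small : normc (N%:R^-1 : R[i]) < d1 /\ normc (N%:R^-1 : R[i]) < d2.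
  rewrite normcV normc_nat; have : N%:R^-1 < Num.min d1 d2.
    have m0 : 0 < Num.min d1 d2 by rewrite lt_min d10.
    rewrite -[Num.min _ _]invrK ltf_pV2 ?posrE ?invr_gt0//.
    by apply: lt_le_trans (truncnS_gt _) _; rewrite ler_nat.
  by rewrite lt_min => /andP[].
have nVC : N%:R^-1 != 0 :> R[i] by rewrite invr_eq0.
have E1 := eq1 _ z0 nVC small.1; have E2 := eq2 _ z0 nVC small.2.
rewrite normcV normc_nat exprVn in E1 E2.
have PN : b%:R * K / t N < eta * N%:R.
  rewrite ltr_pdivrMr//; have := QN.2; rewrite GA// ler_pdivrMr//.
  have : 0 < b%:R * K by rewrite mulr_gt0.
  by lra.
have fin := grid_ball_finite z0 hL N%:R.
have term m : grid_ball N%:R m ->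
    `|t N ^+ 2 * inner_sum N%:R (G N) m - cut eta (m / N%:R) * H (m / N%:R)| <=
    C1 * cutc eta (m / N%:R) + (C2 + 1) * e1.
  move=> gm; have [Lm /andP[m0 mN]] := gm.
  set y := m / N%:R; set I := t N ^+ 2 * _; set c := cut eta y.
  have yN : normc y = normc m / N%:R by rewrite normcM normcV normc_nat.
  have y1 : normc y <= 1 by rewrite yN ler_pdivrMr// mul1r.
  have IC : `|I| <= C1.
    rewrite /I normrM ger0_norm ?sqr_ge0//.
    exact: (inner_sum_le b_gt0 hL K0 fK (A0 n4) (G0 n4) tN0 (AN n4) (GA n4) gm tN1 (ltW M0) fM
      Kc0 cnt).
  have c0 : 0 <= c := cut_ge0 _ _; have c1 : c <= 1 := cut_le1 _ _.
  have cc : 1 - c <= cutc eta y := cutc_ge eta0 y1.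
  have s1 : `|(1 - c) * I| <= C1 * cutc eta y.
    by rewrite normrM [X in X * _]ger0_norm ?subr_ge0// mulrC ler_pM// subr_ge0.
  have s2 : `|c * (I - H y)| <= (C2 + 1) * e1.
    have [cz|cz] := eqVneq c 0.
      by rewrite cz mul0r normr0 mulr_ge0 ?addr_ge0 ?(ltW C20) ?(ltW e10).
    have y2 : eta <= normc y <= 1 - eta.
      apply/andP; split; rewrite leNgt; apply/negP => h; move/eqP: cz; apply.
        by rewrite /c cut_small// ltW.
      by rewrite /c cut_large// ltW.
    have h1 : `|I - main_term (t N) y| <= e1 * C2.
      have -> : y = m / (N%:R)%:C by rewrite /y rmorph_nat.
      apply: (inner_main hL K0 fK nR (A0 n4) (G0 n4) tN0 (AN n4) (GA n4) gm tN1
        eta0 e10 _ PN _ Kc0 cnt).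
        by move: y2; rewrite yN ler_pdivlMr// ler_pdivrMr.
      move=> p pP.
      apply: (hloc _ _ _ _ nR (A0 n4) (G0 n4) tN0 (AN n4) (GA n4) QN.1 m p _ pP).
      by rewrite mN andbT; case/andP: y2 => h _; move: h; rewrite yN ler_pdivlMr.
    have h2 : `|main_term (t N) y - H y| <= e1.
      by apply: hN2 => //; case/andP: y2 => -> _.
    rewrite normrM ger0_norm//; apply: (@le_trans _ _ `|I - H y|).
      by rewrite ler_piMl.
    rewrite (_ : I - H y = (I - main_term (t N) y) + (main_term (t N) y - H y)); last by ring.
    apply: le_trans (ler_normD _ _) _; apply: le_trans (lerD h1 h2) _.
    by rewrite mulrDl mul1r mulrC.
  rewrite (_ : I - c * H y = (1 - c) * I + c * (I - H y)); last by ring.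
  exact: le_trans (ler_normD _ _) (lerD s1 s2).
set S := \sum_(m \in _) (t N ^+ 2 * _).
set S' := \sum_(m \in grid_ball N%:R) (cut eta (m / N%:R) * H (m / N%:R)).
have sq0 : 0 < (N%:R ^+ 2 : R) by rewrite exprn_gt0.
have n2V : 0 < (N%:R ^+ 2)^-1 :> R by rewrite invr_gt0.
have d_S : `|(N%:R ^+ 2)^-1 * S - (N%:R ^+ 2)^-1 * S'| <=
    C1 * (cintr (cutc eta) + e1) + Kg * ((C2 + 1) * e1).
  rewrite -mulrBr normrM (gtr0_norm n2V) mulrC ler_pdivrMr// -fsumB//.
  apply: le_trans (ler_norm_fsum _ fin) _.
  apply: le_trans (ler_fsum fin term) _.
  have -> : \sum_(m \in grid_ball N%:R) (C1 * cutc eta (m / N%:R) + (C2 + 1) * e1) =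
      C1 * \sum_(m \in grid_ball N%:R) cutc eta (m / N%:R) +
      (C2 + 1) * e1 * \sum_(m \in grid_ball N%:R) (1 : R).
    rewrite fsbig_split//= !mulr_fsumr; congr (_ + _).
    by apply: eq_fsbigr => m _; rewrite mulr1.
  rewrite [leRHS]mulrDl; apply: lerD.
    rewrite -[leRHS]mulrA ler_pM2l//; apply: le_trans (grid_sum_cutc eta0 n4) _.
    rewrite -ler_pdivrMr// mulrC.
    by move: E2; rewrite ler_norml; lra.
  have g := ler_wpM2l (ltW (mulr_gt0 (addr_gt0 C20 ltr01) e10)) (gcnt _ n1R).
  by apply: le_trans g _; rewrite le_eqVlt; apply/orP; left; apply/eqP; ring.
have d_J := cintr_punctured C0 eta0 eta1 tH H0 HC.
rewrite -grid_sum_cut// -/S' in E1.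
have c7 := cintr_cutc eta0 eta1.
have C1c : C1 * cintr (cutc eta) <= C1 * (7 * pi * eta) by rewrite ler_pM2l.
set J := cintr (punctured H) in d_J *; set J' := cintr _ in E1 d_J.
set a1 := _ * S in d_S *; set a2 := _ * S' in d_S E1.
have -> : a1 - J = (a1 - a2) + ((a2 - J') + (J' - J)) by ring.
apply: le_trans (ler_normD _ _) _.
apply: le_trans (lerD d_S (le_trans (ler_normD _ _) (lerD E1 d_J))) _.
move: e1D etaT; rewrite /T => e1D etaT.
have : 0 < e1 * 1 by rewrite mulr1.
by lra.
Qed.

End scaling_limit.

(** * Regularity of the limit functions *)

Section annulus_continuity.
Context (R : realType).
Implicit Types (H : R[i] -> R) (y z : R[i]).

Definition annulus_cont H := forall eta e : R, 0 < eta -> 0 < e ->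
  exists2 d : R, 0 < d & forall y z,
    eta <= normc y <= 1 -> eta <= normc z <= 1 -> normc (y - z) < d -> `|H y - H z| < e.

(** Two points closer than [eta / 2] lie both where [cut] vanishes near the origin, or both where it
    vanishes near and beyond the circle, or both in the annulus from [eta / 2] to [1], where [H] is
    bounded and uniformly continuous. *)
Lemma testfun_cutM H (C eta : R) : (forall y, 0 <= H y) ->
  (forall y, 0 < normc y <= 1 -> H y <= C) -> annulus_cont H ->
  0 < eta -> 2 * eta <= 1 -> testfun (fun y => cut eta y * H y).
Proof.
move=> H0 HC aH eta0 eta1; split.
- by move=> y; apply: mulr_ge0 => //; exact: cut_ge0.
- move=> e e0.
  have c1 : 0 < normc (1 : R[i]) <= 1 by rewrite normc1 ltr01 lexx.
  have C0 : 0 <= C by apply: le_trans (H0 1) (HC _ c1).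
  have h2 : 0 < eta / 2 by rewrite divr_gt0.
  have e2 : 0 < e / 2 by rewrite divr_gt0.
  have C1 : 0 < C + 1 by rewrite ltr_wpDl.
  have [d1 d10 hd1] := aH _ _ h2 e2.
  have [d2 d20 hd2] := unif_cont_cut eta (divr_gt0 e2 C1).
  exists (Num.min (eta / 2) (Num.min d1 d2)); first by rewrite !lt_min h2 d10.
  move=> y z; rewrite !lt_min => /and3P[yz1 yz2 yz3].
  have yzd := ler_dist_normc y z.
  have yzn : `|normc y - normc z| < eta / 2 by exact: le_lt_trans yz1.
  move: (yzn); rewrite ltr_norml => /andP[yzn1 yzn2].
  have both : normc y <= eta /\ normc z <= eta \/
      (1 - eta <= normc y /\ 1 - eta <= normc z \/
      (eta / 2 <= normc y <= 1) /\ (eta / 2 <= normc z <= 1)).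
    have [y1|y1] := leP (normc y) (eta / 2); first by left; lra.
    have [z1|z1] := leP (normc z) (eta / 2); first by left; lra.
    have [y2|y2] := leP (normc y) 1; last by right; left; lra.
    have [z2|z2] := leP (normc z) 1; last by right; left; lra.
    by right; right; rewrite (ltW y1) (ltW z1).
  case: both => [[ye ze]|[[ye ze]|[ye ze]]].
  + by rewrite !cut_small// !mul0r subrr normr0.
  + by rewrite !cut_large// !mul0r subrr normr0.
  have h1 := hd1 _ _ ye ze yz2; have h3 := hd2 _ _ yz3.
  rewrite (_ : _ - _ = cut eta y * (H y - H z) + (cut eta y - cut eta z) * H z); last by ring.
  apply: le_lt_trans (ler_normD _ _) _.
  rewrite (normrM (cut eta y)) (normrM _ (H z)).
  have a1 : `|cut eta y| * `|H y - H z| <= `|H y - H z|.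
    by rewrite ler_piMl// ger0_norm ?cut_ge0// cut_le1.
  have a2 : `|cut eta y - cut eta z| * `|H z| <= e / 2.
    apply: (@le_trans _ _ (e / 2 / (C + 1) * (C + 1))); last by rewrite divfK ?gt_eqF.
    apply: ler_pM => //; first exact: ltW.
    rewrite ger0_norm//; apply: (@le_trans _ _ C); last by rewrite lerDl.
    by apply: HC; case/andP: ze => ze1 ->; rewrite (lt_le_trans h2).
  by lra.
- exists 1 => // y y1; rewrite cut_large ?mul0r//; lra.
Qed.

End annulus_continuity.

Section root_ratio.
Context (R : realType) (b : nat).
Hypothesis b_gt0 : (0 < b)%N.
Implicit Types (u v w m p y z x : R[i]).

(** A substitute for a continuous determination of the root: [x] is the root of [z / y] near [1], so
    [w ^ b = y] gives [(w x) ^ b = z], and [w / y] becomes [(w / y) (x / x ^ b)]. *)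
Lemma root_ratio (eta e : R) : 0 < eta -> 0 < e -> exists2 d : R, 0 < d &
  forall y z, eta <= normc y -> normc (y - z) < d ->
  exists x, [/\ z = y * x ^+ b, x != 0, normc (x - 1) <= e & normc (x / x ^+ b - 1) <= e].
Proof.
move=> eta0 e0; have [e1 [K1 [c0 [e10 K10 c00 near]]]] := near_root_ex R b_gt0.
(* The 6 comes from [|x - 1 - eps| <= 3 |eps| <= e / 2], divided by [|1 + eps| >= 1 / 2]. *)
pose q := Num.min e1 (Num.min 2^-1 (e / 6)).
have q0 : 0 < q by rewrite !lt_min e10 invr_gt0 ltr0n/= divr_gt0.
exists (eta * q); first by rewrite mulr_gt0.
move=> y z ye yz; have y_gt0 : 0 < normc y by apply: lt_le_trans ye.
have y0 : y != 0 by rewrite -normc_gt0.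
pose eps := (z - y) / y.
have epsq : normc eps < q.
  rewrite normcM normcV ltr_pdivrMr// normcB; apply: lt_le_trans yz _.
  by rewrite mulrC ler_pM2l.
move: epsq; rewrite !lt_min => /and3P[q1 q2 q3].
have [x [xb x1 _ _]] := near _ (ltW q1).
have zE : z = y * x ^+ b by rewrite xb /eps mulrDr mulr1 mulrCA divff// mulr1 addrC subrK.
have e_ge : 2^-1 <= normc (1 + eps).
  rewrite -[eps]opprK; apply: le_trans (ler_normcB _ _).
  by rewrite normc1 normcN; lra.
have xb0 : x ^+ b != 0 by rewrite xb -normc_gt0; apply: lt_le_trans e_ge; rewrite invr_gt0.
have x0 : x != 0 by apply: contra_neq xb0 => ->; rewrite expr0n; case: b b_gt0.
exists x; split => //; first by lra.
rewrite (_ : x / x ^+ b - 1 = (x - 1 - eps) / x ^+ b); last first.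
  by rewrite [in RHS](_ : eps = x ^+ b - 1); [field|rewrite xb addrC addKr].
rewrite normcM normcV xb ler_pdivrMr; last by apply: lt_le_trans e_ge; rewrite invr_gt0.
have h : normc (x - 1 - eps) <= 3 * normc eps.
  apply: le_trans (le_normcD _ _) _; rewrite normcN; lra.
have : e * 2^-1 <= e * normc (1 + eps) by rewrite ler_pM2l.
by lra.
Qed.

End root_ratio.

Lemma annulus_cont_fsum (R : realType) (I : choiceType) (A : set I)
    (H : I -> R[i] -> R) : finite_set A -> (forall i, A i -> annulus_cont (H i)) ->
  annulus_cont (fun y => \sum_(i \in A) H i y).
Proof.
move=> fA aH.
have {}aH i : i \in finmap.enum_fset (fset_set A) -> annulus_cont (H i).
  by move=> iA; apply: aH; apply: set_mem; rewrite -in_fset_set.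
suff : annulus_cont (fun y => \sum_(i <- finmap.enum_fset (fset_set A)) H i y).
  move=> h eta e eta0 e0; have [d d0 hd] := h _ _ eta0 e0.
  by exists d => // y z hy hz yz; rewrite !fsbig_finite//; exact: hd.
elim: (finmap.enum_fset _) aH => [_|i s IH aH] eta e eta0 e0.
  by exists 1 => // y z _ _ _; rewrite !big_nil subrr normr0.
have e2 : 0 < e / 2 by rewrite divr_gt0.
have [d1 d10 h1] := aH i (mem_head _ _) _ _ eta0 e2.
have [|d2 d20 h2] := IH _ _ _ eta0 e2.
  by move=> j js; apply: aH; rewrite inE js orbT.
exists (Num.min d1 d2); first by rewrite lt_min d10.
move=> y z hy hz; rewrite lt_min => /andP[yz1 yz2]; rewrite !big_cons.
rewrite opprD addrACA [X in _ < X]splitr.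
exact: le_lt_trans (ler_normD _ _) (ltrD (h1 _ _ hy hz yz1) (h2 _ _ hy hz yz2)).
Qed.

(** The roots of [z] are matched with those of [y] through the factor [x] of [root_ratio]. The
    arguments of [f] then differ by at most [normc a / eta] times [normc (x / x ^+ b - 1)]. *)
Lemma root_sum_annulus (R : realType) (b : nat) (b_gt0 : (0 < b)%N) (a : R[i])
    (f : R[i] -> R) : testfun f ->
  annulus_cont (fun y => sum_roots b_gt0 y (fun w => f (a * (w / y)))).
Proof.
move=> [_ uf _] eta e eta0 e0.
have bR : 0 < b%:R :> R by rewrite ltr0n.
have [d d0 fd] := uf _ (divr_gt0 e0 (ltr_wpDl (ltW bR) ltr01 : 0 < b%:R + 1)).
have k0 : 0 <= normc a / eta by rewrite divr_ge0 ?normc_ge0// ltW.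
have k1 : 0 < normc a / eta + 1 by rewrite ltr_wpDl.
have [d' d'0 hd'] := root_ratio b_gt0 eta0 (divr_gt0 d0 k1).
exists d' => // y z /andP[y1 y2] /andP[z1 z2] yz.
have y_gt0 : 0 < normc y by apply: lt_le_trans y1.
have y0 : y != 0 by rewrite -normc_gt0.
have z0 : z != 0 by rewrite -normc_gt0; apply: lt_le_trans z1.
have [x [zE x0 _ hx]] := hd' _ _ y1 yz.
pose u := b.-root y : R[i]; have uy : u ^+ b = y by exact: rootCK.
have ux : (u * x) ^+ b = z by rewrite exprMn uy.
rewrite (sum_rootsE b_gt0 _ ux z0).
have -> : \sum_(w <- unity_roots R b_gt0) f (a * (u * x * w / z)) =
    sum_roots b_gt0 y (fun v => f (a * (v * x / z))).
  rewrite (sum_rootsE b_gt0 _ uy y0); apply: eq_bigr => w _.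
  by rewrite [u * x * w]mulrAC.
rewrite -sum_rootsB; apply: (@le_lt_trans _ _ (b%:R * (e / (b%:R + 1)))); last first.
  by rewrite mulrCA gtr_pMr// ltr_pdivrMr ?ltr_wpDl ?ltW// mul1r ltrDl.
apply: ler_norm_sum_roots => v vy; apply/ltW/fd.
have xb0 : x ^+ b != 0 by rewrite expf_neq0.
rewrite (_ : _ - _ = - (a * (v / y) * (x / x ^+ b - 1))); last first.
  by rewrite zE; field; rewrite y0 xb0.
rewrite normcN normcM.
have v1 : normc v <= 1.
  by rewrite -(lerX_nneg b_gt0) ?normc_ge0// expr1n -normcX vy.
have h1 : normc (a * (v / y)) <= normc a / eta.
  rewrite !normcM !normcV ler_wpM2l ?normc_ge0//.
  rewrite -[leRHS]mul1r; apply: ler_pM => //; rewrite ?normc_ge0 ?invr_ge0 ?normc_ge0//.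
  by rewrite lef_pV2 ?posrE.
apply: (@le_lt_trans _ _ (normc a / eta * (d / (normc a / eta + 1)))).
  by apply: ler_pM => //; exact: normc_ge0.
by rewrite mulrCA gtr_pMr// ltr_pdivrMr// mul1r ltrDl.
Qed.

(** * The limit function in the critical case, [t = 1] *)

Section critical_density.
Context (R : realType) (b : nat).
Hypothesis b_gt0 : (0 < b)%N.
Context (L : set R[i]).
Hypothesis hL : unimodular_lattice L.
Variables (f : R[i] -> R) (K : R).
Hypotheses (tf : testfun f) (K0 : 0 < K) (fK : forall z, K < normc z -> f z = 0).
Local Notation sroots := (@sum_roots R b b_gt0 _).
Local Notation main_term := (@main_term R b b_gt0 L f).
Implicit Types (u v w m p y z x : R[i]).

(** At [t = 1] the other vectors contribute nothing, for any [y] with [0 < |y| <= 1]. A sum over a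
    fixed finite set inherits bounds and continuity from its terms. *)
Definition short_vectors : set R[i] := [set p | [/\ L p, p != 0 & normc p <= b%:R * K]].

Let bR : 0 < b%:R :> R. Proof. by rewrite ltr0n. Qed.
Let bC : b%:R != 0 :> R[i]. Proof. by rewrite pnatr_eq0 -lt0n. Qed.
Let f0 z : 0 <= f z. Proof. by case: tf. Qed.

Lemma short_vectors_finite : finite_set short_vectors.
Proof.
have [Kc Kc0 cnt] := lattice_count hL.
have r0 : 0 <= b%:R * K by rewrite mulr_ge0 ?ltW.
have [fin _] := cnt 0 _ r0; apply: sub_finite_set fin => p [Lp _ pK].
by split => //; rewrite subr0.
Qed.

Lemma main_term1E y : y != 0 -> normc y <= 1 ->
  main_term 1 y = \sum_(p \in short_vectors) sroots y (fun w => f (p / b%:R * (w / y))).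
Proof.
move=> y0 y1.
have := @main_termE R b b_gt0 L f 1 1 1 1 ltr01 ltr01 (expr1n _ b) erefl y y0.
rewrite divr1 expr1n mul1r => ->.
rewrite -(@fsbig_widen _ _ _ _ short_vectors (L `\ 0)); last 2 first.
- by move=> p [Lp p0 _]; split => //; apply/eqP.
- move=> p [[Lp /eqP p0] nB] /=.
  apply: (@main_far R b b_gt0 f K K0 fK 1 1 1 1) => //; rewrite ?expr1n//.
  by rewrite divr1 ltNge; apply/negP => h; apply: nB.
apply: eq_fsbigr => p _; apply: eq_sum_roots => w _; congr f.
by rewrite rmorph1 mul1r; field; rewrite y0 bC.
Qed.

Lemma main_term_ge0 t y : 0 <= main_term t y.
Proof.
apply: mulr_ge0; rewrite ?sqr_ge0//; apply: fsumr_ge0 => p _.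
by apply: sumr_ge0 => w _.
Qed.

Lemma main_term1_bounded : exists C : R, forall y, 0 < normc y <= 1 -> main_term 1 y <= C.
Proof.
have [M M0 fM] := testfun_bounded tf.
exists (b%:R * M * \sum_(p \in short_vectors) (1 : R)) => y /andP[y0 y1].
rewrite main_term1E -?normc_gt0//; apply: le_trans (ler_norm _) _.
apply: fsum_bound => [|p _]; first exact: short_vectors_finite.
by apply: ler_norm_sum_roots => w _.
Qed.

Lemma main_term1_annulus : annulus_cont (main_term 1).
Proof.
move=> eta e eta0 e0.
have [d d0 hd] := annulus_cont_fsum short_vectors_finite
  (fun p _ => root_sum_annulus b_gt0 (p / b%:R) tf) eta0 e0.
exists d => // y z hy hz yz; rewrite !main_term1E; first exact: hd.
- by rewrite -normc_gt0; case/andP: hz => h _; exact: lt_le_trans h.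
- by case/andP: hz.
- by rewrite -normc_gt0; case/andP: hy => h _; exact: lt_le_trans h.
- by case/andP: hy.
Qed.

End critical_density.

(** * The limit function in the subcritical case, [t] tending to 0 *)

Section subcritical_density.
Context (R : realType) (b : nat).
Hypothesis b_gt0 : (0 < b)%N.
Context (L : set R[i]).
Hypothesis hL : unimodular_lattice L.
Variable (f : R[i] -> R).
Hypothesis tf : testfun f.
Local Notation sroots := (@sum_roots R b b_gt0 _).
Local Notation main_term := (@main_term R b b_gt0 L f).
Implicit Types (u v w m p y z x : R[i]).

(** The last factor is [|y| ^ (2 - 2 alpha)], as a natural power of the norm of a root. Of the
    factor [b ^ 3], one [b] counts the determinations. *)
Definition radial_density y : R :=
  b%:R ^+ 3 * cintr f * normc (b.-root y) ^+ (2 * b.-1).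

Let bR : 0 < b%:R :> R. Proof. by rewrite ltr0n. Qed.
Let bC : b%:R != 0 :> R[i]. Proof. by rewrite pnatr_eq0 -lt0n. Qed.
Let f0 z : 0 <= f z. Proof. by case: tf. Qed.

Let I0 : 0 <= cintr f.
Proof. by apply: Rintegral_ge0 => w _; exact: f0. Qed.

Lemma normc_root_eq u v y : u ^+ b = y -> v ^+ b = y -> normc u = normc v.
Proof.
move=> uy vy; apply/eqP; rewrite -(@eqrXn2 _ b)// ?normc_ge0//.
by rewrite -!normcX uy vy.
Qed.

Lemma radial_density_ge0 y : 0 <= radial_density y.
Proof. by rewrite !mulr_ge0 ?exprn_ge0 ?normc_ge0. Qed.

Lemma radial_density_bounded y : 0 < normc y <= 1 -> radial_density y <= b%:R ^+ 3 * cintr f.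
Proof.
move=> /andP[y0 y1]; rewrite ler_piMr ?mulr_ge0 ?exprn_ge0// exprn_ile1 ?normc_ge0//.
by rewrite -(lerX_nneg b_gt0) ?normc_ge0// expr1n -normcX rootCK.
Qed.

Lemma radial_density_annulus : annulus_cont radial_density.
Proof.
move=> eta e eta0 e0; pose c := b%:R ^+ 3 * cintr f.
have c0 : 0 <= c by rewrite mulr_ge0 ?exprn_ge0.
(* Lipschitz constant of [s ^ (2 b - 2)] on [[0, 2]], an interval that contains [normc x] because
   [|x - 1| <= 1]. *)
pose k : R := (2 * b.-1)%:R * 2 ^+ (2 * b.-1).-1.
have k0 : 0 <= k by rewrite mulr_ge0 ?exprn_ge0.
have ck0 : 0 <= c * k by rewrite mulr_ge0.
have ck1 : 0 < c * k + 1 by rewrite ltr_wpDl.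
have q0 : 0 < Num.min 1 (e / (c * k + 1)) by rewrite lt_min ltr01 divr_gt0.
have [d d0 hd] := root_ratio b_gt0 eta0 q0.
exists d => // y z /andP[y1 y2] /andP[z1 z2] yz.
have [x [zE x0 + _]] := hd _ _ y1 yz; rewrite le_min => /andP[x1 xe].
have uy : (b.-root y : R[i]) ^+ b = y by exact: rootCK.
have vz : (b.-root z : R[i]) ^+ b = z by exact: rootCK.
have -> : radial_density z = c * (normc (b.-root y : R[i]) ^+ (2 * b.-1) * normc x ^+ (2 * b.-1)).
  rewrite /radial_density -/c (@normc_root_eq _ (b.-root y * x) z)//.
    by rewrite normcM exprMn.
  by rewrite exprMn uy.
rewrite /radial_density -/c -mulrBr -[X in X - _]mulr1 -mulrBr.
rewrite normrM (ger0_norm c0) normrM ger0_norm ?exprn_ge0 ?normc_ge0//.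
have u1 : normc (b.-root y : R[i]) ^+ (2 * b.-1) <= 1.
  rewrite exprn_ile1 ?normc_ge0//.
  by rewrite -(lerX_nneg b_gt0) ?normc_ge0// expr1n -normcX uy.
have x2 : normc x <= 2.
  by have := ler_normcB x 1; rewrite normc1; lra.
have h : `|1 - normc x ^+ (2 * b.-1)| <= k * (e / (c * k + 1)).
  have := @normc_subX_le R (2 * b.-1) 2 1 (normc x)%:C.
  rewrite normc1 normcR ger0_norm ?normc_ge0// => /(_ (ltac:(lra)) x2).
  rewrite (_ : 1 ^+ _ - _ = (1 - normc x ^+ (2 * b.-1))%:C); last first.
    by rewrite expr1n rmorphB rmorph1 rmorphXn.
  rewrite (_ : 1 - _ = (1 - normc x)%:C); last by rewrite rmorphB rmorph1.
  rewrite !normcR => /le_trans; apply.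
  rewrite ler_wpM2l//; apply: le_trans xe.
  by rewrite -[X in X - _](normc1 R) distrC; exact: ler_dist_normc.
apply: (@le_lt_trans _ _ (c * (k * (e / (c * k + 1))))).
  rewrite ler_wpM2l// -[leRHS]mul1r; apply: ler_pM => //.
  by rewrite exprn_ge0 ?normc_ge0.
rewrite (_ : c * _ = (c * k) * e / (c * k + 1)); last by rewrite !mulrA.
by rewrite ltr_pdivrMr// mulrDr mulr1 [e * _]mulrC ltrDl.
Qed.

(** For each determination [w], the sum over [p] is a Riemann sum of [f] over the lattice dilated by
    [c = t w / (b y)], and [t ^ 2 = b ^ 2 |w| ^ (2 b - 2) |c| ^ 2]. As [|c| <= t / eta], the
    convergence is uniform on the annulus. *)
Lemma main_term_lim (eta e : R) : 0 < eta -> 0 < e -> exists2 d : R, 0 < d &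
  forall t : R, 0 < t < d -> forall y, eta <= normc y <= 1 ->
  `|main_term t y - radial_density y| <= e.
Proof.
move=> eta0 e0; have [M M0 fM] := testfun_bounded tf.
pose e1 := e / (2 * b%:R ^+ 3).
have b3 : 0 < b%:R ^+ 3 :> R by rewrite exprn_gt0.
have e10 : 0 < e1 by rewrite divr_gt0// mulr_gt0.
have [d d0 hd] := equidistribution hL tf e10.
pose q := Num.min 1 (Num.min d (e1 / M)).
have q0 : 0 < q by rewrite !lt_min ltr01 d0 divr_gt0.
exists (eta * q); first by rewrite mulr_gt0.
move=> t /andP[t0 tq] y /andP[y1 y2].
have y_gt0 : 0 < normc y by apply: lt_le_trans y1.
have y0 : y != 0 by rewrite -normc_gt0.
have tC : t%:C != 0 :> R[i] by rewrite -normc_gt0 normcR gtr0_norm.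
have [_ _ [K K0 fK]] := tf.
have [Kc Kc0 cnt] := lattice_count hL.
have r0 : 0 <= b%:R * K / t by rewrite divr_ge0 ?mulr_ge0 ?(ltW K0) ?(ltW t0).
have [fin _] := cnt 0 _ r0; set B := [set p | _] in fin.
have w1 w : w ^+ b = y -> normc w <= 1.
  by move=> wy; rewrite -(lerX_nneg b_gt0) ?normc_ge0// expr1n -normcX wy.
have yw w : w ^+ b = y -> normc y = normc w ^+ b.-1 * normc w.
  by move=> <-; rewrite normcX -exprSr prednK.
have w0 w : w ^+ b = y -> 0 < normc w.
  by move=> wy; rewrite normc_gt0; exact: (root_neq0 b_gt0 wy y0).
have far w p : w ^+ b = y -> ~ B p -> L p -> f (t%:C * p * w / (b%:R * y)) = 0.
  move=> wy nB Lp; apply: fK; rewrite !normcM normcV normcM normc_nat normcR gtr0_norm//.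
  have pK : b%:R * K / t < normc p.
    by rewrite ltNge; apply/negP => h; apply: nB; split => //; rewrite subr0.
  rewrite ltr_pdivlMr ?mulr_gt0//; move: pK; rewrite ltr_pdivrMr// => pK.
  apply: (@le_lt_trans _ _ (b%:R * K * normc w)).
    rewrite [leLHS]mulrA [K * _]mulrC ler_pM2l ?mulr_gt0// (yw _ wy).
    by rewrite ler_piMl ?normc_ge0// exprn_ile1 ?normc_ge0 ?w1.
  by rewrite [t * _]mulrC ltr_pM2r ?w0.
have tail w : w ^+ b = y -> \sum_(p \in L `\ 0) f (t%:C * p * w / (b%:R * y)) =
    \sum_(p \in B `\ 0) f (t%:C * p * w / (b%:R * y)).
  move=> wy; apply/esym/fsbig_widen => [p [[]]//|p [[Lp p0] nB] /=].
  by apply: far => // Bp; apply: nB.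
have finB : finite_set (B `\ 0) by apply: sub_finite_set fin => p [].
have mtE : main_term t y =
    t ^+ 2 * sroots y (fun w => \sum_(p \in L `\ 0) f (t%:C * p * w / (b%:R * y))).
  rewrite (@eq_sum_roots R b b_gt0 _ _ _
    (fun w => \sum_(p \in B `\ 0) f (t%:C * p * w / (b%:R * y)))) //.
  congr (_ * _).
  transitivity (\sum_(p \in B `\ 0) sroots y (fun w => f (t%:C * p * w / (b%:R * y)))).
    apply/esym/fsbig_widen => [p [[]]//|p [[Lp p0] nB] /=].
    rewrite (@eq_sum_roots R b b_gt0 _ _ _ (fun=> 0)) ?sum_roots_cst ?mul0rn// => w wy.
    by apply: far => // Bp; apply: nB.
  rewrite fsbig_finite//= /sum_roots exchange_big/=; apply: eq_bigr => w _.
  by rewrite fsbig_finite.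
have rdE : radial_density y = sroots y (fun w => b%:R ^+ 2 * cintr f * normc w ^+ (2 * b.-1)).
  rewrite (@eq_sum_roots R b b_gt0 _ _ _
    (fun=> b%:R ^+ 2 * cintr f * normc (b.-root y : R[i]) ^+ (2 * b.-1))).
    by rewrite sum_roots_cst -mulr_natl /radial_density; ring.
  by move=> w wy; congr (_ * _ ^+ _); apply: (normc_root_eq wy); exact: rootCK.
have -> : main_term t y - radial_density y = sroots y (fun w =>
    t ^+ 2 * (\sum_(p \in L `\ 0) f (t%:C * p * w / (b%:R * y))) -
    b%:R ^+ 2 * cintr f * normc w ^+ (2 * b.-1)).
  by rewrite mtE rdE sum_rootsB /sum_roots mulr_sumr.
have -> : e = b%:R * (b%:R ^+ 2 * (e1 + e1)).
  by rewrite /e1; field; rewrite gt_eqF.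
apply: ler_norm_sum_roots => w wy.
pose c := t%:C * w / (b%:R * y).
have wn0 : w != 0 by rewrite -normc_gt0 w0.
have cn0 : c != 0 by rewrite !mulf_neq0 ?invr_eq0 ?mulf_neq0.
have cE : normc c = t * normc w / (b%:R * normc y).
  by rewrite !normcM normcV normcM normc_nat normcR gtr0_norm.
have cq : normc c < q.
  rewrite cE; apply: (@le_lt_trans _ _ (t / eta)); last by rewrite ltr_pdivrMr// mulrC.
  rewrite ler_pdivrMr ?mulr_gt0//; apply: (@le_trans _ _ t).
    by rewrite ler_piMr ?w1// ltW.
  rewrite mulrAC ler_pdivlMr// ler_pM2l//; apply: le_trans y1 _.
  by rewrite ler_peMl ?normc_ge0// ler1n.
move: cq; rewrite !lt_min => /and3P[c1 cd cM].
(* Equidistribution sums over all of [L]; the term [p = 0], absent from the main term, costs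
   [|c| ^ 2 f 0], at most [e1] because [|c| < 1] and [|c| < e1 / M]. *)
have := hd c 0 cn0 cd.
have -> : \sum_(p \in L) f (c * (0 + p)) =
    f 0 + \sum_(p \in L `\ 0) f (t%:C * p * w / (b%:R * y)).
  rewrite tail// -(@fsbig_widen _ _ _ _ B L).
  - rewrite (fsbigD1 0)//=; last by split; [exact: lattice0|rewrite subrr normc0].
    rewrite addr0 mulr0; congr (_ + _); apply: eq_fsbigr => p _; congr f.
    by rewrite add0r /c; ring.
  - by move=> p [].
  - move=> p [Lp nB] /=; rewrite (_ : c * (0 + p) = t%:C * p * w / (b%:R * y)).
      exact: far.
    by rewrite add0r /c; ring.
set s := \sum_(p \in _) _ => hs.
have t2 : t ^+ 2 = b%:R ^+ 2 * normc w ^+ (2 * b.-1) * normc c ^+ 2.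
  rewrite cE (yw _ wy).
  have -> : normc w ^+ (2 * b.-1) = (normc w ^+ b.-1) ^+ 2 by rewrite mulnC exprM.
  have wb0 : 0 < normc w ^+ b.-1 by rewrite exprn_gt0// w0.
  have wg0 := w0 _ wy.
  by field; rewrite !gt_eqF.
rewrite t2 (_ : _ - _ = b%:R ^+ 2 * normc w ^+ (2 * b.-1) *
  ((normc c ^+ 2 * (f 0 + s) - cintr f) - normc c ^+ 2 * f 0)); last by ring.
rewrite normrM ger0_norm; last by rewrite mulr_ge0 ?exprn_ge0 ?normc_ge0// ltW.
rewrite -mulrA ler_pM2l ?exprn_gt0//.
apply: (@le_trans _ _ `|normc c ^+ 2 * (f 0 + s) - cintr f - normc c ^+ 2 * f 0|).
  by rewrite ler_piMl// exprn_ile1 ?normc_ge0 ?w1.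
apply: le_trans (ler_normB _ _) _; apply: lerD => //.
rewrite normrM ger0_norm ?sqr_ge0//.
apply: (@le_trans _ _ (normc c * M)); last by rewrite ltW// -ltr_pdivlMr.
apply: ler_pM => //; first by rewrite sqr_ge0.
by rewrite expr2 ler_piMr ?normc_ge0// ltW.
Qed.

End subcritical_density.

(** * Averaging over rotations *)

Section rotation_average.
Context (R : realType).
Local Notation mu := (@lebesgue_measure R).
Local Notation Leb := (lebesgue_complex R).
Local Notation cop := (@complex_of_plane R).
Local Notation poc := (@plane_of_complex R).
Local Notation P := (plane R).

Definition dir (z : R[i]) : R[i] := z * ((normc z)^-1)%:C.

Lemma normc_dir z : z != 0 -> normc (dir z) = 1.
Proof.
move=> z0; rewrite normcM normcR ger0_norm ?invr_ge0 ?normc_ge0// divff//.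
by rewrite normc_eq0.
Qed.

Lemma dirM e z : normc e = 1 -> dir (e * z) = e * dir z.
Proof. by move=> e1; rewrite /dir normcM e1 mul1r mulrA. Qed.

Lemma dirK z : (normc z)%:C * dir z = z.
Proof.
have [->|z0] := eqVneq z 0; first by rewrite /dir mul0r mulr0.
by rewrite /dir mulrCA -rmorphM divff ?normc_eq0// mulr1.
Qed.

Lemma measurable_dir : measurable_fun [set: P] (poc \o dir \o cop).
Proof.
have mn : measurable_fun [set: P] (fun w => normc (cop w) `^ (-1) : R).
  have := measurable_comp (F := setT) measurableT (@subsetT _ _)
    (@measurable_powR R (-1)) (@measurable_normc R).
  exact.
have := measurable_fun_pair (measurable_funM (@measurable_fst _ _ _ _) mn)
  (measurable_funM (@measurable_snd _ _ _ _) mn).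
apply: eq_measurable_fun => -[x y] _.
rewrite /= /poc /dir/= !powR_inv1 ?normc_ge0//=.
by congr (_, _); rewrite ?mulr0 ?subr0 ?addr0 ?add0r.
Qed.

(** The origin is left out because [dir 0 = 0] is not of norm 1. *)
Definition unit_disc (z : R[i]) : bool := 0 < normc z <= 1.

Lemma unit_discE (w : P) : ((if unit_disc (cop w) then 1 else 0) : R) =
  \1_([set w : P | normc (cop w) <= 1] `\` [set w : P | normc (cop w) <= 0]) w.
Proof.
rewrite indicE /unit_disc; case: ifPn => [/andP[h1 h2]|].
  by rewrite mem_set//; split => //=; apply/negP; rewrite -ltNge.
rewrite negb_and -ltNge -leNgt => h; rewrite memNset// => -[/= h1 /negP].
by rewrite -ltNge => h2; move: h; rewrite leNgt h2 ltNge h1.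
Qed.

Lemma measurable_unit_disc :
  measurable_fun [set: P] (fun w => (if unit_disc (cop w) then 1 else 0) : R).
Proof.
rewrite (_ : (fun w => _) = \1_([set w : P | normc (cop w) <= 1] `\`
    [set w : P | normc (cop w) <= 0])); last by apply/funext => w; exact: unit_discE.
by apply: measurable_indic; apply: measurableD; exact: measurable_normc_le.
Qed.

Lemma integral_unit_disc :
  (\int[Leb]_w (if unit_disc (cop w) then 1 else 0)%:E = pi%:E)%E.
Proof.
under eq_integral do rewrite unit_discE.
have m1 := @measurable_normc_le R 1; have m0 := @measurable_normc_le R 0.
rewrite integral_indic//; last exact: measurableD.
have l1 : Leb [set w : P | normc (cop w) <= 1] = pi%:E.
  by rewrite lebesgue_normc_le// expr1n mulr1.
have l0 : Leb [set w : P | normc (cop w) <= 0] = 0%E.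
  by rewrite lebesgue_normc_le// expr0n mulr0.
rewrite setIT [LHS](measureD m1 m0); last by rewrite [X in (X < _)%E]l1 ltry.
rewrite setIidr; last by move=> w /= h; rewrite (le_trans h).
by rewrite [X in (X - _)%E]l1 [X in (_ - X)%E]l0 sube0.
Qed.

Lemma integral_unit_discZ (c : R) : 0 <= c ->
  (\int[Leb]_w (if unit_disc (cop w) then c else 0)%:E = (c * pi)%:E)%E.
Proof.
move=> c0; rewrite EFinM -integral_unit_disc -ge0_integralZl_EFin//.
- by apply: eq_integral => w _; case: ifP; rewrite ?mule1 ?mule0.
- by move=> w _; case: ifP => _; rewrite lee_fin.
- by apply/measurable_EFinP; exact: measurable_unit_disc.
Qed.

Lemma measurable_unit_discZ (c : R) :
  measurable_fun [set: P] (fun w => (if unit_disc (cop w) then c else 0)%:E : \bar R).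
Proof.
apply/measurable_EFinP;
  have := measurable_funM (@measurable_cst _ _ P _ setT c) measurable_unit_disc.
by apply: eq_measurable_fun => w _ /=; case: ifP => _; rewrite ?mulr1 ?mulr0.
Qed.

(* The library's sigma-finite structure on products is shadowed by the one for *)
(* subprobability measures, hence this copy of the Lebesgue measure.           *)
Definition plane_measure : set P -> \bar R := Leb.

HB.instance Definition _ := Measure.copy plane_measure Leb.

Lemma plane_measure_sigma_finite : sigma_finite setT plane_measure.
Proof.
exists (fun n => [set w : P | normc (cop w) <= n%:R]).
  apply/esym; rewrite -subTset => w _; exists (Num.truncn (normc (cop w))).+1 => //=.
  by rewrite ltW// truncnS_gt.
move=> n; split; first exact: measurable_normc_le.
by rewrite /plane_measure lebesgue_normc_le// ltry.
Qed.

HB.instance Definition _ := Measure_isSigmaFinite.Build _ _ _ plane_measure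
  plane_measure_sigma_finite.

(** All [F e] with [|e| = 1] have the same integral. Integrating it over the directions of the
    points of the unit disc, of area [pi], and applying Tonelli's theorem moves the average inside;
    continuity in [a] provides joint measurability. *)
Lemma rotation_swap (F : R[i] -> P -> R) :
  (forall a w, 0 <= F a w) -> (forall a, measurable_fun [set: P] (F a)) ->
  (forall w a (e : R), 0 < e ->
    exists2 r : R, 0 < r & forall a', normc (a - a') < r -> `|F a w - F a' w| < e) ->
  (forall e, normc e = 1 ->
    (\int[Leb]_w (F e w)%:E = \int[Leb]_w (F 1 w)%:E)%E) ->
  (pi%:E * \int[Leb]_w (F 1 w)%:E =
   \int[Leb]_w \int[Leb]_v (if unit_disc (cop v) then F (dir (cop v)) w else 0)%:E)%E.
Proof.
move=> F0 mF cF rF.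
have mJ : measurable_fun [set: P * P] (fun x => F (cop x.1) x.2).
  exact: measurable_caratheodory.
have cpoc z : cop (poc z) = z by case: z.
have mJd : measurable_fun [set: P * P]
    (fun x => (if unit_disc (cop x.1) then 1 else 0) * F (dir (cop x.1)) x.2 : R).
  apply: measurable_funM.
    exact: (measurableT_comp measurable_unit_disc (@measurable_fst _ _ _ _)).
  have := measurable_comp (F := setT) measurableT (@subsetT _ _) mJ
    (measurable_fun_pair (measurableT_comp measurable_dir (@measurable_fst _ _ P P))
      (@measurable_snd _ _ P P)).
  by apply: eq_measurable_fun => x _ /=; rewrite cpoc.
have mJE : measurable_fun [set: P * P]
    (fun x => (if unit_disc (cop x.1) then F (dir (cop x.1)) x.2 else 0)%:E : \bar R).
  apply/measurable_EFinP; move: mJd; apply: eq_measurable_fun => x _.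
  by case: ifP => _; rewrite ?mul1r ?mul0r.
have tonelli := @fubini_tonelli _ _ P P R plane_measure plane_measure _ mJE.
rewrite -[RHS]/(\int[plane_measure]_w \int[plane_measure]_v
   (if unit_disc (cop v) then F (dir (cop v)) w else 0)%:E)%E -[RHS]tonelli; last first.
  by move=> x; rewrite lee_fin; case: ifP.
rewrite -integral_unit_disc -ge0_integralZr//; last 3 first.
- by apply/measurable_EFinP; exact: measurable_unit_disc.
- by move=> v _; case: ifP => _; rewrite lee_fin.
- by apply: integral_ge0 => w _; rewrite lee_fin.
apply: eq_integral => v _; case: ifPn => [/andP[v0 _]|_]; last first.
  by rewrite mul0e integral0.
rewrite mul1e; have d1 : normc (dir (cop v)) = 1.
  by apply: normc_dir; rewrite -normc_gt0.
by rewrite -(rF _ d1).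
Qed.

Variable f : R[i] -> R.
Hypothesis tf : testfun f.

Let f0 z : 0 <= f z. Proof. by case: tf. Qed.

(** [pi] times the mean of [f] over the circle through [z]. The factor [pi] is the one that
    [ge0_integral_radial] produces. *)
Definition avg (z : R[i]) : R :=
  cintr (fun v => if unit_disc v then f (dir v * z) else 0).

Lemma measurable_avg z : measurable_fun [set: P]
  (fun w => if unit_disc (cop w) then f (dir (cop w) * z) else 0).
Proof.
have tz : measurable_fun [set: P] ((fun a => f (a * z)) \o cop).
  have := measurable_cscale z (testfun_measurable tf).
  by apply: eq_measurable_fun => w _ /=; rewrite mulrC.
have mz : measurable_fun [set: P] (fun w => f (dir (cop w) * z)).
  have := measurable_comp (F := setT) measurableT (@subsetT _ _) tz measurable_dir.
  by apply: eq_measurable_fun => w _; rewrite /comp; case: (dir _).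
have := measurable_funM measurable_unit_disc mz.
by apply: eq_measurable_fun => w _ /=; case: ifP => _; rewrite ?mul1r ?mul0r.
Qed.

Lemma avgE z :
  (\int[Leb]_w (if unit_disc (cop w) then f (dir (cop w) * z) else 0)%:E = (avg z)%:E)%E.
Proof.
have [M M0 fM] := testfun_bounded tf.
rewrite /avg /cintr /Rintegral fineK// ge0_fin_numE; last first.
  by apply: integral_ge0 => w _; rewrite lee_fin /=; case: ifP.
apply: (@le_lt_trans _ _ (M * pi)%:E); last by rewrite ltry.
rewrite -integral_unit_discZ ?(ltW M0)//; apply: ge0_le_integral => //.
- by move=> w _; rewrite lee_fin /=; case: ifP.
- by apply/measurable_EFinP; exact: measurable_avg.
- exact: measurable_unit_discZ.
- move=> w _ /=; case: ifP => _; rewrite lee_fin//.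
  exact: le_trans (ler_norm _) (fM _).
Qed.

Lemma avg_ge0 z : 0 <= avg z.
Proof. by apply: Rintegral_ge0 => w _ /=; case: ifP. Qed.

Lemma avg_rot e z : normc e = 1 -> avg (e * z) = avg z.
Proof.
move=> e1; apply: EFin_inj; rewrite -!avgE.
pose g v : \bar R := (if unit_disc v then f (dir v * z) else 0)%:E.
have e0 : e != 0 by rewrite -normc_gt0 e1.
transitivity (\int[Leb]_w g (e * cop w)%R)%E.
  apply: eq_integral => w _; rewrite /g /unit_disc normcM e1 mul1r dirM//.
  by rewrite mulrCA mulrA.
rewrite ge0_cint_scale//.
- by rewrite e1 expr1n invr1 mul1e.
- by apply/measurable_EFinP; exact: measurable_avg.
- by move=> v; rewrite /g lee_fin; case: ifP.
Qed.

Definition avgr (s : R) : R := avg (Num.sqrt s)%:C.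

Lemma avg_radial z : avg z = avgr (normc z ^+ 2).
Proof.
rewrite /avgr sqrtr_sqr ger0_norm ?normc_ge0//.
have [->|z0] := eqVneq z 0; first by rewrite normc0.
by rewrite -[in LHS](dirK z) mulrC avg_rot// normc_dir.
Qed.

Lemma avg_supp (K : R) z : (forall z, K < normc z -> f z = 0) -> K < normc z -> avg z = 0.
Proof.
move=> fK zK; apply: EFin_inj; rewrite -avgE integral0_eq// => w _.
case: ifPn => // /andP[w0 _]; rewrite fK// normcM normc_dir ?mul1r//.
by rewrite -normc_gt0.
Qed.

(** Rotations preserve distances, so the modulus of continuity of [f] passes to its average, up to
    the factor [pi]. *)
Lemma avg_unif_cont : unif_cont avg.
Proof.
move=> e e0; have [_ uf _] := tf.
have p0 : 0 < pi + 1 :> R by rewrite ltr_wpDl ?pi_ge0.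
have ep : 0 < e / (pi + 1) by rewrite divr_gt0.
have [d d0 fd] := uf _ ep; exists d => //.
have half z w : normc (z - w) < d -> avg z <= avg w + e / (pi + 1) * pi.
  move=> zw; rewrite -lee_fin EFinD -!avgE -integral_unit_discZ ?(ltW ep)//.
  rewrite -ge0_integralD//; last 4 first.
  - by move=> v _; rewrite lee_fin; case: ifP.
  - by apply/measurable_EFinP; exact: measurable_avg.
  - by move=> v _; rewrite lee_fin; case: ifP => // _; exact: ltW.
  - exact: measurable_unit_discZ.
  apply: ge0_le_integral => //.
  - by move=> v _; rewrite lee_fin; case: ifP.
  - by apply/measurable_EFinP; exact: measurable_avg.
  - apply: emeasurable_funD; first by apply/measurable_EFinP; exact: measurable_avg.
    exact: measurable_unit_discZ.
  - move=> v _; case: ifPn => [/andP[v0 _]|_]; last by rewrite adde0.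
    rewrite -EFinD lee_fin -lerBlDl; apply: le_trans (ler_norm _) _; apply/ltW/fd.
    by rewrite -mulrBr normcM normc_dir ?mul1r// -normc_gt0.
have lt : e / (pi + 1) * pi < e.
  by rewrite mulrAC ltr_pdivrMr// ltr_pM2l// ltrDl.
move=> z w zw; have h1 := half _ _ zw; have h2 := half w z.
rewrite normcB in zw; have {}h2 := h2 zw.
by rewrite ltr_norml; lra.
Qed.

Lemma avgr_continuous : continuous avgr.
Proof.
move=> s; apply/cvgrPdist_lt => e e0; have [d d0 fd] := avg_unif_cont e0.
have := @sqrt_continuous R s; move=> /cvgrPdist_lt/(_ _ d0).
apply: filterS => t ht; apply: fd.
by rewrite -rmorphB normcR.
Qed.

(** The weight being radial, rotating the argument of [f] does not change the integral. After
    averaging, the integrand depends on [|z| ^ 2] alone and the radial formula applies; its factor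
    [pi] cancels that of [rotation_swap]. *)
Lemma integral_radial_weight (W : R -> R) : measurable_fun [set: R] W ->
  (forall s, 0 <= W s) ->
  (\int[Leb]_w (f (cop w) * W (sqn w))%:E =
   \int[mu]_(s in `[0%R, +oo[) (avgr s * W s)%:E)%E.
Proof.
move=> mW W0; pose F (a : R[i]) (w : P) : R := f (a * cop w) * W (sqn w).
have mWs : measurable_fun [set: P] (fun w => W (sqn w) : R).
  exact: (measurableT_comp mW (@measurable_sqn R)).
have := @rotation_swap F.
move=> /(_ _)/wrap[]; first by move=> a w; rewrite mulr_ge0.
move=> /(_ _)/wrap[].
  by move=> a; apply: measurable_funM => //; exact: (measurable_cscale a (testfun_measurable tf)).
move=> /(_ _)/wrap[].
  move=> w a e e0; have [_ uf _] := tf.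
  have W1 : 0 < W (sqn w) + 1 by rewrite ltr_wpDl.
  have [d d0 fd] := unif_cont_scale (cop w) uf (divr_gt0 e0 W1); exists d => // a' aa'.
  rewrite /F -mulrBl normrM [`|W _|]ger0_norm//.
  have := fd _ _ aa'; rewrite ![cop w * _]mulrC => h.
  apply: (@le_lt_trans _ _ (e / (W (sqn w) + 1) * W (sqn w))).
    by rewrite ler_wpM2r// ltW.
  by rewrite mulrAC ltr_pdivrMr// ltr_pM2l// ltrDl.
move=> /(_ _)/wrap[].
  move=> e e1; have e0 : e != 0 by rewrite -normc_gt0 e1.
  pose g z : \bar R := (f z * W (normc z ^+ 2))%:E.
  transitivity (\int[Leb]_w g (e * cop w)%R)%E.
    by apply: eq_integral => w _; rewrite /g normcM e1 mul1r /F sqnE.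
  rewrite ge0_cint_scale//.
  - rewrite e1 expr1n invr1 mul1e; apply: eq_integral => w _.
    by rewrite /g /F mul1r sqnE.
  - apply/measurable_EFinP.
    have := measurable_funM (testfun_measurable tf) mWs.
    by apply: eq_measurable_fun => w _ /=; rewrite sqnE.
  - by move=> z; rewrite lee_fin mulr_ge0.
rewrite /F; under eq_integral do rewrite mul1r.
move=> h.
have p0 : (pi%:E != 0 :> \bar R)%E by rewrite eqe gt_eqF// pi_gt0.
have h2 : (\int[Leb]_w \int[Leb]_v (if unit_disc (cop v)
    then f (dir (cop v) * cop w) * W (sqn w) else 0)%:E =
    pi%:E * \int[mu]_(s in `[0%R, +oo[) (avgr s * W s)%:E)%E.
  rewrite -(@ge0_integral_radial R (fun s => (avgr s * W s)%:E)); last 2 first.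
  - apply/measurable_EFinP; apply: measurable_funM => //.
    by apply: continuous_measurable_fun; exact: avgr_continuous.
  - by move=> s; rewrite lee_fin mulr_ge0// avg_ge0.
  apply: eq_integral => w _.
  transitivity (\int[Leb]_v ((W (sqn w))%:E *
      (if unit_disc (cop v) then f (dir (cop v) * cop w) else 0)%:E))%E.
    by apply: eq_integral => v _; case: ifP => _; rewrite -EFinM ?mulr0// mulrC.
  rewrite ge0_integralZl//.
  - by rewrite avgE -EFinM avg_radial -sqnE mulrC.
  - by apply/measurable_EFinP; exact: measurable_avg.
  - by move=> v _; rewrite lee_fin; case: ifP.
  - by rewrite lee_fin.
rewrite h2 in h.
have := congr1 (fun x => ((pi^-1)%:E * x)%E) h.
by rewrite !muleA -EFinM mulVf ?mul1e// gt_eqF// pi_gt0.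
Qed.

End rotation_average.

(** * Integrals over the disc *)

Section power_integrals.
Context (R : realType).
Local Notation mu := (@lebesgue_measure R).

Lemma powR_continuous (p x : R) : 0 < x -> {for x, continuous (@powR R ^~ p)}.
Proof.
move=> x0; apply: differentiable_continuous; apply/derivable1_diffP.
by apply: derivable_powR; rewrite in_itv/= x0.
Qed.

Lemma integral_powR (p : R) : 0 < p ->
  (\int[mu]_(s in `[0%R, 1%R]) (s `^ p)%:E = ((p + 1)^-1)%:E)%E.
Proof.
move=> p0; have p1 : 0 < p + 1 by rewrite addr_gt0.
rewrite (@continuous_FTC2 _ _ (fun s => (p + 1)^-1 * s `^ (p + 1)))//.
- by rewrite powR1 mulr1 powR0 ?gt_eqF// mulr0 sube0.
- apply/continuous_within_itvP => //; split.
  + by move=> x; rewrite in_itv/= => /andP[x0 _]; exact: powR_continuous.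
  + by rewrite powR0 ?gt_eqF//; exact: powR_cvg0.
  + by apply: cvg_at_left_filter; exact: powR_continuous.
- split.
  + move=> x; rewrite in_itv/= => /andP[x0 _]; apply: derivableM => //.
    by apply: derivable_powR; rewrite in_itv/= x0.
  + rewrite powR0 ?gt_eqF//; apply: cvgMr; exact: powR_cvg0.
  + by apply: cvgMr; apply: cvg_at_left_filter; exact: powR_continuous.
- move=> x; rewrite in_itv/= => /andP[x0 _]; rewrite derive1E deriveZ/=; last first.
    by apply: derivable_powR; rewrite in_itv/= x0.
  rewrite -derive1E powR_derive1 ?in_itv/= ?x0//.
  by rewrite /GRing.scale/= addrK mulrA mulVf ?mul1r// gt_eqF.
Qed.

(** Substitution by [F s = (c / s) ^ q], decreasing from 1 at [s = c]. As [g] vanishes beyond [T],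
    the integrals reduce to the compact intervals [[c, T]] and [[F T, 1]], away from the singularity
    at 0. *)
Lemma integral_powR_subst (q c : R) (g : R -> R) (T : R) : 0 < q -> 0 < c ->
  continuous g -> (forall s, 0 <= g s) -> (forall s, T < s -> g s = 0) ->
  (\int[mu]_(s in `[0%R, +oo[) (if 0 < s < 1 then g (c * s `^ (- q^-1)) else 0)%:E =
   \int[mu]_(s in `[0%R, +oo[)
     (g s * (if c <= s then q * c `^ q * s `^ (- q - 1) else 0))%:E)%E.
Proof.
move=> q0 c0 cg g0 gT.
(* Enlarging [T] keeps [g] zero beyond it. *)
wlog cT : T gT / c < T.
  move=> /(_ (Num.max T (c + 1))); apply.
    by move=> s; rewrite gt_max => /andP[/gT].
  by rewrite lt_max ltrDl ltr01 orbT.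
have T0 := lt_trans c0 cT.
pose F s := c `^ q * s `^ (- q); pose G s := g (c * s `^ (- q^-1)).
have Fc : F c = 1.
  by rewrite /F powRN divff// gt_eqF// powR_gt0.
have FT0 : 0 < F T by rewrite mulr_gt0 ?powR_gt0.
have GF t : 0 < t -> c * F t `^ (- q^-1) = t.
  move=> t0; rewrite /F powRM ?powR_ge0// -!powRrM mulrNN mulfV ?gt_eqF// powRr1 ?(ltW t0)//.
  by rewrite mulrN mulfV ?gt_eqF// powR_inv1 ?(ltW c0)// mulrA divff ?mul1r// gt_eqF.
have decrF : {in `[c, T] &, {homo F : x y /~ x < y}}.
  move=> x y; rewrite !in_itv/= => /andP[cx _] /andP[cy _] xy.
  have x0 := lt_le_trans c0 cx; have y0 := lt_le_trans c0 cy.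
  rewrite /F ltr_pM2l ?powR_gt0// !powRN ltf_pV2 ?posrE ?powR_gt0//.
  by rewrite gt0_ltr_powR// ?nnegrE ltW.
have dF x : 0 < x -> derive1 F x = - (q * c `^ q * x `^ (- q - 1)).
  move=> x0; rewrite derive1E deriveZ/=; last first.
    by apply: derivable_powR; rewrite in_itv/= x0.
  rewrite -derive1E powR_derive1 ?in_itv/= ?x0//.
  by rewrite /GRing.scale/=; ring.
have cW x : 0 < x -> {for x, continuous (fun x => - (q * c `^ q * x `^ (- q - 1)))}.
  by move=> x0; apply: cvgN; apply: cvgMr; exact: powR_continuous.
have cF' x : 0 < x -> {for x, continuous (derive1 F)}.
  move=> x0; rewrite /prop_for/continuous_at dF//; apply: cvg_trans (cW _ x0).
  apply: near_eq_cvg; near=> z; rewrite dF//.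
  by near: z; exact: lt_nbhsr.
have cF x : 0 < x -> {for x, continuous F}.
  by move=> x0; apply: cvgMr; exact: powR_continuous.
have cG x : 0 < x -> {for x, continuous G}.
  move=> x0; apply: (@continuous_comp _ _ _ (fun s => c * s `^ (- q^-1)) g); last exact: cg.
  by apply: cvgMr; exact: powR_continuous.
have F1 : F T < 1 by rewrite -Fc; apply: decrF; rewrite // in_itv/= lexx ltW.
have sub := @integration_by_substitution_decreasing R F G c T (ltW cT) decrF.
have {}sub : (\int[mu]_(x in `[F T, F c]) (G x)%:E =
    \int[mu]_(x in `[c, T]) (((G \o F) * - derive1 F) x)%:E)%E.
  apply: sub.
  - by move=> x; rewrite in_itv/= => /andP[cx _]; apply: cF'; exact: lt_trans cx.
  - by apply/cvg_ex; exists (derive1 F c); apply: cvg_at_right_filter; exact: cF'.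
  - by apply/cvg_ex; exists (derive1 F T); apply: cvg_at_left_filter; exact: cF'.
  - split.
    + move=> x; rewrite in_itv/= => /andP[cx _]; apply: derivableM => //.
      by apply: derivable_powR; rewrite in_itv/= (lt_trans c0).
    + by apply: cvg_at_right_filter; exact: cF.
    + by apply: cvg_at_left_filter; exact: cF.
  - rewrite Fc; apply: continuous_in_subspaceT => x; rewrite inE/= in_itv/= => /andP[xT _].
    by apply: cG; exact: lt_le_trans xT.
have mG : measurable_fun `[F T, 1[ (EFin \o G).
  apply/measurable_EFinP; apply: subspace_continuous_measurable_fun => //.
  apply: continuous_in_subspaceT => x; rewrite inE/= in_itv/= => /andP[xT _].
  by apply: cG; exact: lt_le_trans xT.
(* For [0 < s < F T] the argument [c s ^ (- 1 / q)] exceeds [T], so [g] vanishes there. *)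
transitivity (\int[mu]_(x in `[F T, F c]) (G x)%:E)%E.
  rewrite Fc -integral_itv_bndo_bndc//.
  rewrite integral_mkcond [RHS]integral_mkcond; apply: eq_integral => s _.
  rewrite /patch !mem_setE !in_itv/= andbT.
  have [s1|s1] := ltP s 1; last by rewrite !andbF if_same.
  have [s0|s0] := ltP 0 s; last first.
    by rewrite [F T <= s]leNgt (le_lt_trans s0 FT0)/= if_same.
  rewrite (ltW s0) !andbT/=; case: leP => // sT; congr EFin.
  apply: gT; rewrite -[ltLHS](GF T T0) ltr_pM2l// !powRN ltf_pV2 ?posrE ?powR_gt0//.
  by rewrite gt0_ltr_powR ?invr_gt0// ?nnegrE ltW.
rewrite sub integral_mkcond [RHS]integral_mkcond; apply: eq_integral => s _.
rewrite /patch !mem_setE !in_itv/= andbT.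
have [cs|cs] := leP c s; last by rewrite /= mulr0 if_same.
have s0 := lt_le_trans c0 cs.
rewrite (ltW s0)/=; case: leP => sT; last by rewrite gT// mul0r.
by rewrite /G/= !fctE dF// opprK/= GF.
Unshelve. all: by end_near. Qed.

End power_integrals.

(** * The contribution of one lattice vector in the critical case *)

Section root_ray_integral.
Context (R : realType) (b : nat).
Hypothesis b_gt1 : (1 < b)%N.
Let b_gt0 : (0 < b)%N := ltnW b_gt1.
Variable f : R[i] -> R.
Hypothesis tf : testfun f.
Local Notation mu := (@lebesgue_measure R).
Local Notation Leb := (lebesgue_complex R).
Local Notation cop := (@complex_of_plane R).
Local Notation P := (plane R).
Local Notation sroots := (@sum_roots R b b_gt0 _).
Local Notation alpha := (b%:R^-1 : R).
Implicit Types (v y z : R[i]).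

Let f0 z : 0 <= f z. Proof. by case: tf. Qed.
Let bR : 0 < b%:R :> R. Proof. by rewrite ltr0n. Qed.

(** For [v = p / b], the term of the vector [p] in the main term at [t = 1]. *)
Definition ray_sum v y : R := sroots y (fun w => f (v * (w / y))).

Lemma ray_sum_ge0 v y : 0 <= ray_sum v y.
Proof. by apply: sumr_ge0. Qed.

Lemma ray_sum_bounded : exists2 M : R, 0 <= M & forall v y, ray_sum v y <= M.
Proof.
have [M M0 fM] := testfun_bounded tf; exists (b%:R * M); first by rewrite mulr_ge0// ltW.
move=> v y; apply: le_trans (ler_norm _) _.
by apply: ler_norm_sum_roots => w _; exact: fM.
Qed.

Lemma ray_sum_measurable v : measurable_fun [set: P] (punctured (ray_sum v) \o cop).
Proof.
have [M M0 fM] := ray_sum_bounded.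
apply: punctured_measurable => eta eta0 eta2.
apply: (@testfun_cutM _ _ M) => //; first exact: ray_sum_ge0.
exact: root_sum_annulus.
Qed.

Lemma ray_sum_continuous y v (e : R) : 0 < e ->
  exists2 r : R, 0 < r & forall a a' : R[i], normc (a - a') < r ->
    `|ray_sum (a * v) y - ray_sum (a' * v) y| < e.
Proof.
move=> e0; have [_ uf _] := tf.
have e1 : 0 < e / (b%:R + 1) by rewrite divr_gt0// addr_gt0.
have [d d0 fd] := uf _ e1.
pose m := normc v * normc (b.-root y / y) + 1.
have m0 : 0 < m by rewrite ltr_wpDl// mulr_ge0// normc_ge0.
exists (d / m); first by rewrite divr_gt0.
move=> a a' aa'; rewrite /ray_sum -sum_rootsB.
apply: (@le_lt_trans _ _ (b%:R * (e / (b%:R + 1)))); last first.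
  by rewrite mulrCA gtr_pMr// ltr_pdivrMr ?addr_gt0// mul1r ltrDl.
apply: ler_norm_sum_roots => w wy; apply/ltW/fd.
have wn : normc w = normc (b.-root y).
  by apply: (@normc_root_eq _ _ b_gt0 _ _ y) => //; rewrite rootCK.
rewrite -mulrBl -mulrBl !normcM wn -mulrA.
apply: (@le_lt_trans _ _ (normc (a - a') * m)).
  by rewrite ler_wpM2l ?normc_ge0// /m normcM lerDl.
by rewrite -ltr_pdivlMr.
Qed.

(** Choose [r] with [r ^ (b - 1) = 1 / e], possible since [b > 1]. Replacing [y] by [r ^ b y]
    preserves Lebesgue measure and multiplies the roots of [y] by [r], hence [w / y] by
    [r ^ (1 - b) = e]. *)
Lemma ray_sum_rot v (e : R[i]) : normc e = 1 ->
  (\int[Leb]_w (punctured (ray_sum (e * v)) (cop w))%:E =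
   \int[Leb]_w (punctured (ray_sum v) (cop w))%:E)%E.
Proof.
move=> e1; have e0 : e != 0 by rewrite -normc_gt0 e1.
have b1 : (0 < b.-1)%N by rewrite -ltnS prednK.
pose r := b.-1.-root e^-1.
have rb : r ^+ b.-1 = e^-1 by rewrite rootCK.
have r1 : normc r = 1.
  have : normc r ^+ b.-1 = 1 by rewrite -normcX rb normcV e1 invr1.
  by move/eqP; rewrite pexpr_eq1 ?normc_ge0// => /eqP.
have r0 : r != 0 by rewrite -normc_gt0 r1.
have rb0 : r ^+ b != 0 by rewrite expf_neq0.
transitivity (\int[Leb]_w ((fun z => (punctured (ray_sum v) z)%:E) (r ^+ b * cop w)%R))%E.
  apply: eq_integral => w _; congr EFin.
  rewrite /punctured normcM normcX r1 expr1n mul1r; case: ifPn => // /andP[w0 _].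
  have y0 : cop w != 0 by rewrite -normc_gt0.
  rewrite /ray_sum (sum_rootsE b_gt0 _ (u := r * b.-root (cop w)) (y := r ^+ b * cop w)).
  - rewrite /sum_roots; apply: eq_bigr => x _; congr f.
    rewrite -(prednK b_gt0) exprS rb.
    by field; rewrite e0 y0 r0.
  - by rewrite exprMn rootCK.
  - by rewrite mulf_neq0.
rewrite (@ge0_cint_scale _ (fun z => (punctured (ray_sum v) z)%:E))//.
- by rewrite normcX r1 !expr1n invr1 mul1e.
- by apply/measurable_EFinP; exact: ray_sum_measurable.
- by move=> z; rewrite lee_fin /punctured; case: ifP => // _; exact: ray_sum_ge0.
Qed.

Let q : R := (1 - alpha)^-1.

Let a1 : 0 < 1 - alpha.
Proof. by rewrite subr_gt0 invf_lt1// ltr1n. Qed.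

Let q0 : 0 < q. Proof. by rewrite invr_gt0. Qed.

(** Density of the image of Lebesgue measure on the unit interval under [s = c r ^ (alpha - 1)]. *)
Definition ray_weight (c s : R) : R := if c <= s then q * c `^ q * s `^ (- q - 1) else 0.

Lemma ray_weight_ge0 c s : 0 <= ray_weight c s.
Proof. by rewrite /ray_weight; case: ifP => // _; rewrite !mulr_ge0 ?powR_ge0// ltW. Qed.

Lemma measurable_ray_weight c : measurable_fun [set: R] (ray_weight c).
Proof.
apply: measurable_fun_ifT => //.
- by apply: measurable_fun_ler.
- by apply: measurable_funM => //; exact: measurable_powR.
Qed.

(** For every root [w] of [y], [|v w / y| ^ 2 = |v| ^ 2 |y| ^ (2 alpha - 2)]: after averaging, the
    [b] determinations contribute equally. *)
Lemma ray_avg v (w : P) : v != 0 -> 0 < normc (cop w) < 1 ->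
  (\int[Leb]_x (if unit_disc (cop x) then ray_sum (dir (cop x) * v) (cop w) else 0)%:E =
   (b%:R * avgr f (normc v ^+ 2 * sqn w `^ (- q^-1)))%:E)%E.
Proof.
move=> v0 /andP[w0 w1]; set y := cop w.
have y0 : y != 0 by rewrite -normc_gt0.
transitivity (\int[Leb]_x \sum_(u <- unity_roots R b_gt0) (if unit_disc (cop x)
    then f (dir (cop x) * (v * (b.-root y * u / y))) else 0)%:E)%E.
  apply: eq_integral => x _; case: ifP => _; last by rewrite big1.
  by rewrite /ray_sum /sum_roots -sumEFin; apply: eq_bigr => u _; rewrite [dir _ * (v * _)]mulrA.
rewrite ge0_integral_sum//; last 2 first.
- by move=> u; apply/measurable_EFinP; exact: measurable_avg.
- by move=> u x _; rewrite lee_fin; case: ifP.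
under eq_bigr do rewrite avgE//.
rewrite sumEFin; congr EFin.
rewrite (eq_big_seq (fun=> avgr f (normc v ^+ 2 * sqn w `^ (- q^-1)))); last first.
  move=> u; rewrite mem_unity_roots => /eqP u1; rewrite avg_radial//; congr (avgr f _).
  rewrite !normcM normcV (normc_unity_root b_gt0 u1) mulr1 exprMn; congr (_ * _).
  have /(congr1 (@normc R)) := rootCK b_gt0 y; rewrite normcX => ry.
  have -> : sqn w = normc (b.-root y) ^+ (b * 2).
    by rewrite sqnE -/y exprM ry.
  have rp : 0 < normc (b.-root y).
    by rewrite normc_gt0; apply/eqP => h; move: y0;
      rewrite -normc_gt0 -ry h normc0 expr0n gtn_eqF// ltxx.
  have rn := ltW rp.
  rewrite -ry exprMn exprVn -!powR_mulrn ?powR_ge0// -!powRrM -powRN -powRD; last first.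
    by apply/implyP => _; rewrite gt_eqF.
  by congr (_ `^ _); rewrite /q invrK natrM; field; rewrite pnatr_eq0 -lt0n.
rewrite big_const_seq count_predT (size_unity_roots _ b_gt0) iter_addr_0.
by rewrite mulr_natl.
Qed.

(** Invariance under rotation of [v] turns both sides into integrals of [avgr f] over the half-line,
    which the substitution [s = |v| ^ 2 r ^ (alpha - 1)] identifies. *)
Lemma ray_integral v : v != 0 ->
  (\int[Leb]_w (punctured (ray_sum v) (cop w))%:E =
   b%:R%:E * \int[Leb]_w (f (cop w) * ray_weight (normc v ^+ 2) (sqn w))%:E)%E.
Proof.
move=> v0; pose F (a : R[i]) (w : P) : R := punctured (ray_sum (a * v)) (cop w).
have c0 : 0 < normc v ^+ 2 by rewrite exprn_gt0// normc_gt0.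
have [K K0 fK] : bounded_supp f by case: tf.
have := @rotation_swap R F.
move=> /(_ _)/wrap[].
  by move=> a w; rewrite /F /punctured; case: ifP => // _; exact: ray_sum_ge0.
move=> /(_ _)/wrap[]; first by move=> a; exact: ray_sum_measurable.
move=> /(_ _)/wrap[].
  move=> w a e e0; have [r r0 h] := ray_sum_continuous (cop w) v e0; exists r => // a' aa'.
  by rewrite /F /punctured; case: ifP => _; [exact: h | rewrite subrr normr0].
move=> /(_ _)/wrap[].
  by move=> e e1; rewrite /F mul1r; exact: ray_sum_rot.
rewrite /F; under eq_integral do rewrite mul1r.
move=> h.
have p0 : (pi%:E != 0 :> \bar R)%E by rewrite eqe gt_eqF// pi_gt0.
pose g (s : R) : R := if 0 < s < 1 then avgr f (normc v ^+ 2 * s `^ (- q^-1)) else 0.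
have g0 s : 0 <= g s by rewrite /g; case: ifP => // _; exact: avg_ge0.
have mg : measurable_fun [set: R] g.
  apply: measurable_fun_ifT => //.
    by apply: measurable_and; apply: measurable_fun_ltr.
  have ma : measurable_fun [set: R] (avgr f).
    by apply: continuous_measurable_fun; exact: avgr_continuous.
  apply: (measurableT_comp ma); apply: measurable_funM => //; exact: measurable_powR.
have h2 : (\int[Leb]_w \int[Leb]_x (if unit_disc (cop x)
    then punctured (ray_sum (dir (cop x) * v)) (cop w) else 0)%:E =
    pi%:E * (b%:R%:E * \int[Leb]_w (f (cop w) * ray_weight (normc v ^+ 2) (sqn w))%:E))%E.
  rewrite integral_radial_weight//; last 2 first.
  - exact: measurable_ray_weight.
  - exact: ray_weight_ge0.
  rewrite -(@integral_powR_subst R q (normc v ^+ 2) (avgr f) (K ^+ 2))//; last 3 first.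
  - exact: avgr_continuous.
  - by move=> s; exact: avg_ge0.
  - move=> s Ks; apply: (avg_supp tf fK); rewrite normcR ger0_norm ?sqrtr_ge0//.
    by rewrite -[K](@ger0_norm _ K) ?(ltW K0)// -sqrtr_sqr ltr_sqrt// (le_lt_trans _ Ks)// sqr_ge0.
  rewrite muleCA -(@ge0_integral_radial R (fun s => (g s)%:E)); last 2 first.
  - exact/measurable_EFinP.
  - by move=> s; rewrite lee_fin.
  rewrite -ge0_integralZl//; last 2 first.
  - apply/measurable_EFinP; exact: (measurableT_comp mg (@measurable_sqn R)).
  - by move=> w _; rewrite lee_fin.
  apply: eq_integral => w _.
  have nw : (0 < sqn w < 1) = (0 < normc (cop w) < 1).
    rewrite sqnE; move: (cop w) => y.
    by rewrite exprn_even_gt0//= normc_eq0 -normc_gt0 expr_lt1// normc_ge0.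
  have [hw|/negPf hw] := boolP (0 < normc (cop w) < 1).
    have := ray_avg v0 hw; rewrite EFinM /g nw hw => <-.
    by apply: eq_integral => x _; rewrite /punctured hw.
  rewrite /g nw hw mule0; apply: integral0_eq => x _.
  by rewrite /punctured hw if_same.
rewrite h2 in h.
have := congr1 (fun x => ((pi^-1)%:E * x)%E) h.
by rewrite !muleA -EFinM mulVf ?mul1e// gt_eqF// pi_gt0.
Qed.

End root_ray_integral.

(** * Identification of the limit densities *)

Section limit_densities.
Context (R : realType) (b : nat).
Hypothesis b_gt1 : (1 < b)%N.
Context (L : set R[i]).
Hypothesis hL : unimodular_lattice L.
Variable f : R[i] -> R.
Hypothesis tf : testfun f.
Local Notation b_gt0 := (ltnW b_gt1).
Local Notation mu := (@lebesgue_measure R).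
Local Notation Leb := (lebesgue_complex R).
Local Notation cop := (@complex_of_plane R).
Local Notation P := (plane R).
Local Notation alpha := (b%:R^-1 : R).
Local Notation q := ((1 - alpha)^-1 : R).
Implicit Types (p y z : R[i]).

Let f0 z : 0 <= f z. Proof. by case: tf. Qed.
Let bR : 0 < b%:R :> R. Proof. by rewrite ltr0n b_gt0. Qed.
Let a1 : 0 < 1 - alpha. Proof. by rewrite subr_gt0 invf_lt1 ?bR// ltr1n. Qed.
Let q0 : 0 < q. Proof. by rewrite invr_gt0 a1. Qed.

(** With [c = (alpha |p|) ^ 2] and [s = |z| ^ 2], the condition [c <= s] reads [|p| <= |z| / alpha],
    and [s ^ (- q - 1)] yields the power of [|z|]. By [|z| <= K], every such [p != 0] is a short
    vector. *)
Lemma ray_weight_density (K : R) z : 0 < normc z <= K ->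
  \sum_(p \in short_vectors b L K) ray_weight b (normc (p / b%:R) ^+ 2) (normc z ^+ 2) =
  correlation_density b (1 - alpha) L z.
Proof.
move=> /andP[z0 zK]; rewrite /correlation_density ltxx -[z == 0]negbK -normc_gt0 z0/=.
have K0 : 0 < K := lt_le_trans z0 zK.
have [C C0 /(_ 0 (b%:R * K))] := lattice_count hL.
rewrite mulr_ge0 ?(ltW bR) ?(ltW K0)// => /(_ isT)[].
have -> : [set p | L p /\ normc (p - 0) <= b%:R * K] = [set p | L p /\ normc p <= b%:R * K].
  by apply/seteqP; split => p /=; rewrite subr0.
set S := [set p | L p /\ normc p <= b%:R * K] => S_fin _.
pose W p := ray_weight b (normc (p / b%:R) ^+ 2) (normc z ^+ 2).
have Wp p : normc (p / b%:R) = normc p / b%:R.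
  by rewrite normcM normcV normc_nat.
have ZS : [set p | L p /\ normc p <= normc z / b%:R^-1] `<=` S.
  move=> p [Lp]; rewrite invrK => pz; split => //.
  by rewrite (le_trans pz)// mulrC ler_pM2l.
rewrite (@fsbig_widen _ _ _ _ (short_vectors b L K) S W); last 2 first.
- by move=> p [].
- move=> p [[Lp pK]] /= np; rewrite /W.
  (* The density also sums over [p = 0], where the weight vanishes because [0 ^ q = 0]. *)
  have -> : p = 0 by apply/eqP/negPn/negP => pn; apply: np.
  by rewrite mul0r normc0 expr0n /ray_weight/= powR0 ?gt_eqF// mulr0 mul0r if_same.
rewrite -(@fsbig_widen _ _ _ _ _ S W ZS); last first.
  move=> p [[Lp pK]] /= /not_andP[//|/negP]; rewrite invrK -ltNge => zp.
  rewrite /W /ray_weight Wp ifF//; apply/negbTE; rewrite -ltNge.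
  by rewrite ltrXn2r ?divr_ge0 ?normc_ge0 ?(ltW bR)//= ltr_pdivlMr.
rewrite mulr_fsumr; apply: eq_fsbigr => p; rewrite inE/= invrK => -[_ pz].
rewrite /W /ray_weight ifT; last first.
  by rewrite Wp lerXn2r ?nnegrE ?divr_ge0 ?normc_ge0 ?(ltW bR)// ler_pdivrMr.
rewrite Wp -!powR_mulrn ?divr_ge0 ?normc_ge0 ?(ltW bR)// -!powRrM.
rewrite powRM ?normc_ge0 ?invr_ge0 ?(ltW bR)//.
have -> : 2%:R * (- q - 1) = - ((4 - 2 * alpha) / (1 - alpha)).
  have aux a : 1 - a != 0 -> 2 * (- (1 - a)^-1 - 1) = - ((4 - 2 * a) / (1 - a)) :> R.
    by move=> h; field.
  by apply: aux; rewrite gt_eqF.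
by rewrite -/(2 / (1 - alpha)); ring.
Qed.

(** The integral is computed term by term over the finitely many short vectors; [alpha] cancels the
    factor [b] of [ray_integral]. *)
Lemma integral_critical :
  (alpha%:E * \int[Leb]_w (punctured (main_term b_gt0 L f 1) (cop w))%:E =
   \int[Leb]_w (f (cop w) * correlation_density b (1 - alpha) L (cop w))%:E)%E.
Proof.
have [K K0 fK] : bounded_supp f by case: tf.
set S := short_vectors b L K;
  have S_fin : finite_set S by exact: (short_vectors_finite b_gt0 hL K0).
have mW (c : R) : measurable_fun [set: P] (fun w => f (cop w) * ray_weight b c (sqn w)).
  apply: measurable_funM; first exact: (testfun_measurable tf).
  exact: (measurableT_comp (@measurable_ray_weight R b c) (@measurable_sqn R)).
have W0 (c s : R) : 0 <= ray_weight b c s by exact: ray_weight_ge0.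
transitivity (alpha%:E * \int[Leb]_w \sum_(p \in S)
    (punctured (ray_sum b_gt1 f (p / b%:R)) (cop w))%:E)%E.
  congr (_ * _)%E; apply: eq_integral => w _; rewrite fsumEFin//; congr EFin.
  rewrite /punctured; case: ifPn => [/andP[w0 w1]|_]; last by rewrite fsbig1.
  by rewrite (main_term1E b_gt0 L K0 fK) -?normc_gt0 ?(ltW w1).
rewrite ge0_integral_fsum//; last 2 first.
- by move=> p; apply/measurable_EFinP; exact: ray_sum_measurable.
- by move=> p w _; rewrite lee_fin /punctured; case: ifP => // _; exact: ray_sum_ge0.
transitivity (alpha%:E * \sum_(p \in S) (b%:R%:E * \int[Leb]_w
    (f (cop w) * ray_weight b (normc (p / b%:R) ^+ 2) (sqn w))%:E))%E.
  congr (_ * _)%E; apply: eq_fsbigr => p; rewrite inE => -[_ p0 _].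
  by rewrite ray_integral// mulf_neq0// invr_eq0 pnatr_eq0 -lt0n b_gt0.
rewrite -ge0_mule_fsumr; last first.
  by move=> p; apply: integral_ge0 => w _; rewrite lee_fin mulr_ge0.
rewrite muleA -EFinM mulVf ?gt_eqF// mul1e -ge0_integral_fsum//; last 2 first.
- by move=> p; apply/measurable_EFinP.
- by move=> p w _; rewrite lee_fin mulr_ge0.
apply: eq_integral => w _; rewrite fsumEFin// -mulr_fsumr; congr EFin.
have [Kw|wK] := ltP K (normc (cop w)); first by rewrite fK// !mul0r.
have [w0|w0] := eqVneq (cop w) 0; last first.
  by rewrite sqnE ray_weight_density// normc_gt0 w0.
(* At the origin the density is 0 by convention, and so is each weight, since [s = 0] lies below
   [c > 0]. *)
congr (_ * _); rewrite /correlation_density ltxx w0 eqxx fsbig1// => p [_ p0 _].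
rewrite sqnE w0 normc0 expr0n /ray_weight/= ifF//; apply/negbTE; rewrite -ltNge.
by rewrite exprn_gt0// normc_gt0 mulf_neq0// invr_eq0 pnatr_eq0 -lt0n b_gt0.
Qed.

(** In the variable [r = |y| ^ 2] the function is a multiple of [r ^ (1 - alpha)] on the unit
    interval, whose integral is [1 / (2 - alpha)]; then [alpha b ^ 3 = alpha ^ (-2)]. *)
Lemma integral_subcritical :
  (alpha%:E * \int[Leb]_w (punctured (radial_density b f) (cop w))%:E =
   (pi / (alpha ^+ 2 * (2 - alpha)))%:E * (cintr f)%:E)%E.
Proof.
set c := b%:R ^+ 3 * cintr f.
have c0 : 0 <= c.
  by rewrite mulr_ge0 ?exprn_ge0 ?(ltW bR)//; apply: Rintegral_ge0 => w _ /=.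
pose g (s : R) : R := if 0 < s < 1 then c * s `^ (1 - alpha) else 0.
have g0 s : 0 <= g s by rewrite /g; case: ifP => // _; rewrite mulr_ge0 ?powR_ge0.
have mp : measurable_fun [set: R] (fun s : R => c * s `^ (1 - alpha)).
  by apply: measurable_funM => //; exact: measurable_powR.
have mg : measurable_fun [set: R] g.
  apply: measurable_fun_ifT => //.
  by apply: measurable_and; apply: measurable_fun_ltr.
transitivity (alpha%:E * \int[Leb]_w (g (sqn w))%:E)%E.
  congr (_ * _)%E; apply: eq_integral => w _; congr EFin.
  have nw : (0 < sqn w < 1) = (0 < normc (cop w) < 1).
    rewrite sqnE; move: (cop w) => y.
    by rewrite exprn_even_gt0//= normc_eq0 -normc_gt0 expr_lt1// normc_ge0.
  rewrite /punctured /g nw; case: ifPn => // /andP[w0 _].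
  rewrite /radial_density -/c; congr (_ * _); rewrite sqnE; move: w0.
  move: (cop w) => y y0; set r := b.-root y.
  have /(congr1 (@normc R)) := rootCK b_gt0 y; rewrite normcX -/r => <-.
  rewrite -exprM -!powR_mulrn ?normc_ge0// -powRrM; congr (_ `^ _).
  rewrite !natrM -subn1 natrB ?b_gt0//.
  by field; rewrite gt_eqF.
rewrite (@ge0_integral_radial R (fun s => (g s)%:E)); last 2 first.
- exact/measurable_EFinP.
- by move=> s; rewrite lee_fin.
have -> : (\int[mu]_(x in `[0%R, +oo[) (g x)%:E = (c / (2 - alpha))%:E)%E.
  transitivity (\int[mu]_(s in `[0%R, 1%R]) (c * s `^ (1 - alpha))%:E)%E.
    rewrite -integral_itv_bndo_bndc; last first.
      by apply/measurable_EFinP; exact: measurable_funS mp.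
    rewrite integral_mkcond [RHS]integral_mkcond; apply: eq_integral => s _.
    rewrite /patch !mem_setE !in_itv/= andbT /g.
    have [s1|s1] := ltP s 1; last by rewrite !andbF if_same.
    rewrite !andbT; case: (ltgtP 0 s) => [//|//|<-].
    by rewrite powR0 ?mulr0// gt_eqF.
  under eq_integral do rewrite EFinM.
  rewrite ge0_integralZl//; last 2 first.
  - by apply/measurable_EFinP; apply: measurable_funTS; exact: measurable_powR.
  - by move=> s _; rewrite lee_fin powR_ge0.
  by rewrite integral_powR// -EFinM; congr (_ * _)%:E; congr (_^-1); ring.
rewrite -!EFinM /c; congr EFin.
have aux (a I : R) : a != 0 -> 2 - a != 0 ->
    a * (pi * (a^-1 ^+ 3 * I / (2 - a))) = pi / (a ^+ 2 * (2 - a)) * I.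
  by move=> h1 h2; field; rewrite h1 h2.
have := aux alpha (cintr f); rewrite invrK; apply; first by rewrite invr_eq0 gt_eqF.
by rewrite gt_eqF// -(addrA 1 1 (- alpha)) addr_gt0.
Qed.

End limit_densities.

Lemma powR_nat_unbounded (R : realType) (p Q : R) : 0 < p ->
  exists N0 : nat, forall N : nat, (N0 <= N)%N -> Q <= N%:R `^ p.
Proof.
move=> p0; exists (Num.truncn (`|Q| `^ p^-1)).+1 => N hN.
have lN : `|Q| `^ p^-1 <= N%:R.
  by apply/ltW; apply: lt_le_trans (truncnS_gt _) _; rewrite ler_nat.
apply: le_trans (ler_norm Q) _.
have := @ge0_ler_powR R p (ltW p0) _ _ _ _ lN.
rewrite -powRrM mulVf ?gt_eqF// powRr1//; apply; rewrite nnegrE ?powR_ge0//.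
Qed.

(** * Convergence for one nonnegative test function in the three regimes *)

Section test_limit.
Context (R : realType) (b : nat).
Hypothesis b_gt0 : (0 < b)%N.
Context (L : set R[i]) (z0 : R[i]) (gamma : R).
Hypothesis hL : unimodular_lattice L.
Hypothesis gamma0 : 0 < gamma.
Variable f : R[i] -> R.
Hypothesis tf : testfun f.
Local Notation Leb := (lebesgue_complex R).
Local Notation cop := (@complex_of_plane R).
Local Notation P := (plane R).
Local Notation alpha := (b%:R^-1 : R).
Local Notation rho := (correlation_density b gamma L).
Implicit Types (p y z m : R[i]).

Let f0 z : 0 <= f z. Proof. by case: tf. Qed.
Let bR : 0 < b%:R :> R. Proof. by rewrite ltr0n. Qed.
Let alpha0 : 0 < alpha. Proof. by rewrite invr_gt0 bR. Qed.
Let A (N : nat) : R := N%:R `^ alpha.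
Let G (N : nat) : R := N%:R `^ gamma.
Let t (N : nat) : R := N%:R `^ (gamma + alpha - 1).

Let N_gt0 (N : nat) : (0 < N)%N -> 0 < N%:R :> R. Proof. by rewrite ltr0n. Qed.
Let A0 N : (0 < N)%N -> 0 < A N. Proof. by move=> h; rewrite powR_gt0 ?N_gt0. Qed.
Let G0 N : (0 < N)%N -> 0 < G N. Proof. by move=> h; rewrite powR_gt0 ?N_gt0. Qed.
Let t0 N : (0 < N)%N -> 0 < t N. Proof. by move=> h; rewrite powR_gt0 ?N_gt0. Qed.

Let AN N : (0 < N)%N -> A N ^+ b = N%:R.
Proof.
move=> h; rewrite -powR_mulrn ?powR_ge0// -powRrM mulVf ?gt_eqF// powRr1//.
Qed.

Let GAE N : (0 < N)%N -> G N * A N = N%:R `^ (gamma + alpha).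
Proof. by move=> h; rewrite powRD//; apply/implyP => _; rewrite gt_eqF// N_gt0. Qed.

Let GA N : (0 < N)%N -> G N * A N = t N * N%:R.
Proof.
move=> h; rewrite GAE// -[in RHS](@powRr1 _ N%:R)// /t -powRD.
  by rewrite subrK.
by apply/implyP => _; rewrite gt_eqF// N_gt0.
Qed.

Let GAoo (Q : R) : exists N0, forall N, (N0 <= N)%N -> Q <= G N * A N.
Proof.
have [N0 hN0] := powR_nat_unbounded Q (addr_gt0 gamma0 alpha0).
exists N0.+1 => N hN; rewrite GAE ?(leq_ltn_trans _ hN)//.
by apply: hN0; exact: ltnW.
Qed.

Definition correlation_sum (N : nat) : R :=
  alpha / N%:R `^ (2 * (2 - alpha - gamma)) *
  \sum_(m \in grid_ball L z0 N%:R) inner_sum b_gt0 L z0 f N%:R (N%:R `^ gamma) m.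

(** [N ^ (- 2 (2 - alpha - gamma)) = N ^ (-2) t ^ 2]: the normalisation is that of a Riemann sum
    over the disc, times the weight [t ^ 2] of the main term. *)
Let correlation_sumE N : (0 < N)%N -> correlation_sum N =
  alpha * (N%:R ^- 2 * \sum_(m \in grid_ball L z0 N%:R)
    t N ^+ 2 * inner_sum b_gt0 L z0 f N%:R (G N) m).
Proof.
move=> h; rewrite /correlation_sum -mulr_fsumr -mulrA; congr (_ * _); rewrite mulrA.
congr (_ * _); rewrite /t -!powR_mulrn ?powR_ge0// -powRrM -!powRN -powRD.
  by congr (_ `^ _); ring.
by apply/implyP => _; rewrite gt_eqF// N_gt0.
Qed.

Let limit_with (H : R[i] -> R) (C : R) : gamma <= 1 - alpha ->
  (forall y, 0 <= H y) -> (forall y, 0 < normc y <= 1 -> H y <= C) -> annulus_cont H ->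
  (forall eta e : R, 0 < eta -> 0 < e -> exists N0, forall N, (N0 <= N)%N ->
    forall y, eta <= normc y <= 1 -> `|main_term b_gt0 L f (t N) y - H y| <= e) ->
  (alpha%:E * \int[Leb]_w (punctured H (cop w))%:E =
   \int[Leb]_w (f (cop w) * rho (cop w))%:E)%E ->
  (\int[Leb]_w (f (cop w) * rho (cop w))%:E)%E \is a fin_num /\
  forall e : R, 0 < e -> exists N0, forall N, (N0 <= N)%N ->
    `|correlation_sum N - cintr (fun z => f z * rho z)| <= e.
Proof.
move=> ga H0 HC cH Hlim HI.
have tH eta : 0 < eta -> 2 * eta <= 1 -> testfun (fun y => cut eta y * H y).
  exact: (testfun_cutM H0 HC cH).
have C0 : 0 <= C.
  by apply: le_trans (HC 1 _); rewrite ?H0// normc1 ltr01 lexx.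
have fin : (\int[Leb]_w (punctured H (cop w))%:E)%E \is a fin_num.
  rewrite ge0_fin_numE; last first.
    by apply: integral_ge0 => w _; rewrite lee_fin /punctured; case: ifP.
  apply: (@le_lt_trans _ _ (C * (pi * 1 ^+ 2))%:E); last by rewrite ltry.
  apply: le_cint_bound => //; first exact: punctured_measurable.
  - move=> y; rewrite /punctured; case: ifPn => [/andP[y0 y1]|_]; last by rewrite lexx.
    by rewrite H0 HC// y0 ltW.
  - by move=> y y1; rewrite /punctured [X in _ && X]ltNge (ltW y1) andbF.
have cE : cintr (fun z => f z * rho z) = alpha * cintr (punctured H).
  by rewrite /cintr /Rintegral/= -HI -(fineK fin) -EFinM.
split; first by rewrite -HI -(fineK fin) -EFinM.
move=> e e0; have tle N : (0 < N)%N -> 0 < t N <= 1.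
  move=> h; rewrite t0//= /t -[leRHS](powRr0 N%:R) ler_powR ?ler1n//.
  by rewrite subr_le0 -lerBrDr.
have [N0 h] := @pair_sum_limit R b b_gt0 L z0 hL f tf A G t H C A0 G0 tle AN GA GAoo
  H0 HC tH Hlim e e0.
exists N0.+1 => N hN; rewrite correlation_sumE ?(leq_ltn_trans _ hN)//.
rewrite cE -mulrBr normrM gtr0_norm//; apply: le_trans (h N (ltnW hN)).
by rewrite ler_piMl// invf_le1// ler1n.
Qed.

Lemma test_limit :
  (\int[Leb]_w (f (cop w) * rho (cop w))%:E)%E \is a fin_num /\
  forall e : R, 0 < e -> exists N0, forall N, (N0 <= N)%N ->
    `|correlation_sum N - cintr (fun z => f z * rho z)| <= e.
Proof.
have [K K0 fK] : bounded_supp f by case: tf.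
have [ga|ga|ga] := ltgtP gamma (1 - alpha).
(* For [b = 1] the threshold [1 - alpha] would be 0, below [gamma]. *)
- have b1 : (1 < b)%N.
    have : 0 < 1 - alpha := lt_trans gamma0 ga.
    by rewrite subr_gt0 invf_lt1// ltr1n.
  apply: (@limit_with (radial_density b f) (b%:R ^+ 3 * cintr f)) => //.
  + exact: ltW.
  + exact: radial_density_ge0.
  + by move=> y; exact: radial_density_bounded.
  + exact: radial_density_annulus.
  + move=> eta e eta0 e0; have [d d0 h] := main_term_lim b_gt0 hL tf eta0 e0.
    have ep : 0 < 1 - alpha - gamma by rewrite subr_gt0.
    have [N0 hN0] := powR_nat_unbounded (d^-1 + 1) ep.
    exists N0.+1 => N hN y yN; apply: h => //; rewrite t0 ?(leq_ltn_trans _ hN)//=.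
    have -> : t N = (N%:R `^ (1 - alpha - gamma))^-1.
      by rewrite /t -powRN; congr (_ `^ _); ring.
    rewrite invf_plt ?posrE ?powR_gt0 ?N_gt0 ?(leq_ltn_trans _ hN)//.
    by apply: lt_le_trans (hN0 N (ltnW hN)); rewrite ltrDl.
  + rewrite integral_subcritical// -cintrE// -ge0_integralZl//; last 3 first.
    * by apply/measurable_EFinP; exact: (testfun_measurable tf).
    * by move=> w _; rewrite lee_fin.
    * by rewrite lee_fin divr_ge0 ?pi_ge0// mulr_ge0 ?exprn_ge0 ?(ltW alpha0)//
        subr_ge0 (@le_trans _ _ 1) ?invf_le1 ?ler1n.
    apply: eq_integral => w _; rewrite -EFinM mulrC; congr (_ * _)%:E.
    by rewrite /correlation_density ltNge (ltW ga)/= ga.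
- have r0 z : rho z = 0 by rewrite /correlation_density ga.
  have i0 : (\int[Leb]_w (f (cop w) * rho (cop w))%:E = 0)%E.
    by apply: integral0_eq => w _; rewrite r0 mulr0.
  split; first by rewrite i0.
  move=> e e0; have c0 : cintr (fun z => f z * rho z) = 0.
    by rewrite /cintr /Rintegral/= i0.
  (* Here [t N] tends to infinity, so [b K / t N] drops below the minimal distance [d], and from
     then on every pair sum is exactly 0. *)
  have [d d0 gap] := lattice_gap hL.
  have ep : 0 < gamma + alpha - 1 by rewrite subr_gt0 -ltrBlDr.
  have [N0 hN0] := powR_nat_unbounded (b%:R * K / d + 1) ep.
  exists N0.+1 => N hN; rewrite c0 subr0 /correlation_sum fsbig1 ?mulr0 ?normr0 ?(ltW e0)//.
  have N1 : (0 < N)%N by exact: leq_ltn_trans hN.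
  move=> m [Lm /andP[m0 mN]]; rewrite /inner_sum fsbig1// => m' [[Lm' /andP[m'0 m'N]] mm'].
  apply: (root_pair_sum_far b_gt0 fK (A0 N1) (G0 N1) (t0 N1) (AN N1) (GA N1)) => //.
  have : d <= normc (m' - m).
    apply: gap; last by rewrite subr_eq0; exact/eqP.
    by rewrite (_ : m' - m = (m' - z0) - (m - z0)); [exact: latticeB | ring].
  apply: lt_le_trans; rewrite ltr_pdivrMr ?t0// [d * _]mulrC -ltr_pdivrMr//.
  by apply: lt_le_trans (hN0 N (ltnW hN)); rewrite ltrDl.
- have b1 : (1 < b)%N.
    have : 0 < 1 - alpha by rewrite -ga.
    by rewrite subr_gt0 invf_lt1// ltr1n.
  have [C HC] := main_term1_bounded b_gt0 hL tf K0 fK.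
  apply: (@limit_with (main_term b_gt0 L f 1) C) => //.
  + by rewrite ga.
  + by move=> y; exact: main_term_ge0.
  + exact: (main_term1_annulus b_gt0 hL tf K0 fK).
  + move=> eta e eta0 e0; exists 0%N => N _ y _.
    have -> : t N = 1 by rewrite /t ga subrK subrr powRr0.
    by rewrite subrr normr0 ltW.
  + by rewrite ga -(integral_critical b1 hL tf) (bool_irrelevance (ltnW b1) b_gt0).
Qed.

End test_limit.

(** * The correlation measures as finite sums *)

(** Over a finite index set the measure is the [msum] of a list of measures, for which the integral
    is additive; [i0] is the default value of [nth]. *)
Lemma ge0_integral_mesum (R : realType) d (T : measurableType d) (I : choiceType)
    (i0 : I) (D : set I) (m : I -> {measure set T -> \bar R}) (g : T -> \bar R) :
  finite_set D -> measurable_fun [set: T] g -> (forall x, (0 <= g x)%E) ->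
  (\int[mesum D m]_x g x = \sum_(i \in D) \int[m i]_x g x)%E.
Proof.
move=> D_fin mg g0; pose s := finmap.enum_fset (fset_set D).
rewrite (@eq_measure_integral _ _ _ _ (msum (fun k => m (nth i0 s k)) (size s))).
  rewrite ge0_integral_measure_sum// fsbig_finite//= (big_nth i0) big_mkord.
  by [].
move=> A mA _; rewrite /= /mesum esum_fset// fsbig_finite//= (big_nth i0) big_mkord.
by [].
Qed.

Section correlation_integral.
Context (R : realType) (b : nat).
Hypothesis b_gt0 : (0 < b)%N.
Context (L : set R[i]) (z0 : R[i]) (gamma : R).
Hypothesis hL : unimodular_lattice L.
Variable f : R[i] -> R.
Hypothesis tf : testfun f.
Local Notation cop := (@complex_of_plane R).
Local Notation poc := (@plane_of_complex R).
Local Notation P := (plane R).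
Local Notation alpha := (b%:R^-1 : R).
Local Notation Lambda := [set z0 + p | p in L].
Implicit Types (p y z m u v : R[i]).

Let f0 z : 0 <= f z. Proof. by case: tf. Qed.

Lemma grid_ballE (n : R) : grid_ball L z0 n = [set m | Lambda m /\ 0 < normc m <= n].
Proof.
apply/seteqP; split => m [Lm mn]; split => //.
  by exists (m - z0) => //; rewrite addrC subrK.
by case: Lm => p Lp <-; rewrite addrC addKr.
Qed.

Lemma correlation_pairsE N : correlation_pairs Lambda N =
  (grid_ball L z0 N%:R `*` grid_ball L z0 N%:R) `&` [set nm | nm.1 != nm.2].
Proof.
rewrite !grid_ballE; apply/seteqP; split => nm /=.
  by case=> h1 h2 h3 h4 h5; split => //; split; split.
by case=> -[[h1 h2] [h3 h4]] h5; split.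
Qed.

Lemma correlation_rootsE (m' m : R[i]) : m' != 0 -> m != 0 -> correlation_roots b (m', m) =
  [set u | u ^+ b = m] `*` [set v | v ^+ b = m'].
Proof.
move=> m'0 m0; apply/seteqP; split => uv /=; first by case.
case=> h1 h2; split => //=.
  by apply: contraNneq m0 => u0; rewrite -h1 u0 expr0n gtn_eqF.
by apply: contraNneq m'0 => u0; rewrite -h2 u0 expr0n gtn_eqF.
Qed.

Lemma correlation_roots_finite (nm : R[i] * R[i]) : finite_set (correlation_roots b nm).
Proof.
apply: (@sub_finite_set _ _ ([set u | u ^+ b = nm.2] `*` [set v | v ^+ b = nm.1])).
  by move=> uv [].
by apply: finite_setX; exact: finite_roots.
Qed.

Lemma correlation_pairs_finite N : finite_set (correlation_pairs Lambda N).
Proof.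
rewrite correlation_pairsE; apply: finite_setIl; apply: finite_setX; exact: grid_ball_finite.
Qed.

(** In a pair [(n, m)] the first root [u] belongs to [m] and the second root [v] to [n]; exchanging
    the sums puts [m] outside, as in [inner_sum]. *)
Lemma correlation_pair_sum N (c : R) :
  \sum_(nm \in correlation_pairs Lambda N) \sum_(uv \in correlation_roots b nm)
    f (c%:C * (uv.2 - uv.1)) =
  \sum_(m \in grid_ball L z0 N%:R) inner_sum b_gt0 L z0 f N%:R c m.
Proof.
have B_fin := grid_ball_finite z0 hL N%:R.
rewrite correlation_pairsE fsbig_mkcondr.
transitivity (\sum_(nm \in grid_ball L z0 N%:R `*` grid_ball L z0 N%:R)
    (fun m' m => if m' != m then root_pair_sum b_gt0 f c m m' else 0) nm.1 nm.2).
  apply: eq_fsbigr => -[m' m]; rewrite inE => -[[_ /= /andP[m'0 _]] [_ /= /andP[m0 _]]].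
  rewrite normc_gt0 in m0; rewrite normc_gt0 in m'0.
  have -> : ((m', m) \in [set nm | nm.1 != nm.2]) = (m' != m).
    by apply/idP/idP; rewrite inE.
  case: ifP => // _.
  rewrite correlation_rootsE// -(@pair_fsbig _ _ _ _ _ _ _ (fun u v => f (c%:C * (v - u))));
    last 2 first.
  - exact: finite_roots.
  - exact: finite_roots.
  rewrite (@fsbig_roots _ _ b_gt0)//; apply: eq_sum_roots => u _.
  by rewrite (@fsbig_roots _ _ b_gt0).
rewrite -(@pair_fsbig _ _ _ _ _ _ _
  (fun m' m => if m' != m then root_pair_sum b_gt0 f c m m' else 0))// exchange_fsbig//;
    apply: eq_fsbigr => m _.
rewrite /inner_sum setDE [RHS]fsbig_mkcondr; apply: eq_fsbigr => m' _.
rewrite (_ : (m' \in ~` [set m]) = (m' != m))//.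
by apply/idP/idP; rewrite inE/= => /eqP.
Qed.

Lemma correlation_integral N :
  (\int[pair_correlation b gamma Lambda N]_w (f (cop w))%:E =
   (correlation_sum b_gt0 L z0 gamma f N)%:E)%E.
Proof.
have mf : measurable_fun [set: P] (fun w => (f (cop w))%:E).
  by apply/measurable_EFinP; exact: (testfun_measurable tf).
have fE w : (0 <= (f (cop w))%:E)%E by rewrite lee_fin.
rewrite /pair_correlation ge0_integral_mscale//.
rewrite (ge0_integral_mesum (0, 0)) //; last exact: correlation_pairs_finite.
rewrite /correlation_sum [RHS]EFinM; congr (_ * _)%E; rewrite -correlation_pair_sum.
rewrite -[RHS]fsumEFin; last exact: correlation_pairs_finite.
apply: eq_fsbigr => nm _.
rewrite (ge0_integral_mesum (0, 0))//; last exact: correlation_roots_finite.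
rewrite -[RHS]fsumEFin; last exact: correlation_roots_finite.
apply: eq_fsbigr => uv _; rewrite integral_dirac// diracT mul1e.
by congr (f _)%:E; case: (_ * _).
Qed.

End correlation_integral.

(** * Continuous functions with compact support *)

Section complex_topology.
Context (R : realType).
Implicit Types (x y z w : R[i]).

(** A positive element of [R[i]] is real, and so is the norm of [z] in [R[i]], whose real part is
    [normc z]. *)
Lemma ltc_normc z (e : R[i]) : 0 < e -> (`|z| < e) = (normc z < complex.Re e).
Proof.
rewrite ltcE => /andP[/eqP/= e1 e2].
by rewrite /Num.norm/= ltcE/= -e1 eqxx/=.
Qed.

Lemma nbhs_normcP (x : R[i]^o) (A : set R[i]^o) :
  nbhs x A <-> exists2 r : R, 0 < r & forall y, normc (x - y) < r -> A y.
Proof.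
split=> [/nbhs_normP[e /= e0 eA]|[r r0 rA]].
  exists (complex.Re e); first by move: e0; rewrite ltcE => /andP[].
  by move=> y xy; apply: eA; rewrite /= ltc_normc.
apply/(nbhs_normP x A); exists r%:C; first by rewrite /= ltcR.
by move=> y; rewrite /= ltc_normc ?ltcR// => xy; exact: rA.
Qed.

(** In use, [phi] is the positive part of plus or minus a coordinate. Compactness of the closure [S]
    of the support gives a modulus of continuity valid at all points of [S]; two points outside [S]
    have the same value [phi 0 = 0]. *)
Lemma testfun_comp (f : R[i]^o -> R[i]^o) (phi : R[i] -> R) : continuous f ->
  compact (closure [set z | f z != 0]) ->
  (forall z, 0 <= phi z) -> phi 0 = 0 ->
  (forall z w, `|phi z - phi w| <= normc (z - w)) -> testfun (phi \o f).
Proof.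
move=> cf; set S := closure _ => /compact_near_coveringP cS phi0 phi00 lip.
have fS z : ~ S z -> f z = 0.
  by move=> nS; apply/eqP/negPn/negP => fz; apply: nS; exact: subset_closure.
have cfe z (e : R) : 0 < e ->
    exists2 r : R, 0 < r & forall w, normc (z - w) < r -> normc (f z - f w) < e.
  move=> e0; have : nbhs (f z) [set v | normc (f z - v) < e].
    by apply/nbhs_normcP; exists e.
  by move/(cf z)/nbhs_normcP.
split => [z|e e0|]; first exact: phi0.
- have e2 : 0 < e / 2 by rewrite divr_gt0.
  (* Compactness through near coverings: a property of [n] and [x] that holds near each point of [S]
     for large [n] holds on all of [S] for large [n]. Here it makes the radius [1 / (n + 1)]
     uniform. *)
  have : \forall n \near \oo, S `<=` (fun x =>
      forall w, normc (x - w) < n.+1%:R^-1 -> normc (f x - f w) < e).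
    apply: cS => x _; have [r r0 fr] := cfe x _ e2.
    have r2 : 0 < r / 2 by rewrite divr_gt0.
    exists ([set x' | normc (x - x') < r / 2], [set n | n.+1%:R^-1 < r / 2]).
      split => /=; first by apply/nbhs_normcP; exists (r / 2).
      near=> n; rewrite /= invf_plt ?posrE//.
      by near: n; exists (Num.truncn ((r / 2)^-1)) => // n /= hn;
        apply: lt_le_trans (truncnS_gt _) _; rewrite ler_nat.
    move=> [x' n] [/= xx' nr] w x'w.
    have h1 : normc (f x - f x') < e / 2 by apply: fr; apply: lt_trans xx' _;
      rewrite ltr_pdivrMr// ltr_pMr// ltr1n.
    have h2 : normc (f x - f w) < e / 2.
      apply: fr; rewrite (_ : x - w = (x - x') + (x' - w)); last by ring.
      apply: le_lt_trans (le_normcD _ _) _; rewrite [r]splitr ltrD//.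
      exact: lt_trans nr.
    rewrite (_ : f x' - f w = - (f x - f x') + (f x - f w)); last by ring.
    apply: le_lt_trans (le_normcD _ _) _; rewrite normcN [e]splitr ltrD//.
  move=> [n0 _ hn]; exists n0.+1%:R^-1; first by rewrite invr_gt0.
  move=> z w zw; have {}hn := hn n0 (leqnn _).
  have [Sz|nSz] := pselect (S z); first exact: le_lt_trans (lip _ _) (hn z Sz w zw).
  have [Sw|nSw] := pselect (S w).
    rewrite distrC; apply: le_lt_trans (lip _ _) _; apply: hn => //.
    by rewrite normcB.
  by rewrite /= !fS// subrr normr0.
- have : \forall n \near \oo, S `<=` (fun x => normc x < n%:R).
    apply: cS => x _; exists ([set x' | normc (x - x') < 1], [set n | normc x + 1 < n%:R]).
      split => /=; first by apply/nbhs_normcP; exists 1.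
      exists (Num.truncn (normc x + 1)).+1 => // n /= hn.
      by apply: lt_le_trans (truncnS_gt _) _; rewrite ler_nat.
    move=> [x' n] [/= xx' nr]; apply: le_lt_trans nr.
    rewrite (_ : x' = x - (x - x')); last by ring.
    by apply: le_trans (le_normcD _ _) _; rewrite normcN lerD2l ltW.
  move=> [n0 _ hn]; exists n0.+1%:R; first by [].
  move=> z zn; rewrite /= fS// => /(hn n0.+1 (leqnSn _)).
  by rewrite ltNge (ltW zn).
Unshelve. all: by end_near. Qed.

End complex_topology.

Lemma Rintegral_posneg (R : realType) d (T : measurableType d)
    (mu : {measure set T -> \bar R}) (g : T -> R) :
  (\int[mu]_x (Num.max (g x) 0)%:E)%E \is a fin_num ->
  (\int[mu]_x (Num.max (- g x) 0)%:E)%E \is a fin_num ->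
  Rintegral mu setT g = Rintegral mu setT (fun x => Num.max (g x) 0) -
                        Rintegral mu setT (fun x => Num.max (- g x) 0).
Proof.
move=> fp fn; rewrite /Rintegral -fineB//; congr fine.
rewrite integralE; congr (_ - _)%E; apply: eq_integral => x _.
  by rewrite funeposE EFin_max.
by rewrite funenegE EFin_max.
Qed.

Lemma correlation_density_ge0 (R : realType) (b : nat) (gamma : R) L z :
  (0 < b)%N -> 0 <= correlation_density b gamma L z.
Proof.
move=> b0; have bR : 0 < b%:R :> R by rewrite ltr0n.
have a1 : 0 <= 1 - b%:R^-1 :> R by rewrite subr_ge0 invf_le1// ler1n.
rewrite /correlation_density; case: ifP => // _; case: ifP => _.
  rewrite divr_ge0 ?pi_ge0// mulr_ge0 ?exprn_ge0 ?invr_ge0 ?(ltW bR)//.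
  by rewrite -(addrA 1 1) addr_ge0.
case: ifP => // _; rewrite !mulr_ge0 ?powR_ge0 ?invr_ge0//.
by apply: sumr_ge0 => i _; rewrite powR_ge0.
Qed.

(** * From nonnegative to complex test functions *)

Section real_limit.
Context (R : realType) (b : nat).
Hypothesis b_gt0 : (0 < b)%N.
Context (L : set R[i]) (z0 : R[i]) (gamma : R).
Hypothesis hL : unimodular_lattice L.
Hypothesis gamma0 : 0 < gamma.
Local Notation cop := (@complex_of_plane R).
Local Notation rho := (correlation_density b gamma L).
Local Notation Lambda := [set z0 + p | p in L].

Lemma real_limit (g : R[i] -> R) : testfun (fun z => Num.max (g z) 0) ->
  testfun (fun z => Num.max (- g z) 0) ->
  forall e : R, 0 < e -> exists N0, forall N, (N0 <= N)%N ->
    `|Rintegral (pair_correlation b gamma Lambda N) setT (g \o cop) -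
      Rintegral (lebesgue_complex R) setT (fun w => g (cop w) * rho (cop w))| <= e.
Proof.
move=> tp tn e e0; have e2 : 0 < e / 2 by rewrite divr_gt0.
have [fp /(_ _ e2)[N1 h1]] := test_limit b_gt0 z0 hL gamma0 tp.
have [fn /(_ _ e2)[N2 h2]] := test_limit b_gt0 z0 hL gamma0 tn.
exists (maxn N1 N2) => N; rewrite geq_max => /andP[/h1 {}h1 /h2 {}h2].
have cp := correlation_integral b_gt0 z0 gamma hL tp N.
have cn := correlation_integral b_gt0 z0 gamma hL tn N.
(* Since [rho] is nonnegative, the positive and negative parts of [g rho] are those of [g] times
   [rho]. *)
have maxM (x : R) z : Num.max (x * rho z) 0 = Num.max x 0 * rho z.
  by rewrite maxr_pMl ?mul0r// correlation_density_ge0.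
rewrite Rintegral_posneg; [|by rewrite /= cp|by rewrite /= cn].
rewrite [X in _ - X]Rintegral_posneg; last 2 first.
- by under eq_integral do rewrite maxM.
- by under eq_integral do rewrite -mulNr maxM.
have -> : Rintegral (pair_correlation b gamma Lambda N) setT
    (fun w => Num.max ((g \o cop) w) 0) =
    correlation_sum b_gt0 L z0 gamma (fun z => Num.max (g z) 0) N.
  by rewrite /Rintegral /= cp.
have -> : Rintegral (pair_correlation b gamma Lambda N) setT
    (fun w => Num.max (- (g \o cop) w) 0) =
    correlation_sum b_gt0 L z0 gamma (fun z => Num.max (- g z) 0) N.
  by rewrite /Rintegral /= cn.
have -> : Rintegral (lebesgue_complex R) setT
    (fun w => Num.max (g (cop w) * rho (cop w)) 0) =
    cintr (fun z => Num.max (g z) 0 * rho z).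
  by congr fine; apply: eq_integral => w _; rewrite maxM.
have -> : Rintegral (lebesgue_complex R) setT
    (fun w => Num.max (- (g (cop w) * rho (cop w))) 0) =
    cintr (fun z => Num.max (- g z) 0 * rho z).
  by congr fine; apply: eq_integral => w _; rewrite -mulNr maxM.
move: h1 h2; set a1 := correlation_sum _ _ _ _ _ _; set a2 := cintr _.
set a3 := correlation_sum _ _ _ _ _ _; set a4 := cintr _ => h1 h2.
rewrite (_ : a1 - a3 - (a2 - a4) = (a1 - a2) - (a3 - a4)); last by ring.
by apply: le_trans (ler_normB _ _) _; rewrite [e]splitr lerD.
Qed.

End real_limit.

Theorem theorem1p1 (R : realType) (b : nat) (hb : (1 <= b)%N)
    (Lambda L : set R[i]) (z0 : R[i])
    (hL : unimodular_lattice L) (hLambda : Lambda = [set z0 + p | p in L])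
    (gamma : R) (hgamma : 0 < gamma < 1)
    (f : R[i]^o -> R[i]^o) (fcont : continuous f)
    (fsupp : compact (closure [set z | f z != 0])) :
  cintegral (pair_correlation b gamma Lambda N) f @[N --> \oo] -->
  (cintegral (lebesgue_complex R)
     (fun z => f z * (correlation_density b gamma L z)%:C) : R[i]^o).
Proof.
case/andP: hgamma => gamma0 _.
have tp (phi : R[i] -> R) : phi 0 = 0 -> (forall z w, `|phi z - phi w| <= normc (z - w)) ->
    testfun (fun z => Num.max (phi (f z)) 0).
  move=> p0 plip; apply: (@testfun_comp _ f (fun z => Num.max (phi z) 0)) => //.
  - by move=> z; rewrite le_max lexx orbT.
  - by rewrite p0 maxxx.
  - move=> z w; apply: le_trans (plip z w).
    (* The positive part is 1-Lipschitz, by cases on the two signs. *)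
    by case: (leP (phi z) 0) => hz; case: (leP (phi w) 0) => hw; rewrite ler_norml;
      have := ler_norm (phi z - phi w); have := lerNnormlW (lexx `|phi z - phi w|); lra.
have tn (phi : R[i] -> R) : phi 0 = 0 -> (forall z w, `|phi z - phi w| <= normc (z - w)) ->
    testfun (fun z => Num.max (- phi (f z)) 0).
  move=> p0 plip; apply: (tp (fun z => - phi z)); first by rewrite p0 oppr0.
  by move=> z w; rewrite -opprD normrN; exact: plip.
have Re_lip (z w : R[i]) : `|complex.Re z - complex.Re w| <= normc (z - w).
  by rewrite -raddfB; exact: ler_Re_normc.
have Im_lip (z w : R[i]) : `|complex.Im z - complex.Im w| <= normc (z - w).
  by rewrite -raddfB; exact: ler_Im_normc.
have limRe := @real_limit R b hb L z0 gamma hL gamma0 (fun z => complex.Re (f z))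
  (tp (fun z => complex.Re z) erefl Re_lip) (tn (fun z => complex.Re z) erefl Re_lip).
have limIm := @real_limit R b hb L z0 gamma hL gamma0 (fun z => complex.Im (f z))
  (tp (fun z => complex.Im z) erefl Im_lip) (tn (fun z => complex.Im z) erefl Im_lip).
rewrite hLambda; move=> A /nbhs_normcP[r r0 rA].
(* A third of [r] for each coordinate leaves room for the strict inequality. *)
have r3 : 0 < r / 3 by rewrite divr_gt0.
have [N1 h1] := limRe _ r3; have [N2 h2] := limIm _ r3.
exists (maxn N1 N2) => // N; rewrite /= geq_max => /andP[/h1 {}h1 /h2 {}h2].
apply: rA; rewrite normcB; apply: le_lt_trans (ler_normc_ReIm _) _.
apply: (@le_lt_trans _ _ (r / 3 + r / 3)); last by lra.
apply: lerD.
  rewrite (_ : complex.Re (_ - _) = complex.Re (cintegral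
    (pair_correlation b gamma [set z0 + p | p in L] N) f) - complex.Re (cintegral
    (lebesgue_complex R) (fun z => f z * (correlation_density b gamma L z)%:C)))//.
  apply: le_trans h1; rewrite le_eqVlt; apply/orP; left; apply/eqP.
  congr (`| _ - _|); congr fine; apply: eq_integral => w _.
  by case: (f _) => x y /=; rewrite mulr0 subr0.
rewrite (_ : complex.Im (_ - _) = complex.Im (cintegral
  (pair_correlation b gamma [set z0 + p | p in L] N) f) - complex.Im (cintegral
  (lebesgue_complex R) (fun z => f z * (correlation_density b gamma L z)%:C)))//.
apply: le_trans h2; rewrite le_eqVlt; apply/orP; left; apply/eqP.
congr (`| _ - _|); congr fine; apply: eq_integral => w _.
by case: (f _) => x y /=; rewrite mulr0 add0r.
Qed.
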